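(* Let $L$ be an algebraically closed field of characteristic zero, $\Lambda$ a finitely generated free abelian group, $\psi\in\mathrm{Aut}(\Lambda)$ an elliptic automorphism of finite order $n$, $\Delta=\Lambda\rtimes\langle u\rangle$ where $\langle u\rangle$ is infinite cyclic and $u\lambda u^{-1}=\psi(\lambda)$, and $B=L[\Delta]$. Let $M$ be a finitely generated $u$-locally finite $B$-module. (a) For every $\lambda\in\Lambda$, $\mathrm{Tr}_{gen}(\lambda u\lambda^{-1},M)=\mathrm{Tr}_{gen}(u,M)$. (b) Each group homology $H_i(\Lambda,M)$ is a finite-dimensional representation of $\langle u\rangle$ over $L$, and $$\sum_i(-1)^i\,\mathrm{Tr}(u,H_i(\Lambda,M))=\sum_{\lambda}\mathrm{Tr}_{gen}(\lambda u,M),$$ where $\lambda u$ runs over a set of representatives of the $\Lambda$-conjugacy classes in $\Lambda u\subseteq\Delta$.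
   Context: $\psi$ is elliptic if $\Lambda^\psi=\{1\}$ (the group $\Lambda$ is written multiplicatively inside $\Delta$). A $B$-module is $v$-locally finite ($v\in\Delta$) if it is a union of $v$-invariant finite-dimensional $L$-subspaces. Put $A=L[\Lambda]$, so $B=L[\Delta]=A\{u^{\pm1};\psi\}$ (with $ua=\psi(a)u$). **Generalized trace:** since $\Lambda/(\psi-1)\Lambda$ is finite, there is a unique homomorphism $\mathrm{Tr}_{gen}(u,-)$ from the Grothendieck group of finitely generated $u$-locally finite $B$-modules to $L$ such that (i) $\mathrm{Tr}_{gen}(u,V\otimes_LM)=\mathrm{Tr}(u,V)\mathrm{Tr}_{gen}(u,M)$ for every finite-dimensional representation $V$ of $\langle u\rangle$ (where $\lambda\in\Lambda$ acts on $V\otimes M$ by $1\otimes\lambda$ and $u$ by $u\otimes u$), and (ii) $\mathrm{Tr}_{gen}(u,M)=\mathrm{Tr}(u,M)$ if $\dim_LM<\infty$. For $\lambda\in\Lambda$ one has $(\lambda u)^n=u^n$ in $\Delta$, so a $u$-locally finite module is $\lambda u$-locally finite; $\mathrm{Tr}_{gen}(\lambda u,M)$ is defined in the same way with $u$ replaced by $\lambda u$ (i.e. using the automorphism of $B$ which is the identity on $A$ and sends $u\mapsto\lambda u$). *)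

(* Defs.v *)
From HB Require Import structures.
From mathcomp Require Import all_boot all_order all_algebra.
From mathcomp Require Import generic_quotient ring_quotient finmap.
From mathcomp Require Import boolp classical_sets functions cardinality fsbigop.

Set Implicit Arguments.
Unset Strict Implicit.
Unset Printing Implicit Defensive.

Import GRing.Theory.
Local Open Scope classical_set_scope.
Local Open Scope ring_scope.

Section FiniteDim.
Variable L : fieldType.
Implicit Types V : lmodType L.

Definition findim V : Prop :=
  exists d (phi : {linear V -> 'rV[L]_d}), bijective phi.

Definition fd_subspace V (W : set V) : Prop :=
  exists d (phi : {linear 'rV[L]_d -> V}), W = range phi.

(* [A] acts on row vectors, so it is the transpose of the usual matrix of [f]
   in the basis given by [phi]. *)
Definition is_trace V (f : V -> V) (t : L) : Prop :=
  exists d (phi : {linear V -> 'rV[L]_d}) (A : 'M[L]_d),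
    [/\ bijective phi, forall v, phi (f v) = phi v *m A & t = \tr A].

(* The value is 0 (by convention) when [V] is not finite-dimensional. *)
Definition trace V (f : {linear V -> V}) : L := xget 0 [set t | is_trace f t].

End FiniteDim.

Section IntIter.
Variables (T : Type) (f g : T -> T).

(* [f] iterated [i] times, where [g] is meant to be the inverse of [f]. *)
Definition ziter (i : int) (x : T) : T :=
  match i with Posz k => iter k f x | Negz k => iter k.+1 g x end.

Hypotheses (fK : cancel f g) (gK : cancel g f).

Lemma ziterS i x : ziter (1 + i) x = f (ziter i x).
Proof.
case: i => [k|[|k]]; first by [].
  by rewrite /= gK.
have -> : 1 + Negz k.+1 = Negz k by rewrite !NegzE -[k.+2]addn1 PoszD opprD addrCA subrr addr0.
by rewrite /= gK.
Qed.

Lemma ziterP i x : ziter (- 1 + i) x = g (ziter i x).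
Proof.
have -> : ziter i x = f (ziter (- 1 + i) x) by rewrite -ziterS addrA subrr add0r.
by rewrite fK.
Qed.

Lemma ziterD i j x : ziter (i + j) x = ziter i (ziter j x).
Proof.
elim: i => [|k IH|k IH]; first by rewrite add0r.
  by rewrite intS -addrA !ziterS IH.
by rewrite -add1n PoszD opprD -addrA !ziterP IH.
Qed.

End IntIter.

Record zmod_aut (V : zmodType) := ZmodAut {
  aut_fun :> {additive V -> V};
  aut_inv : V -> V;
  aut_funK : cancel aut_fun aut_inv;
  aut_invK : cancel aut_inv aut_fun }.

Definition fg_free (V : zmodType) : Prop :=
  exists r (phi : {additive V -> 'rV[int]_r}), bijective phi.

Definition aut_order (V : zmodType) (psi : zmod_aut V) (n : nat) : Prop :=
  [/\ (0 < n)%N, iter n psi =1 id &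
      forall m, (0 < m < n)%N -> ~ (iter m psi =1 id)].

Definition elliptic (V : zmodType) (psi : zmod_aut V) : Prop :=
  forall x : V, psi x = x -> x = 0.

(* The pair [(a, i)] stands for the element [a * u ^ i]. *)
Definition Delta (Lam : zmodType) (psi : zmod_aut Lam) : Type := (Lam * int)%type.

HB.instance Definition _ (Lam : zmodType) (psi : zmod_aut Lam) :=
  Choice.copy (Delta psi) (Lam * int)%type.

Section Delta.
Variables (Lam : zmodType) (psi : zmod_aut Lam).

Definition apow : int -> Lam -> Lam := ziter psi (aut_inv psi).

Lemma aut_invD : {morph aut_inv psi : x y / x + y}.
Proof.
move=> x y; apply: (can_inj (aut_funK psi)).
by rewrite raddfD !(aut_invK psi).
Qed.

Lemma apowD_act i j x : apow (i + j) x = apow i (apow j x).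
Proof. exact: (ziterD (aut_funK psi) (aut_invK psi)). Qed.

Lemma apowD i : {morph apow i : x y / x + y}.
Proof.
case: i => k x y; rewrite /apow /ziter.
  by elim: k => //= k ->; rewrite raddfD.
by elim: k.+1 => //= m ->; rewrite aut_invD.
Qed.

Lemma apow0 i : apow i 0 = 0.
Proof. by apply: (addrI (apow i 0)); rewrite -apowD !addr0. Qed.

Lemma apowN i x : apow i (- x) = - apow i x.
Proof. by apply: (addrI (apow i x)); rewrite -apowD !subrr apow0. Qed.

Local Notation Delta := (Delta psi).

Definition Delta_mul (x y : Delta) : Delta :=
  (x.1 + apow x.2 y.1, x.2 + y.2).
Definition Delta_one : Delta := (0, 0).
Definition Delta_inv (x : Delta) : Delta := (apow (- x.2) (- x.1), - x.2).

Lemma Delta_mulA : associative Delta_mul.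
Proof.
move=> [a i] [b j] [c k]; rewrite /Delta_mul /=.
by rewrite apowD apowD_act !addrA.
Qed.

Lemma Delta_mul1 : left_id Delta_one Delta_mul.
Proof. by move=> [a i]; rewrite /Delta_mul /= !add0r. Qed.

Lemma Delta_1mul : right_id Delta_one Delta_mul.
Proof. by move=> [a i]; rewrite /Delta_mul /= apow0 !addr0. Qed.

Lemma Delta_mulV : left_inverse Delta_one Delta_inv Delta_mul.
Proof.
by move=> [a i]; rewrite /Delta_mul /= -apowD !addNr apow0.
Qed.

Lemma Delta_mulVr : right_inverse Delta_one Delta_inv Delta_mul.
Proof.
by move=> [a i]; rewrite /Delta_mul /= -apowD_act !subrr.
Qed.

HB.instance Definition _ := isGroup.Build Delta
  Delta_mulA Delta_mul1 Delta_1mul Delta_mulV Delta_mulVr.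

Definition dLam (a : Lam) : Delta := (a, 0).
Definition du : Delta := (0, 1).
Definition lam_part (w : Delta) : Lam := w.1.

Lemma dLamD a b : dLam (a + b) = (dLam a * dLam b)%g.
Proof. by []. Qed.

Lemma Delta_conj a : (du * dLam a * du^-1)%g = dLam (psi a).
Proof.
by apply/(canLR (mulgK _)); congr pair; rewrite /= ?add0r ?addr0.
Qed.

Definition Lam_coset : set Delta := [set (dLam a * du)%g | a in [set: Lam]].

Lemma Lam_cosetE w : Lam_coset w -> w = (dLam (lam_part w) * du)%g.
Proof. by case=> a _ <-; rewrite /lam_part /mul /= /Delta_mul /= addr0. Qed.

Definition Lam_conj (w w' : Delta) : Prop :=
  exists a : Lam, w' = (dLam a * w * (dLam a)^-1)%g.

(* [S] contains exactly one element of each [Lam]-conjugacy class in the coset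
   [Lam u]. *)
Definition conj_transversal (S : set Delta) : Prop :=
  S `<=` Lam_coset /\
  forall w, Lam_coset w -> exists! s, S s /\ Lam_conj w s.

End Delta.

Arguments du {Lam} psi.
Arguments dLam {Lam} psi a.

(* A module over the group algebra [L[G]], presented as an [L]-linear
   representation of [G]; it need not be finite-dimensional. *)
Record gmod (L : fieldType) (G : groupType) := GMod {
  gmod_space :> lmodType L;
  gact : G -> {linear gmod_space -> gmod_space};
  gact1 : forall x, gact 1%g x = x;
  gactM : forall g h x, gact (g * h)%g x = gact g (gact h x) }.

Arguments gact {L G} M g : rename.

Section GMod.
Variables (L : fieldType) (G : groupType).
Implicit Types M N P : gmod L G.

Definition submodule M (W : set M) : Prop :=
  [/\ W 0, forall (c : L) x y, W x -> W y -> W (c *: x + y)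
    & forall g x, W x -> W (gact M g x)].

Definition fin_gen M : Prop :=
  exists s : seq M, forall W : set M,
    submodule W -> (forall x, x \in s -> W x) -> W = [set: M].

Definition locally_finite (v : G) M : Prop :=
  forall x : M, exists W : set M,
    [/\ fd_subspace W, forall y, W y -> W (gact M v y) & W x].

Definition equivariant M N (f : M -> N) : Prop :=
  forall g x, f (gact M g x) = gact N g (f x).

Definition short_exact M N P (f : {linear M -> N}) (p : {linear N -> P}) :=
  [/\ equivariant f, equivariant p, injective f, (forall z, exists y, p y = z)
    & forall y, p y = 0 <-> exists x, f x = y].

End GMod.

Section MkGMod.
Variables (L : fieldType) (Lam : zmodType) (psi : zmod_aut Lam).
Variables (V : lmodType L) (rho : Lam -> {linear V -> V}) (U Ui : {linear V -> V}).
Hypotheses (rho0 : forall x, rho 0 x = x)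
  (rhoD : forall a b x, rho (a + b) x = rho a (rho b x))
  (UK : cancel U Ui) (UiK : cancel Ui U)
  (Urho : forall a x, U (rho a x) = rho (psi a) (U x)).

Definition mk_act (w : Delta psi) (x : V) : V := rho w.1 (ziter U Ui w.2 x).

Lemma mk_act_linear w : linear (mk_act w).
Proof.
case: w => a [] k c x y; rewrite /mk_act /ziter /= -?linearP; congr (rho a _).
  by elim: k => //= k ->; rewrite linearP.
by elim: k => /= [|k ->]; rewrite linearP.
Qed.

HB.instance Definition _ w :=
  GRing.isLinear.Build L V V *:%R (mk_act w) (mk_act_linear w).

Lemma Uirho a x : Ui (rho a x) = rho (aut_inv psi a) (Ui x).
Proof. by apply: (can_inj UK); rewrite Urho !UiK aut_invK. Qed.

Lemma ziter_rho i a x : ziter U Ui i (rho a x) = rho (apow psi i a) (ziter U Ui i x).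
Proof.
case: i => k; rewrite /apow /ziter.
  by elim: k => //= k ->; rewrite Urho.
by elim: k.+1 => //= m ->; rewrite Uirho.
Qed.

Lemma mk_act1 x : mk_act 1%g x = x.
Proof. exact: rho0. Qed.

Lemma mk_actM w w' x : mk_act (w * w')%g x = mk_act w (mk_act w' x).
Proof.
by rewrite /mk_act ziter_rho -rhoD -(ziterD UK UiK).
Qed.

Definition mk_gmod : gmod L (Delta psi) := GMod mk_act1 mk_actM.

End MkGMod.

Section DeltaModules.
Variables (L : fieldType) (Lam : zmodType) (psi : zmod_aut Lam).
Local Notation B_mod := (gmod L (Delta psi)).
Implicit Types M : B_mod.

Definition act_Lam M (a : Lam) : {linear M -> M} := gact M (dLam psi a).
Definition act_u M : {linear M -> M} := gact M (du psi).
Definition act_ui M : {linear M -> M} := gact M (du psi)^-1%g.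

Lemma act_Lam0 M x : act_Lam M 0 x = x.
Proof. exact: gact1. Qed.

Lemma act_LamD M a b x : act_Lam M (a + b) x = act_Lam M a (act_Lam M b x).
Proof. by rewrite /act_Lam dLamD gactM. Qed.

Lemma act_uK M : cancel (act_u M) (act_ui M).
Proof. by move=> x; rewrite /act_u /act_ui -gactM mulVg gact1. Qed.

Lemma act_uiK M : cancel (act_ui M) (act_u M).
Proof. by move=> x; rewrite /act_u /act_ui -gactM mulgV gact1. Qed.

Lemma act_uLam M a x : act_u M (act_Lam M a x) = act_Lam M (psi a) (act_u M x).
Proof. by rewrite /act_u /act_Lam -!gactM -Delta_conj mulgVK. Qed.

(* [M] pulled back along the automorphism of [L[Delta]] that is the identity on
   [L[Lam]] and sends [u] to [mu * u]. *)
Section Twist.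
Variables (mu : Lam) (M : B_mod).

Definition twist_u : {linear M -> M} := act_Lam M mu \o act_u M.
Definition twist_ui : {linear M -> M} := act_ui M \o act_Lam M (- mu).

Lemma twist_uK : cancel twist_u twist_ui.
Proof. by move=> x /=; rewrite -act_LamD addNr act_Lam0 act_uK. Qed.

Lemma twist_uiK : cancel twist_ui twist_u.
Proof. by move=> x /=; rewrite act_uiK -act_LamD subrr act_Lam0. Qed.

Lemma twist_uLam a x : twist_u (act_Lam M a x) = act_Lam M (psi a) (twist_u x).
Proof. by rewrite /= act_uLam -!act_LamD addrC. Qed.

Definition twist : B_mod := mk_gmod
  (act_Lam0 (M := M)) (act_LamD (M := M)) twist_uK twist_uiK twist_uLam.

End Twist.

(* [V (x) M], where [V = L^d] is the representation of [<u>] in which [u] acts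
   by [x |-> A x]: an element is the family of its [M]-valued coordinates on the
   standard basis of [V], [a] in [Lam] acts by [1 (x) a] and [u] by [u (x) u]. *)
Section Tensor.
Variables (d : nat) (A : 'M[L]_d) (M : B_mod).

Definition tens_map (C : 'M[L]_d) (f : {linear M -> M})
    (x : {ffun 'I_d -> M}) : {ffun 'I_d -> M} :=
  [ffun p => \sum_q C p q *: f (x q)].

Lemma tens_map_linear C f : linear (tens_map C f).
Proof.
move=> c x y; apply/ffunP => p; rewrite !ffunE scaler_sumr -big_split /=.
apply: eq_bigr => q _; rewrite !ffunE linearP scalerDr !scalerA.
by rewrite (mulrC c).
Qed.

HB.instance Definition _ C f := GRing.isLinear.Build L
  {ffun 'I_d -> M} {ffun 'I_d -> M} *:%R (tens_map C f) (tens_map_linear C f).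

Lemma tens_mapM C D (f g : {linear M -> M}) x :
  tens_map C f (tens_map D g x) = tens_map (C *m D) (f \o g) x.
Proof.
apply/ffunP => p; rewrite !ffunE.
under eq_bigr do rewrite ffunE linear_sum scaler_sumr.
rewrite exchange_big /=; apply: eq_bigr => q _.
rewrite mxE scaler_suml; apply: eq_bigr => r _.
by rewrite linearZ scalerA.
Qed.

Lemma tens_map1 (f : {linear M -> M}) x :
  f =1 id -> tens_map 1%:M f x = x.
Proof.
move=> f1; apply/ffunP => p; rewrite !ffunE (bigD1 p) //= big1 ?addr0.
  by rewrite mxE eqxx scale1r f1.
by move=> q qp; rewrite mxE eq_sym (negbTE qp) scale0r.
Qed.

Lemma eq_tens_map C (f g : {linear M -> M}) x :
  f =1 g -> tens_map C f x = tens_map C g x.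
Proof.
by move=> fg; apply/ffunP => p; rewrite !ffunE; under eq_bigr do rewrite fg.
Qed.

Definition tens_Lam (a : Lam) : {linear {ffun 'I_d -> M} -> {ffun 'I_d -> M}} :=
  tens_map 1%:M (act_Lam M a).
Definition tens_u : {linear {ffun 'I_d -> M} -> {ffun 'I_d -> M}} :=
  tens_map A (act_u M).
Definition tens_ui : {linear {ffun 'I_d -> M} -> {ffun 'I_d -> M}} :=
  tens_map (invmx A) (act_ui M).

Hypothesis Aunit : A \in unitmx.

Lemma tens_Lam0 x : tens_Lam 0 x = x.
Proof. by apply: tens_map1 => y; exact: act_Lam0. Qed.

Lemma tens_LamD a b x : tens_Lam (a + b) x = tens_Lam a (tens_Lam b x).
Proof.
rewrite /= tens_mapM mul1mx; apply: eq_tens_map => y; exact: act_LamD.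
Qed.

Lemma tens_uK : cancel tens_u tens_ui.
Proof.
move=> x; rewrite /= tens_mapM mulVmx //; apply: tens_map1 => y; exact: act_uK.
Qed.

Lemma tens_uiK : cancel tens_ui tens_u.
Proof.
move=> x; rewrite /= tens_mapM mulmxV //; apply: tens_map1 => y; exact: act_uiK.
Qed.

Lemma tens_uLam a x : tens_u (tens_Lam a x) = tens_Lam (psi a) (tens_u x).
Proof.
rewrite /= !tens_mapM mul1mx mulmx1; apply: eq_tens_map => y; exact: act_uLam.
Qed.

Definition tensor : B_mod :=
  mk_gmod tens_Lam0 tens_LamD tens_uK tens_uiK tens_uLam.

End Tensor.

Definition fgulf M : Prop := fin_gen M /\ locally_finite (du psi) M.

(* A homomorphism to [L] from the Grothendieck group of finitely generated
   [u]-locally finite modules is a function on such modules that is additive on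
   short exact sequences; the values of [T] on other modules are irrelevant. *)
Record is_gen_trace (T : B_mod -> L) : Prop := {
  gen_trace_add : forall (M' M M'' : B_mod)
      (f : {linear M' -> M}) (p : {linear M -> M''}),
    fgulf M' -> fgulf M -> fgulf M'' -> short_exact f p ->
    T M = T M' + T M'';
  gen_trace_tensor : forall d (A : 'M[L]_d) (Aunit : A \in unitmx) (M : B_mod),
    fgulf M -> T (tensor M Aunit) = \tr A * T M;
  gen_trace_findim : forall M : B_mod,
    findim M -> T M = trace (act_u M) }.

(* [Tr_gen (w, M)] for [w] in the coset [Lam u], where [T] is [Tr_gen (u, -)];
   such a [w] is [lam_part w * u] (see [Lam_cosetE]). *)
Definition gen_trace_at (T : B_mod -> L) (w : Delta psi) M : L :=
  T (twist (lam_part w) M).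

End DeltaModules.

Arguments gen_trace_at {L Lam psi} T w M.

Section Homology.
Variable L : fieldType.

Section Def.
Variables (U V W : lmodType L) (f : {linear U -> V}) (g : {linear V -> W}).

Definition cycle_pred : {pred V} := fun x => g x == 0.

Lemma cycle_submod : submod_closed cycle_pred.
Proof.
split; first by rewrite unfold_in linear0.
move=> c x y; rewrite !unfold_in => /eqP gx /eqP gy.
by rewrite linearP gx gy scaler0 addr0.
Qed.

HB.instance Definition _ := GRing.isSubmodClosed.Build L V cycle_pred cycle_submod.

Record cycle := Cycle { cycle_val :> V; _ : cycle_val \in cycle_pred }.

HB.instance Definition _ := [isSub for cycle_val].
HB.instance Definition _ := [Choice of cycle by <:].
HB.instance Definition _ := [SubChoice_isSubLmodule of cycle by <:].

Definition boundary_pred : {pred cycle} := fun z => `[< exists x, f x = val z >].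

Lemma boundary_submod : submod_closed boundary_pred.
Proof.
split; first by apply/asboolP; exists 0; rewrite !linear0.
move=> c x y /asboolP[x' ex] /asboolP[y' ey]; apply/asboolP.
by exists (c *: x' + y'); rewrite !linearP ex ey.
Qed.

HB.instance Definition _ :=
  GRing.isSubmodClosed.Build L cycle boundary_pred boundary_submod.

(* [ker g / (im f `&` ker g)]; the inclusion of [im f] in [ker g] is not needed
   for the definition. *)
Definition homology : Type := Quotient.quot boundary_pred.

Local Open Scope quotient_scope.

HB.instance Definition _ := GRing.Zmodule.on homology.
HB.instance Definition _ := EqQuotient.on homology.

Definition hclass (z : cycle) : homology := \pi_(Quotient.quot boundary_pred) z.

Lemma hclass_eq (x y : cycle) :
  (hclass x = hclass y) <-> exists t, f t = val x - val y.
Proof.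
have E : (x - y \in boundary_pred) = (hclass x == hclass y).
  exact: Quotient.idealrBE.
have -> : (exists t, f t = val x - val y) <-> x - y \in boundary_pred.
  by rewrite -linearB; split => [?|/asboolP]; first apply/asboolP.
by rewrite E; split => /eqP.
Qed.

Lemma hclassD x y : hclass (x + y) = hclass x + hclass y.
Proof. exact: (raddfD (\pi_(Quotient.quot boundary_pred))). Qed.

Lemma hclass_surj h : exists x, hclass x = h.
Proof. by exists (repr (h : Quotient.quot boundary_pred)); rewrite /hclass reprK. Qed.

Definition hscale (c : L) (h : homology) : homology :=
  hclass (c *: repr (h : Quotient.quot boundary_pred)).

Lemma hscale_class c x : hscale c (hclass x) = hclass (c *: x).
Proof.
apply/hclass_eq; rewrite !linearZ /= -scalerDr.
have /hclass_eq[t et] :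
    hclass (repr (hclass x : Quotient.quot boundary_pred)) = hclass x.
  by rewrite /hclass reprK.
by exists (c *: t); rewrite linearZ /= et.
Qed.

Lemma hscaleA a b h : hscale a (hscale b h) = hscale (a * b) h.
Proof. by have [x <-] := hclass_surj h; rewrite !hscale_class scalerA. Qed.

Lemma hscale1 : left_id 1 hscale.
Proof. by move=> h; have [x <-] := hclass_surj h; rewrite hscale_class scale1r. Qed.

Lemma hscaleDr : right_distributive hscale +%R.
Proof.
move=> c h k; have [x <-] := hclass_surj h; have [y <-] := hclass_surj k.
by rewrite -hclassD !hscale_class scalerDr hclassD.
Qed.

Lemma hscaleDl h : {morph hscale^~ h : a b / a + b}.
Proof.
move=> a b; have [x <-] := hclass_surj h.
by rewrite !hscale_class scalerDl hclassD.
Qed.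

HB.instance Definition _ := GRing.Zmodule_isLmodule.Build L homology
  hscaleA hscale1 hscaleDr hscaleDl.

Lemma hclassZ c x : hclass (c *: x) = c *: hclass x.
Proof. by rewrite -hscale_class. Qed.

End Def.

Arguments boundary_pred {U V W} f g _.
Arguments hclass {U V W} f {g} z.

Section Map.
Variables (U V W : lmodType L) (f : {linear U -> V}) (g : {linear V -> W}).
Variables (U' V' W' : lmodType L) (f' : {linear U' -> V'}) (g' : {linear V' -> W'}).
Variables (pU : {linear U -> U'}) (pV : {linear V -> V'}) (pW : {linear W -> W'}).
Hypotheses (pf : forall x, pV (f x) = f' (pU x))
           (pg : forall x, pW (g x) = g' (pV x)).

Lemma cycle_mapP (z : cycle g) : pV (val z) \in cycle_pred g'.
Proof.
have := valP z; rewrite !unfold_in => /eqP gz.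
by rewrite -pg gz linear0.
Qed.

Definition cycle_map (z : cycle g) : cycle g' := Cycle (cycle_mapP z).

Definition homology_fun (h : homology f g) : homology f' g' :=
  hclass f' (cycle_map (repr (h : Quotient.quot (boundary_pred f g)))).

Lemma homology_fun_class (z : cycle g) :
  homology_fun (hclass f z) = hclass f' (cycle_map z).
Proof.
apply/hclass_eq => /=.
have /hclass_eq[t et] :
    hclass f (repr (hclass f z : Quotient.quot (boundary_pred f g))) = hclass f z.
  by rewrite /hclass reprK.
by exists (pU t); rewrite -pf et linearB.
Qed.

Lemma homology_fun_linear : linear homology_fun.
Proof.
move=> c h k; have [x <-] := hclass_surj h; have [y <-] := hclass_surj k.
rewrite -hclassZ -hclassD !homology_fun_class -hclassZ -hclassD.
by congr (hclass f' _); apply: val_inj; rewrite /= !linearP.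
Qed.

Definition homology_map : {linear homology f g -> homology f' g'} :=
  HB.pack homology_fun (GRing.isLinear.Build L (homology f g) (homology f' g')
    *:%R homology_fun homology_fun_linear).

Lemma homology_mapE (z : cycle g) :
  homology_map (hclass f z) = hclass f' (cycle_map z).
Proof. exact: homology_fun_class. Qed.

End Map.

Arguments homology_map {U V W f g U' V' W' f' g' pU pV pW} pf pg.

End Homology.

Section FinSupp.
Variables (L : fieldType) (X : choiceType) (M : lmodType L).

Definition finsupp_pred : {pred X -> M} :=
  fun c => `[< finite_set [set x | c x != 0] >].

Lemma finsupp_submod : submod_closed finsupp_pred.
Proof.
split.
  apply/asboolP; rewrite (_ : [set _ | _] = set0) //.
  by apply/seteqP; split => // x /=; rewrite eqxx.
move=> a c e /asboolP fc /asboolP fe; apply/asboolP.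
apply: (@sub_finite_set _ _ ([set x | c x != 0] `|` [set x | e x != 0])).
  move=> x /=; apply: contra_neqP => /not_orP[/negP + /negP].
  by rewrite !negbK => /eqP cx /eqP ex; rewrite /GRing.add/= /GRing.scale/= cx ex scaler0 addr0.
by rewrite finite_setU.
Qed.

HB.instance Definition _ :=
  GRing.isSubmodClosed.Build L (X -> M) finsupp_pred finsupp_submod.

Record finsupp := FinSupp { finsupp_fun :> X -> M;
                            _ : finsupp_fun \in finsupp_pred }.

HB.instance Definition _ := [isSub for finsupp_fun].
HB.instance Definition _ := [Choice of finsupp by <:].
HB.instance Definition _ := [SubChoice_isSubLmodule of finsupp by <:].

Lemma finsuppP (c : finsupp) : finite_set [set x | c x != 0].
Proof. by case: c => c /= /asboolP. Qed.

Lemma finsuppPE a (c e : finsupp) x : (a *: c + e) x = a *: c x + e x.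
Proof. by []. Qed.

Lemma finsupp_eq (c e : finsupp) : c =1 e -> c = e.
Proof. by move=> ce; apply: val_inj; apply/funext. Qed.

End FinSupp.

Section Push.
Variable L : fieldType.

(* The image of [c = \sum_x c x (x)] under [m (x) |-> k x m (f x)]. *)
Section Def.
Variables (X Y : choiceType) (M N : lmodType L).
Variables (f : X -> Y) (k : X -> {linear M -> N}).

Definition push_fun (c : X -> M) (y : Y) : N :=
  \sum_(x \in [set x | f x = y]) k x (c x).

Lemma push_funE (c : X -> M) (r : seq X) y : uniq r ->
  (forall x, c x != 0 -> x \in r) ->
  push_fun c y = \sum_(x <- r | f x == y) k x (c x).
Proof.
move=> ur cr; rewrite /push_fun [RHS]bigfs //; last first.
  move=> x _ xr; have [->|/cr] := eqVneq (c x) 0; first exact: linear0.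
  by rewrite (negbTE xr).
by apply: eq_fsbigl; apply/seteqP; split => x /= /eqP.
Qed.

Lemma push_finsupp (c : finsupp X M) : push_fun c \in @finsupp_pred L Y N.
Proof.
apply/asboolP; apply: (sub_finite_set _ (finite_image f (finsuppP c))).
move=> y /=; apply: contra_neqP => /forall2NP H; apply: fsbig1 => x /= fx.
case: (H x) => //= /negP; rewrite negbK => /eqP ->; exact: linear0.
Qed.

Definition push (c : finsupp X M) : finsupp Y N := FinSupp (push_finsupp c).

End Def.

Section Theory.
Variables (X Y : choiceType) (M N : lmodType L).
Variables (f : X -> Y) (k : X -> {linear M -> N}).

Lemma pushE (c : finsupp X M) (r : seq X) y : uniq r ->
  (forall x, c x != 0 -> x \in r) ->
  push f k c y = \sum_(x <- r | f x == y) k x (c x).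
Proof. exact: push_funE. Qed.

Lemma push_linear : linear (push f k).
Proof.
move=> a c e; apply: finsupp_eq => y.
set r := fset_set ([set x | c x != 0] `|` [set x | e x != 0]).
have fin : finite_set ([set x | c x != 0] `|` [set x | e x != 0]).
  by rewrite finite_setU; split; exact: finsuppP.
have rP x : (x \in r) = (c x != 0) || (e x != 0).
  by rewrite in_fset_set //; apply/idP/orP; rewrite inE.
rewrite finsuppPE !(@pushE _ r) ?fset_uniq //; try by move=> x; rewrite rP => ->; rewrite ?orbT.
  rewrite scaler_sumr -big_split /=; apply: eq_bigr => x _.
  by rewrite linearP.
move=> x; rewrite rP finsuppPE; apply: contra_neqT; rewrite negb_or !negbK.
by move=> /andP[/eqP -> /eqP ->]; rewrite scaler0 addr0.
Qed.

HB.instance Definition _ := GRing.isLinear.Build L (finsupp X M) (finsupp Y N)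
  *:%R (push f k) push_linear.

Lemma eq_push f' (k' : X -> {linear M -> N}) c :
  f =1 f' -> (forall x, k x =1 k' x) -> push f k c = push f' k' c.
Proof.
move=> ff' kk'; apply: finsupp_eq => y; rewrite /= /push_fun.
rewrite (_ : [set x | f x = y] = [set x | f' x = y]); last first.
  by apply/seteqP; split => x /=; rewrite ff'.
by apply: eq_fsbigr => x _; rewrite kk'.
Qed.

End Theory.

Lemma push_comp (X Y Z : choiceType) (M N P : lmodType L)
    (f : X -> Y) (k : X -> {linear M -> N})
    (g : Y -> Z) (l : Y -> {linear N -> P}) c :
  push g l (push f k c) = push (g \o f) (fun x => l (f x) \o k x) c.
Proof.
apply: finsupp_eq => z.
have fc := finsuppP c.
set r := fset_set [set x | c x != 0].
have rP x : c x != 0 -> x \in r by move=> cx; rewrite in_fset_set // inE.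
rewrite (pushE _ _ _ (fset_uniq r) rP).
rewrite (@pushE _ _ _ _ g l _ (undup [seq f x | x <- r])) ?undup_uniq //; last first.
  move=> y; rewrite (pushE _ _ _ (fset_uniq r) rP) mem_undup => ny.
  apply/negPn/negP => yr; move/eqP: ny; apply; apply: big1_seq => x /andP[/eqP fx xr].
  by move: yr; rewrite -fx map_f.
under eq_bigr do rewrite (pushE _ _ _ (fset_uniq r) rP) linear_sum /=.
rewrite (exchange_big_dep (fun x => g (f x) == z)) /=; last by move=> y x /eqP gy /eqP ->; apply/eqP.
rewrite big_seq_cond [RHS]big_seq_cond; apply: eq_bigr => x /andP[xr gfx].
rewrite (eq_bigl (fun i => i == f x)); last first.
  by move=> i; rewrite [f x == i]eq_sym andbC; case: eqP => //= ->.
by rewrite -big_filter filter_pred1_uniq ?undup_uniq ?mem_undup ?map_f // big_seq1.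
Qed.

End Push.

(* The inhomogeneous bar complex of [Lam] with coefficients in a left module
   [M]: [C_n] is spanned by the [m (x) [g_1 | ... | g_n]], and the boundary of
   such an element is
     [(g_1^-1 m) (x) [g_2 | ... | g_n]
      + \sum_(0 < i < n) (-1)^i m (x) [g_1 | ... | g_i g_(i+1) | ... | g_n]
      + (-1)^n m (x) [g_1 | ... | g_(n-1)]],
   the left module being turned into a right one by inversion. *)
Section Bar.
Variables (L : fieldType) (Lam : zmodType) (psi : zmod_aut Lam).
Variable M : gmod L (Delta psi).

Definition bar_chain (n : nat) : lmodType L := finsupp {ffun 'I_n -> Lam} M.

(* The entries of [t] are numbered from 0, so the face number [i] adds the
   entries [i - 1] and [i] when [0 < i < n + 1]; it drops the first entry when
   [i = 0] and the last one when [i = n + 1]. *)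
Definition face n (i : 'I_n.+2) (t : {ffun 'I_n.+1 -> Lam}) : {ffun 'I_n -> Lam} :=
  [ffun j : 'I_n =>
    let tj := t (widen_ord (leqnSn n) j) in
    let tSj := t (lift ord0 j) in
    if (j.+1 < i)%N then tj else if j.+1 == i then tj + tSj else tSj].

Definition face_coef n (i : 'I_n.+2) (t : {ffun 'I_n.+1 -> Lam}) : {linear M -> M} :=
  if i == ord0 then act_Lam M (- t ord0) else idfun.

Definition bar_face n (i : 'I_n.+2) : {linear bar_chain n.+1 -> bar_chain n} :=
  push (@face n i) (@face_coef n i).

Definition bar_bd n (c : bar_chain n.+1) : bar_chain n :=
  \sum_(i < n.+2) (-1) ^+ i *: bar_face i c.

Lemma bar_bd_linear n : linear (@bar_bd n).
Proof.
move=> a c e; rewrite /bar_bd scaler_sumr -big_split /=; apply: eq_bigr => i _.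
by rewrite linearP scalerDr !scalerA mulrC.
Qed.

HB.instance Definition _ n := GRing.isLinear.Build L (bar_chain n.+1)
  (bar_chain n) *:%R (@bar_bd n) (@bar_bd_linear n).

(* The boundary out of degree [n]; it is zero in degree 0. *)
Definition bar_out n : {linear bar_chain n -> bar_chain n.-1} :=
  match n with 0 => \0 | m.+1 => @bar_bd m end.

Definition bar_u n : {linear bar_chain n -> bar_chain n} :=
  push (fun t : {ffun 'I_n -> Lam} => [ffun j => psi (t j)]) (fun=> act_u M).

Lemma bar_u_face n (i : 'I_n.+2) c :
  bar_u n (bar_face i c) = bar_face i (bar_u n.+1 c).
Proof.
rewrite /bar_u /bar_face /= !push_comp; apply: eq_push => [t|t x] /=.
  apply/ffunP => j; rewrite !ffunE /=.
  by case: ifP => // _; case: ifP => // _; rewrite raddfD.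
rewrite /face_coef; case: ifP => //= _.
by rewrite act_uLam ffunE raddfN.
Qed.

Lemma bar_u_bd n c : bar_u n (@bar_bd n c) = bar_bd (bar_u n.+1 c).
Proof.
rewrite /bar_bd linear_sum; apply: eq_bigr => i _.
by rewrite linearZ /= bar_u_face.
Qed.

Lemma bar_u_out n c : bar_u n.-1 (bar_out n c) = bar_out n (bar_u n c).
Proof. by case: n c => [|n] c; [exact: linear0|exact: bar_u_bd]. Qed.

Definition group_homology (i : nat) : lmodType L :=
  homology (@bar_bd i) (bar_out i).

Definition group_homology_u (i : nat) :
    {linear group_homology i -> group_homology i} :=
  homology_map (bar_u_bd (n := i)) (bar_u_out (n := i)).

End Bar.

(* Main.v *)
(** Both sides of (b) are additive in M, so Noetherian induction allows us to
    assume (b) for all proper quotients of a nonzero M.  Let f be an endomorphism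
    of M that commutes with Lambda and commutes with u up to a scalar z.  If f is
    neither zero nor injective, then the sequence 0 -> V (x) M/ker f -> M -> M/im f -> 0,
    where u acts by z on the line V, gives (b) for M.  If f is injective, z <> 1,
    and f acts by 0 on homology, then 0 -> V (x) M -> M -> M/im f -> 0 gives (b) up to
    the nonzero factor 1 - z.  The second case applies to the sums
    \sum_(k < n) w^k psi^k(a) with w^n = 1 and w <> 1, because Lambda acts trivially
    on H_*(Lambda, M).  Hence we may assume that all of them vanish on M, so that a and psi(a)
    act equally.  As a + psi(a) + ... + psi^(n-1)(a) = 0, the n-th power of a acts
    trivially, and the first case applied to a - c and to u - c shows that Lambda
    acts by a psi-invariant character chi and u by a scalar.  Every line in M is then
    a submodule, and it remains to treat a line.

    For a line with chi <> 1 the homology vanishes, and so does the right hand side,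
    a multiple of the sum of a nontrivial character over Lambda/(1 - psi).  For
    chi = 1, alternating cycles show that u acts on H_i(Lambda, L) as on the i-th
    exterior power of Lambda, so the left hand side is a multiple of det(1 - psi); it is
    positive because psi has finite order without fixed vectors, and by the Smith
    normal form its absolute value is the number of conjugacy classes in Lambda u.

    In (a), a acts on M as an isomorphism between M and its twist. *)

Require Import Defs.
From HB Require Import structures.
From mathcomp Require Import all_boot all_order all_algebra.
From mathcomp Require Import perm cyclic separable cyclotomic polyrcf realalg zify.
From mathcomp Require Import boolp classical_sets functions cardinality fsbigop.

Set Implicit Arguments.
Unset Strict Implicit.
Unset Printing Implicit Defensive.

Import Order.TTheory GRing.Theory Num.Theory.
Local Open Scope classical_set_scope.
Local Open Scope ring_scope.

(** * Linear maps and traces *)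

(** Nothing bounds [H_i(Lambda, M)] in advance, so the statement under induction includes the
    existence of its traces and its vanishing in high degrees, both inherited from other modules.
    For an injective [f] the module [M] itself stands at two places of the sequence. If [f] kills
    homology, the long exact sequence falls apart into short ones, in which the homology of [M] is
    controlled by that of [M/im f], and the value for [M] is recovered by dividing by 1 - z.

    The sums with w are made to supply such maps: moving u past them shifts them cyclically and
    costs a power of w, while on homology, where every psi^k(a) is the identity, they become the sum
    of the powers of w, which is 0. Their vanishing on M for all w <> 1 says that the function k |->
    psi^k(a) on Z/n has no nontrivial Fourier coefficient, hence is constant.

    Noetherian induction rests on the commutative basis theorem: generators of [M] lie in a
    finite-dimensional [u]-stable subspace, and this subspace generates [M] already over
    L[Lambda]. *)

Section LinearMaps.
Variable L : fieldType.
Implicit Types V W Q N : lmodType L.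

(** Quotient maps, coordinates and connecting maps are all described by a choice of representatives.
    Such a description is a relation, and the third hypothesis expresses independence of the
    choices. *)
Lemma linear_of_rel V W (R : V -> W -> Prop) :
    (forall c x y x' y', R x y -> R x' y' -> R (c *: x + x') (c *: y + y')) ->
    (forall x, exists y, R x y) -> (forall y, R 0 y -> y = 0) ->
  exists h : {linear V -> W}, forall x y, R x y <-> y = h x.
Proof.
move=> Rlin Rtot R0.
have [h hP] := choice Rtot.
have Runiq x y y' : R x y -> R x y' -> y = y'.
  move=> Ry Ry'; have := Rlin (-1) _ _ _ _ Ry' Ry.
  rewrite !scaleN1r addNr => /R0/eqP; rewrite addrC subr_eq0 => /eqP //.
have hl : linear h by move=> c x y; apply: Runiq (hP _) _; apply: Rlin.
pose h' : {linear V -> W} := HB.pack h (GRing.isLinear.Build L V W *:%R h hl).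
exists h' => x y /=; split.
  by move=> Rxy; apply: Runiq Rxy (hP x).
by move=> ->; exact: hP.
Qed.

Lemma linear_factor V Q N (q : {linear V -> Q}) (h : {linear V -> N}) :
    (forall z, exists y, q y = z) -> (forall x, q x = 0 -> h x = 0) ->
  exists hb : {linear Q -> N}, forall x, hb (q x) = h x.
Proof.
move=> qsurj qh.
have [|z|_ [x [qx <-]]|hb hbP] :=
    @linear_of_rel Q N (fun z w => exists x, q x = z /\ h x = w).
- by move=> c _ _ _ _ [x [<- <-]] [y [<- <-]]; exists (c *: x + y); rewrite !linearP.
- by have [y <-] := qsurj z; exists (h y), y.
- exact: qh.
by exists hb => x; symmetry; apply/hbP; exists x.
Qed.

Lemma linear_inj V W (f : {linear V -> W}) :
  (forall x, f x = 0 -> x = 0) -> injective f.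
Proof. by move=> f0 x y /eqP; rewrite -subr_eq0 -linearB => /eqP/f0/eqP; rewrite subr_eq0 => /eqP. Qed.

Lemma linear_bij V W (f : {linear V -> W}) :
  injective f -> (forall y, exists x, f x = y) -> bijective f.
Proof.
move=> fi /choice[g gP]; exists g => // x; exact/fi/gP.
Qed.

Lemma linear_inv V W (f : {linear V -> W}) : bijective f ->
  exists g : {linear W -> V}, cancel f g /\ cancel g f.
Proof.
move=> [f' fK f'K].
have [|x|g gP] := @linear_factor V W V f idfun.
- by move=> z; exists (f' z).
- by rewrite -[x in _ -> idfun x = _]fK => ->; rewrite -(linear0 f) fK.
by exists g; split=> x; [rewrite gP | rewrite -[x]f'K gP].
Qed.

Definition has_dim V d := exists phi : {linear V -> 'rV[L]_d}, bijective phi.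

Lemma has_dimP V d (g : {linear 'rV[L]_d -> V}) : bijective g -> has_dim V d.
Proof.
move=> /linear_inv[h [gK hK]]; exists h; exists g => //.
Qed.

Lemma linear_rowE d V (f : {linear 'rV[L]_d -> V}) y :
  f y = \sum_k y 0 k *: f (delta_mx 0 k).
Proof.
by rewrite {1}[y]row_sum_delta linear_sum; apply: eq_bigr => k _; rewrite linearZ.
Qed.

Lemma linear_mx d e (f : {linear 'rV[L]_d -> 'rV[L]_e}) :
  exists A, forall v, f v = v *m A.
Proof. by exists (lin1_mx f) => v; rewrite mul_rV_lin1. Qed.

Lemma mx_of_endo V d (phi : {linear V -> 'rV[L]_d}) (f : {linear V -> V}) :
  bijective phi -> exists A, forall v, phi (f v) = phi v *m A.
Proof.
move=> /linear_inv[g [phiK gK]].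
have [A AP] := linear_mx (phi \o f \o g).
by exists A => v; rewrite -AP /= phiK.
Qed.

(** Cyclicity of the trace holds for the rectangular base changes [P] and [Q]: tr A = tr (P A' Q) =
    tr (A' Q P) = tr A', without comparing [d] and [d']. *)
Lemma is_trace_uniq V (f : V -> V) s t : is_trace f s -> is_trace f t -> s = t.
Proof.
move=> [d [phi [A [/linear_inv[g [phiK gK]] phiA ->]]]].
move=> [d' [phi' [A' [/linear_inv[g' [phiK' gK']] phiA' ->]]]].
have [P PE] := linear_mx (phi' \o g); have [Q QE] := linear_mx (phi \o g').
have PQ : P *m Q = 1%:M.
  by apply/row_matrixP => i; rewrite !rowE mulmxA -PE -QE /= phiK' gK mulmx1.
have QP : Q *m P = 1%:M.
  by apply/row_matrixP => i; rewrite !rowE mulmxA -QE -PE /= phiK gK' mulmx1.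
have AP : A *m P = P *m A'.
  apply/row_matrixP => i; rewrite !rowE !mulmxA; set w := delta_mx 0 i.
  by rewrite -!PE /= -phiA' -{1}[w]gK -phiA phiK.
by rewrite -[A]mulmx1 -PQ mulmxA AP mxtrace_mulC mulmxA QP mul1mx.
Qed.

Lemma traceE V (f : {linear V -> V}) t : is_trace f t -> trace f = t.
Proof. by move=> ft; apply: xget_unique => // s fs; apply: is_trace_uniq fs ft. Qed.

Lemma is_trace_findim V (f : V -> V) t : is_trace f t -> findim V.
Proof. by move=> [d [phi [A [bij _ _]]]]; exists d, phi. Qed.

Lemma findim_trace V (f : {linear V -> V}) : findim V -> exists t, is_trace f t.
Proof.
by move=> [d [phi bij]]; have [A AP] := mx_of_endo f bij; exists (\tr A), d, phi, A.
Qed.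

Lemma eq_is_trace V (f g : V -> V) t : f =1 g -> is_trace f t -> is_trace g t.
Proof.
by move=> fg [d [phi [A [bij AP ->]]]]; exists d, phi, A; split=> // v; rewrite -fg.
Qed.

Lemma is_traceZ V (f g : V -> V) c t :
  (forall x, g x = c *: f x) -> is_trace f t -> is_trace g (c * t).
Proof.
move=> gf [d [phi [A [bij AP ->]]]]; exists d, phi, (c *: A).
by rewrite linearZ; split=> // v; rewrite gf linearZ AP /= scalemxAr.
Qed.

Lemma is_trace0 V (f : V -> V) : (forall x : V, x = 0) -> is_trace f 0.
Proof.
move=> V0; exists 0, \0, 0; rewrite linear0; split=> // [|v].
  by apply: linear_bij => [x y _|y]; [rewrite (V0 x) (V0 y) | exists 0; apply/rowP; case].
by apply/rowP; case.
Qed.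

Definition exact_seq (A V B : lmodType L) (i : {linear A -> V}) (p : {linear V -> B}) :=
  [/\ injective i, forall z, exists y, p y = z
    & forall y, p y = 0 <-> exists x, i x = y].

(** Lifts of a basis of [B] split the sequence by [s]. The coordinates of [v] are those of
    [v - s (p v)] in [A] followed by those of [p v], so endomorphisms that respect the sequence
    become block triangular. *)
Lemma exact_coord (A V B : lmodType L) (i : {linear A -> V}) (p : {linear V -> B}) a b
    (phiA : {linear A -> 'rV[L]_a}) (phiB : {linear B -> 'rV[L]_b}) :
    exact_seq i p -> bijective phiA -> bijective phiB ->
  exists phi : {linear V -> 'rV[L]_(a + b)},
    [/\ bijective phi, forall x, phi (i x) = row_mx (phiA x) 0
      & forall v, rsubmx (phi v) = phiB (p v)].
Proof.
move=> [iinj psurj ex] /linear_inv[gA [phiAK gAK]] /linear_inv[gB [phiBK gBK]].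
have /choice[v vP] : forall k, exists v, p v = gB (delta_mx 0 k) by move=> k; exact: psurj.
pose s (y : 'rV[L]_b) := \sum_k y 0 k *: v k.
have sl : linear s.
  move=> c x y; rewrite /s scaler_sumr -big_split; apply: eq_bigr => k _ /=.
  by rewrite scalerA -scalerDl !mxE.
have psE y : p (s y) = gB y.
  by rewrite (linear_rowE gB) /s linear_sum; apply: eq_bigr => k _; rewrite linearZ /= vP.
pose R v' w := exists x, v' = i x + s (phiB (p v')) /\ w = row_mx (phiA x) (phiB (p v')).
have RP v' w : R v' w -> p v' = gB (rsubmx w) /\ v' = i (gA (lsubmx w)) + s (rsubmx w).
  by move=> [x [e ->]]; rewrite row_mxKr row_mxKl phiBK phiAK -e.
have [|||phi phiP] := @linear_of_rel _ _ R.
- move=> c v1 w1 v2 w2 [x [e1 ->]] [x' [e2 ->]]; exists (c *: x + x'); split.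
    by rewrite {1}e1 {1}e2 !linearP sl scalerDr addrACA.
  by rewrite !linearP scale_row_mx add_row_mx.
- move=> v'; have /ex[x ix] : p (v' - s (phiB (p v'))) = 0.
    by rewrite linearB /= psE phiBK subrr.
  by exists (row_mx (phiA x) (phiB (p v'))), x; rewrite ix subrK.
- move=> w0 [x []]; rewrite !linear0 => /esym e ->.
  have s0 : s 0 = 0 by rewrite /s big1 // => k _; rewrite mxE scale0r.
  rewrite s0 addr0 in e; have -> : x = 0 by apply: iinj; rewrite e linear0.
  by rewrite linear0 row_mx0.
have phiE v' : R v' (phi v') by apply/phiP.
exists phi; split.
- apply: linear_bij => [|w].
    apply: linear_inj => v' e; have [_ ->] := RP _ _ (phiE v').
    rewrite e !linear0 add0r /s big1 // => k _; by rewrite !mxE scale0r.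
  exists (i (gA (lsubmx w)) + s (rsubmx w)); symmetry; apply/phiP.
  exists (gA (lsubmx w)); have pi x : p (i x) = 0 by apply/ex; exists x.
  by rewrite linearD /= pi add0r psE gBK gAK hsubmxK.
- move=> x; symmetry; apply/phiP; exists x.
  have -> : p (i x) = 0 by apply/ex; exists x.
  rewrite linear0 /s big1 ?addr0 // => k _; by rewrite mxE scale0r.
- by move=> v'; have [-> _] := RP _ _ (phiE v'); rewrite gBK.
Qed.

Lemma exact_dim (A V B : lmodType L) (i : {linear A -> V}) (p : {linear V -> B}) a b :
  exact_seq i p -> has_dim A a -> has_dim B b -> has_dim V (a + b).
Proof.
move=> ex [phiA bA] [phiB bB]; have [phi [bij _ _]] := exact_coord ex bA bB.
by exists phi.
Qed.

Lemma exact_trace (A V B : lmodType L) (i : {linear A -> V}) (p : {linear V -> B})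
    (fA : A -> A) (f : {linear V -> V}) (fB : B -> B) s t :
    exact_seq i p -> (forall x, i (fA x) = f (i x)) -> (forall v, p (f v) = fB (p v)) ->
  is_trace fA s -> is_trace fB t -> is_trace f (s + t).
Proof.
move=> ex fi fp [a [phiA [MA [bA MAE ->]]]] [b [phiB [MB [bB MBE ->]]]].
have [phi [bij phil phir]] := exact_coord ex bA bB.
have [M ME] := mx_of_endo f bij; exists (a + b)%N, phi, M; split=> //.
rewrite -[M]submxK mxtrace_block.
have [gA [phiAK gAK]] := linear_inv bA.
have [g [phiK gK]] := linear_inv bij.
congr (_ + _).
  congr (\tr _); apply/row_matrixP => k; rewrite !rowE.
  have := congr1 lsubmx (phil (fA (gA (delta_mx 0 k)))).
  rewrite fi ME phil row_mxKl MAE gAK => <-.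
  by rewrite -{1}[M]submxK mul_row_block row_mxKl mul0mx addr0.
congr (\tr _); apply/row_matrixP => k; rewrite !rowE.
have := phir (f (g (row_mx 0 (delta_mx 0 k)))).
rewrite ME gK fp MBE -phir gK row_mxKr => <-.
by rewrite -{1}[M]submxK mul_row_block row_mxKr mul0mx add0r.
Qed.

(** A matrix of largest rank among those with row space inside [W] works: adjoining a vector of [W]
    to its row space cannot raise the rank. *)
Lemma subspace_mx d (W : set 'rV[L]_d) :
    W 0 -> (forall c x y, W x -> W y -> W (c *: x + y)) ->
  exists K : 'M[L]_d, forall v, W v <-> (v <= K)%MS.
Proof.
move=> W0 Wl.
pose Pr k := `[< exists B : 'M[L]_d, \rank B = k /\ forall v : 'rV_d, (v <= B)%MS -> W v >].
have exP : exists k, Pr k.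
  exists 0%N; apply/asboolP; exists 0; split; first exact: mxrank0.
  by move=> v; rewrite submx0 => /eqP ->.
have ubP k : Pr k -> (k <= d)%N by move=> /asboolP[B [<- _]]; exact: rank_leq_row.
case: (ex_maxnP exP ubP) => k /asboolP[B [rB BW]] kmax.
exists B => v; split; last exact: BW.
move=> Wv; have : Pr (\rank (B + v)%MS).
  apply/asboolP; exists (B + v)%MS; split=> // w /sub_addsmxP[[u1 u2] /= ->].
  have [c ->] : exists c, u2 *m v = c *: v.
    exists (u2 0 0); rewrite [u2]mx11_scalar mul_scalar_mx mxE; by rewrite eqxx mulr1n.
  by rewrite addrC; apply: Wl => //; apply: BW; exact: submxMl.
move=> /kmax; rewrite -rB => le; apply: submx_trans (addsmxSr B v) _.
by rewrite -(mxrank_leqif_sup (addsmxSl B v)) eqn_leq le mxrankS ?addsmxSl.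
Qed.

Lemma findim_inj (A V : lmodType L) (i : {linear A -> V}) : injective i -> findim V -> findim A.
Proof.
move=> iinj [d [phi bij]].
have pinj : injective (phi \o i) by apply: inj_comp => //; exact: bij_inj.
have [|c _ _ [x _ <-] [y _ <-]|K KP] := @subspace_mx d (range (phi \o i)).
- by exists 0; rewrite ?linear0.
- by exists (c *: x + y); rewrite ?linearP.
set B := row_base K; have Bfree : row_free B := row_base_free K.
have xB x : (phi (i x) <= B)%MS by rewrite eq_row_base; apply/KP; exists x.
exists (\rank K), (mulmxr (pinvmx B) \o (phi \o i)).
apply: linear_bij => [|y].
  apply: linear_inj => x /= e; apply: pinj => /=; rewrite !linear0.
  by rewrite -(mulmxKpV (xB x)) e mul0mx.
have /KP[x _ xE] : (y *m B <= K)%MS by rewrite -(eq_row_base K) submxMl.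
by exists x; rewrite /= in xE *; rewrite xE mulmxKp.
Qed.

(** A complement of the kernel maps isomorphically onto [B]. *)
Lemma findim_surj (V B : lmodType L) (p : {linear V -> B}) :
  (forall z, exists y, p y = z) -> findim V -> findim B.
Proof.
move=> psurj [d [phi /linear_inv[g [phiK gK]]]].
have [|c x y /= px py|K KP] := @subspace_mx d [set w | p (g w) = 0].
- by rewrite /= !linear0.
- by rewrite /= !linearP /= px py scaler0 addr0.
set C := row_base (K^C)%MS; have Cfree : row_free C := row_base_free _.
exists (\rank (K^C)%MS); apply: (has_dimP (g := p \o (g \o mulmxr C))).
apply: linear_bij => [|b].
  apply: linear_inj => y /KP yK.
  have yC : (y *m C <= K^C)%MS by rewrite -(eq_row_base (K^C)%MS) submxMl.
  have : (y *m C <= K :&: K^C)%MS by rewrite sub_capmx /= yC andbT.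
  rewrite capmx_compl submx0 => /eqP e.
  by apply: (row_free_inj Cfree); rewrite e mul0mx.
have [v <-] := psurj b.
have : (phi v <= K + K^C)%MS by rewrite submx_full // addsmx_compl_full.
case/sub_addsmxP => -[u1 u2] /= e.
have /submxP[y yE] : (u2 *m K^C <= C)%MS by rewrite eq_row_base submxMl.
exists y; rewrite /= -yE -[v]phiK e linearD linearD /=.
by have /KP -> := submxMl u1 K; rewrite add0r.
Qed.

End LinearMaps.

(** * The long exact homology sequence *)

Section HomologyClass.
Variables (L : fieldType) (U V W : lmodType L).
Variables (f : {linear U -> V}) (g : {linear V -> W}).
Local Notation H := (homology f g).

(** Cycles form a subtype. The relation between a vector and its class allows arguments with plain
    vectors, the proof of being a cycle staying hidden inside. *)
Definition class_of (z : V) (h : H) : Prop :=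
  exists zc : Defs.cycle g, val zc = z /\ hclass f zc = h.

Lemma class_of_ex z : g z = 0 -> exists h, class_of z h.
Proof.
move=> gz; have zP : z \in cycle_pred g by rewrite unfold_in gz.
by exists (hclass f (Cycle zP)), (Cycle zP).
Qed.

Lemma class_of_surj h : exists z, class_of z h.
Proof. by have [zc <-] := hclass_surj h; exists (val zc), zc. Qed.

Lemma class_of_cycle z h : class_of z h -> g z = 0.
Proof. by move=> [zc [<- _]]; have := valP zc; rewrite unfold_in => /eqP. Qed.

Lemma class_of_linear c z h z' h' :
  class_of z h -> class_of z' h' -> class_of (c *: z + z') (c *: h + h').
Proof.
move=> [zc [<- <-]] [zc' [<- <-]]; exists (c *: zc + zc').
by rewrite linearP hclassD hclassZ.
Qed.

Lemma class_of_uniq z h h' : class_of z h -> class_of z h' -> h = h'.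
Proof. by move=> [zc [<- <-]] [zc' [/val_inj -> <-]]. Qed.

Lemma class_of00 : class_of 0 0.
Proof.
by exists 0; split=> //; apply/(addrI (hclass f (0 : Defs.cycle g))); rewrite -hclassD !addr0.
Qed.

Lemma class_of0 z : class_of z 0 <-> g z = 0 /\ exists t, f t = z.
Proof.
have [c0 [c0E hc0]] := class_of00; split.
  move=> cz; split; first exact: class_of_cycle cz.
  have [zc [<- ]] := cz; rewrite -hc0 => /hclass_eq[t].
  by rewrite c0E subr0 => <-; exists t.
move=> [gz [t tz]]; have [h [zc [zcE hE]]] := class_of_ex gz.
exists zc; split=> //; rewrite -hc0; apply/hclass_eq; exists t.
by rewrite c0E subr0 zcE.
Qed.

Lemma homology_eq0 : (forall z, g z = 0 -> exists t, f t = z) -> forall h : H, h = 0.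
Proof.
move=> ex h; have [z zh] := class_of_surj h; apply: (class_of_uniq zh).
by apply/class_of0; have gz := class_of_cycle zh; split=> //; exact: ex.
Qed.

End HomologyClass.

Section Induced.
Variable L : fieldType.

(** Describes a map on homology by its effect on representatives, so that identities, scalar
    multiples and values of [homology_map] can be compared whatever their construction. *)
Definition induces (U V W U' V' W' : lmodType L)
    (f : {linear U -> V}) (g : {linear V -> W})
    (f' : {linear U' -> V'}) (g' : {linear V' -> W'})
    (phi : V -> V') (a : homology f g -> homology f' g') : Prop :=
  forall z h, class_of z h -> class_of (phi z) (a h).

Lemma homology_map_induces (U V W U' V' W' : lmodType L)
    (f : {linear U -> V}) (g : {linear V -> W})
    (f' : {linear U' -> V'}) (g' : {linear V' -> W'})
    (pU : {linear U -> U'}) (pV : {linear V -> V'}) (pW : {linear W -> W'})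
    (pf : forall x, pV (f x) = f' (pU x)) (pg : forall x, pW (g x) = g' (pV x)) :
  induces pV (homology_map pf pg).
Proof.
by move=> _ _ [zc [<- <-]]; rewrite homology_mapE; exists (Defs.cycle_map pg zc).
Qed.

End Induced.

Section Complex.
Variable L : fieldType.

Section Def.
Variables (C : nat -> lmodType L) (d : forall n, {linear C n.+1 -> C n}).

(** Has the shape of [bar_out], which makes [cpx_homology] of the bar complex convertible to
    [group_homology]. *)
Definition bd_out n : {linear C n -> C n.-1} :=
  match n with 0 => \0 | m.+1 => d m end.

Definition cpx_homology n : lmodType L := homology (d n) (bd_out n).

End Def.

Variables (C' C C'' : nat -> lmodType L).
Variables (d' : forall n, {linear C' n.+1 -> C' n})
  (d : forall n, {linear C n.+1 -> C n}) (d'' : forall n, {linear C'' n.+1 -> C'' n}).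
Variables (f : forall n, {linear C' n -> C n}) (p : forall n, {linear C n -> C'' n}).
Hypotheses (fd : forall n x, f n (d' n x) = d n (f n.+1 x))
  (pd : forall n x, p n (d n x) = d'' n (p n.+1 x))
  (dd : forall n x, d n (d n.+1 x) = 0)
  (ex : forall n, exact_seq (f n) (p n)).

Local Notation H' := (cpx_homology d').
Local Notation H := (cpx_homology d).
Local Notation H'' := (cpx_homology d'').

Lemma chain_map_out (D E : nat -> lmodType L) (dD : forall n, {linear D n.+1 -> D n})
    (dE : forall n, {linear E n.+1 -> E n}) (g : forall n, {linear D n -> E n}) :
    (forall n x, g n (dD n x) = dE n (g n.+1 x)) ->
  forall n x, g n.-1 (bd_out dD n x) = bd_out dE n (g n x).
Proof. by move=> gd [|n] x; [exact: linear0 | exact: gd]. Qed.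

Lemma exact_pf n x : p n (f n x) = 0.
Proof. by case: (ex n) => _ _ e; apply/e; exists x. Qed.

Definition connects n (h'' : H'' n.+1) (h' : H' n) : Prop :=
  exists c z', [/\ class_of (p n.+1 c) h'', f n z' = d n c & class_of z' h'].

(** Exactness at [H], [H''] and [H'] is in [les_ab], [les_bd] and [les_da]. The action of the three
    maps on representatives is kept as well: naturality is derived from it. *)
Record les_spec (a : forall n, {linear H' n -> H n}) (b : forall n, {linear H n -> H'' n})
    (del : forall n, {linear H'' n.+1 -> H' n}) : Prop := LesSpec {
  les_a : forall n, induces (f n) (a n);
  les_b : forall n, induces (p n) (b n);
  les_ab : forall n h, b n h = 0 <-> exists h', a n h' = h;
  les_bd : forall n h, del n h = 0 <-> exists h0, b n.+1 h0 = h;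
  les_da : forall n h, a n h = 0 <-> exists h'', del n h'' = h;
  les_b0 : forall h, exists h0, b 0 h0 = h;
  les_del : forall n h'' h', connects h'' h' <-> h' = del n h'' }.

Lemma connects_ex n h'' : exists h', @connects n h'' h'.
Proof.
have [_ psurj ex1] := ex n; have [_ psurj1 _] := ex n.+1.
have [z'' zh] := class_of_surj h''; have [c cz] := psurj1 z''.
have dz : d'' n z'' = 0 by exact: (class_of_cycle zh).
have [|z' fz] := (ex1 (d n c)).1; first by rewrite pd cz.
have oz : bd_out d' n z' = 0.
  have [finj _ _] := ex n.-1; apply: finj.
  rewrite (chain_map_out fd) fz linear0.
  by case: n {psurj ex1 psurj1 h'' z'' zh dz z' fz cz} c => [|m] c; rewrite /= ?dd.
have [h' zh'] := class_of_ex (d' n) oz.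
by exists h', c, z'; rewrite cz.
Qed.

Lemma connects0 n h' : @connects n 0 h' -> h' = 0.
Proof.
move=> [c [z' [/class_of0[_ [t'' te]] fz zh]]].
have [_ psurj2 _] := ex n.+2; have [_ _ ex1] := ex n.+1; have [finj _ _] := ex n.
have [t tt] := psurj2 t''.
have /ex1[x xe] : p n.+1 (c - d n.+1 t) = 0 by rewrite linearB /= pd tt te subrr.
apply: (class_of_uniq zh); apply/class_of0; split; first exact: class_of_cycle zh.
by exists x; apply: finj; rewrite fd xe linearB /= dd subr0.
Qed.

Lemma les : exists a b del, les_spec a b del.
Proof.
have [del delP] : exists del : forall n, {linear H'' n.+1 -> H' n},
    forall n h'' h', connects h'' h' <-> h' = del n h''.
  have delS n : {del : {linear H'' n.+1 -> H' n} |
      forall h'' h', connects h'' h' <-> h' = del h''}.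
    apply/cid; apply: linear_of_rel; last exact: connects0.
    - move=> k h1 h1' h2 h2' [c1 [z1 [p1 f1 cl1]]] [c2 [z2 [p2 f2 cl2]]].
      exists (k *: c1 + c2), (k *: z1 + z2); rewrite !linearP f1 f2; split=> //.
        exact: class_of_linear.
      exact: class_of_linear.
    - exact: connects_ex.
  by exists (fun n => projT1 (delS n)) => n; exact: (projT2 (delS n)).
exists (fun n => homology_map (@fd n) (chain_map_out fd (n:=n))).
exists (fun n => homology_map (@pd n) (chain_map_out pd (n:=n))), del.
set a := fun n => _; set b := fun n => _.
have aP n : induces (f n) (a n) by exact: homology_map_induces.
have bP n : induces (p n) (b n) by exact: homology_map_induces.
split=> //.
- move=> n h; split.
    move=> bh; have [z zh] := class_of_surj h.
    have := bP n _ _ zh; rewrite bh => /class_of0[_ [t'' te]].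
    have [_ psurj _] := ex n.+1; have [finj _ exn] := ex n.
    have [t tt] := psurj t''.
    have /exn[x xe] : p n (z - d n t) = 0 by rewrite linearB /= pd tt te subrr.
    have oz : bd_out d' n x = 0.
      have [finj1 _ _] := ex n.-1; apply: finj1; rewrite (chain_map_out fd) xe !linear0 linearB /=.
      rewrite (class_of_cycle zh) sub0r; case: n t {x xe h bh z zh t'' te psurj finj exn tt} => [|m] t /=.
        by rewrite oppr0.
      by rewrite dd oppr0.
    have [h' xh] := class_of_ex (d' n) oz; exists h'.
    have := class_of_linear (-1) (aP n _ _ xh) zh; rewrite !scaleN1r xe => e.
    apply/eqP; rewrite eq_sym -subr_eq0 addrC; apply/eqP/(class_of_uniq e)/class_of0.
    by split; [exact: class_of_cycle e | exists t; rewrite opprB subrK].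
  move=> [h' <-]; have [z' zh] := class_of_surj h'.
  have e := bP n _ _ (aP n _ _ zh); rewrite exact_pf in e.
  exact: class_of_uniq e (class_of00 _ _).
- move=> n h; split.
    move=> dh; have [c [z' [ch fz zh]]] : connects h (0 : H' n) by apply/delP; rewrite dh.
    have [_ [x xe]] := (class_of0 _ _ _).1 zh.
    have oc : bd_out d n.+1 (c - f n.+1 x) = 0 by rewrite /= linearB /= -fd xe fz subrr.
    have [h0 ch0] := class_of_ex (d n.+1) oc; exists h0.
    have := bP n.+1 _ _ ch0; rewrite linearB /= exact_pf subr0.
    by move/class_of_uniq; apply.
  move=> [h0 <-]; have [z zh] := class_of_surj h0.
  symmetry; apply/delP; exists z, 0; rewrite linear0; split; first exact: bP.
    by rewrite (class_of_cycle zh).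
  exact: class_of00.
- move=> n h; split.
    move=> ah; have [z' zh] := class_of_surj h.
    have := aP n _ _ zh; rewrite ah => /class_of0[_ [c ce]].
    have oc : bd_out d'' n.+1 (p n.+1 c) = 0 by rewrite /= -pd ce exact_pf.
    have [h'' ch] := class_of_ex (d'' n.+1) oc.
    by exists h''; symmetry; apply/delP; exists c, z'.
  move=> [h'' /esym/delP[c [z' [ch fz zh]]]].
  apply: (class_of_uniq (aP n _ _ zh)); apply/class_of0.
  by split; [exact: class_of_cycle (aP n _ _ zh) | exists c].
- move=> h; have [z'' zh] := class_of_surj h.
  have [_ psurj _] := ex 0; have [z ze] := psurj z''.
  have [h0 zh0] := @class_of_ex _ _ _ _ (d 0) (bd_out d 0) z erefl.
  by exists h0; have := bP 0%N _ _ zh0; rewrite ze => /class_of_uniq; apply.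
Qed.

Section Naturality.
Variables (a : forall n, {linear H' n -> H n}) (b : forall n, {linear H n -> H'' n})
    (del : forall n, {linear H'' n.+1 -> H' n}).
Hypothesis abd : les_spec a b del.
Variables (g' : forall n, {linear C' n -> C' n}) (g : forall n, {linear C n -> C n})
  (g'' : forall n, {linear C'' n -> C'' n}).
Hypotheses (gd : forall n x, g n (d n x) = d n (g n.+1 x))
  (gf : forall n x, f n (g' n x) = g n (f n x))
  (gp : forall n x, p n (g n x) = g'' n (p n x)).

Lemma les_natural_a n (G' : H' n -> H' n) (G : H n -> H n) :
  induces (g' n) G' -> induces (g n) G -> forall h, a n (G' h) = G (a n h).
Proof.
move=> g'G' gG h; have [z zh] := class_of_surj h.
have := les_a abd (g'G' _ _ zh); rewrite gf => /class_of_uniq; apply.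
exact/gG/(les_a abd).
Qed.

Lemma les_natural_b n (G : H n -> H n) (G'' : H'' n -> H'' n) :
  induces (g n) G -> induces (g'' n) G'' -> forall h, b n (G h) = G'' (b n h).
Proof.
move=> gG g''G'' h; have [z zh] := class_of_surj h.
have := les_b abd (gG _ _ zh); rewrite gp => /class_of_uniq; apply.
exact/g''G''/(les_b abd).
Qed.

Lemma les_natural_del n (G'' : H'' n.+1 -> H'' n.+1) (G' : H' n -> H' n) :
  induces (g'' n.+1) G'' -> induces (g' n) G' -> forall h, del n (G'' h) = G' (del n h).
Proof.
move=> g''G'' g'G' h.
have /(les_del abd)[c [z' [ch fz zh]]] : del n h = del n h by [].
symmetry; apply/(les_del abd); exists (g n.+1 c), (g' n z').
by rewrite gp gf fz gd; split=> //; [exact: g''G'' | exact: g'G'].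
Qed.

End Naturality.

End Complex.

(** * Traces on kernels in exact sequences *)

Section KernelTrace.
Variable L : fieldType.

Lemma corestrict (V W X : lmodType L) (phi : {linear V -> W}) (chi : {linear W -> X}) :
    (forall v, chi (phi v) = 0) ->
  exists phi' : {linear V -> Defs.cycle chi}, forall v, val (phi' v) = phi v.
Proof.
move=> chiphi.
have [|v||phi' phiP] := @linear_of_rel _ V (Defs.cycle chi) (fun v w => val w = phi v).
- by move=> c x y x' y' e e'; rewrite !linearP /= e e'.
- have vP : phi v \in cycle_pred chi by rewrite unfold_in chiphi.
  by exists (Cycle vP).
- by move=> w; rewrite linear0 => e; apply: val_inj; rewrite e.
by exists phi' => v; apply/phiP.
Qed.

Lemma cycleP (V W : lmodType L) (phi : {linear V -> W}) (x : Defs.cycle phi) : phi (val x) = 0.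
Proof. by have := valP x; rewrite unfold_in => /eqP. Qed.

Lemma cycle_ex (V W : lmodType L) (phi : {linear V -> W}) v :
  phi v = 0 -> exists x : Defs.cycle phi, val x = v.
Proof.
move=> pv; have vP : v \in cycle_pred phi by rewrite unfold_in pv.
by exists (Cycle vP).
Qed.

(** The trace of [g] on the kernel of [phi]. Long exact sequences are cut at the kernels of their
    maps. *)
Definition ker_trace (V W : lmodType L) (phi : {linear V -> W}) (g : V -> V) (k : L) :=
  exists h : {linear Defs.cycle phi -> Defs.cycle phi},
    (forall x, val (h x) = g (val x)) /\ is_trace h k.

Lemma ker_trace_uniq (V W : lmodType L) (phi : {linear V -> W}) (g : V -> V) k l :
  ker_trace phi g k -> ker_trace phi g l -> k = l.
Proof.
move=> [h [hE hk]] [h' [h'E h'l]]; apply: is_trace_uniq hk _.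
by apply: eq_is_trace h'l => x; apply: val_inj; rewrite hE h'E.
Qed.

Definition exact_at (V W X : lmodType L) (phi : {linear V -> W}) (chi : {linear W -> X}) :=
  forall y, chi y = 0 <-> exists x, phi x = y.

Section Split.
Variables (V W X : lmodType L) (phi : {linear V -> W}) (chi : {linear W -> X}).
Variables (g : {linear V -> V}) (k : {linear W -> W}).
Hypotheses (ex : exact_at phi chi) (gk : forall x, phi (g x) = k (phi x)).

Lemma ker_exact_seq : exists phi' : {linear V -> Defs.cycle chi},
  (forall v, val (phi' v) = phi v) /\
  exact_seq (val : {linear Defs.cycle phi -> V}) phi'.
Proof.
have [|phi' phiE] := @corestrict _ _ _ phi chi; first by move=> v; apply/ex; exists v.
exists phi'; split=> //; split.
- exact: val_inj.
- move=> z; have /ex[y ye] := cycleP z.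
  by exists y; apply: val_inj; rewrite phiE.
- move=> y; split.
    move=> e; apply: cycle_ex; by rewrite -phiE e.
  move=> [x <-]; apply: val_inj; by rewrite phiE cycleP.
Qed.

Lemma ker_endo : exists h : {linear Defs.cycle phi -> Defs.cycle phi},
  forall x, val (h x) = g (val x).
Proof.
have [|h hE] := @corestrict _ _ _ (g \o val : {linear Defs.cycle phi -> V}) phi.
  by move=> v /=; rewrite gk cycleP linear0.
by exists h.
Qed.

Lemma coker_endo : exists h : {linear Defs.cycle chi -> Defs.cycle chi},
  forall x, val (h x) = k (val x).
Proof.
have [|h hE] := @corestrict _ _ _ (k \o val : {linear Defs.cycle chi -> W}) chi.
  move=> v /=; have /ex[x <-] := cycleP v.
  by rewrite -gk; apply/ex; exists (g x).
by exists h.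
Qed.

(** By exactness, [0 -> ker phi -> V -> ker chi -> 0] is short exact, and finite dimension passes
    from [V] to both ends. *)
Lemma ker_trace_split t : is_trace g t ->
  exists s r, [/\ ker_trace phi g s, ker_trace chi k r & t = s + r].
Proof.
move=> gt; have [phi' [phiE ex']] := ker_exact_seq.
have [h hE] := ker_endo; have [h' h'E] := coker_endo.
have fdV := is_trace_findim gt.
have [s hs] : exists s, is_trace h s.
  by case: ex' => iinj _ _; apply: findim_trace (findim_inj iinj fdV).
have [r hr] : exists r, is_trace h' r.
  by case: ex' => _ psurj _; apply: findim_trace (findim_surj psurj fdV).
exists s, r; split; [by exists h | by exists h' |].
apply: is_trace_uniq gt _; apply: (exact_trace ex' _ _ hs hr) => // v.
by apply: val_inj; rewrite h'E !phiE gk.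
Qed.

Lemma ker_trace_join s r : ker_trace phi g s -> ker_trace chi k r -> is_trace g (s + r).
Proof.
move=> [h [hE hs]] [h' [h'E hr]]; have [phi' [phiE ex']] := ker_exact_seq.
apply: (exact_trace ex' _ _ hs hr) => // v.
by apply: val_inj; rewrite h'E !phiE gk.
Qed.

End Split.

End KernelTrace.

(** * Euler characteristics along a long exact sequence *)

Section LongExact.
Variable L : fieldType.
Variables (H' H H'' : nat -> lmodType L).
Variables (a : forall n, {linear H' n -> H n}) (b : forall n, {linear H n -> H'' n})
    (del : forall n, {linear H'' n.+1 -> H' n}).
Hypotheses (exb : forall n, exact_at (a n) (b n)) (exd : forall n, exact_at (b n.+1) (del n))
  (exa : forall n, exact_at (del n) (a n)) (b0 : forall h, exists h0, b 0 h0 = h).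

Lemma long_exact_short : (forall n h, a n h = 0) ->
  (forall n, exact_seq (b n.+1) (del n)) /\ bijective (b 0).
Proof.
move=> a0; have binj n : injective (b n).
  by apply: linear_inj => x /exb[y <-]; exact: a0.
split; last by apply: linear_bij => //; exact: b0.
move=> n; split=> //; last exact: exd.
by move=> z; apply/exa; exact: a0.
Qed.

Variables (G' : forall n, {linear H' n -> H' n}) (G : forall n, {linear H n -> H n})
  (G'' : forall n, {linear H'' n -> H'' n}).
Hypotheses (aG : forall n h, a n (G' n h) = G n (a n h))
  (bG : forall n h, b n (G n h) = G'' n (b n h))
  (delG : forall n h, del n (G'' n.+1 h) = G' n (del n h)).
Variables (t' t'' : nat -> L).
Hypotheses (G't : forall n, is_trace (G' n) (t' n)) (G''t : forall n, is_trace (G'' n) (t'' n)).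

(** The connecting map leaves positive degrees only. In degree 0 it is replaced by the zero map
    followed by an identity, so that exactness at [H'' n] and at the next term has the same form for
    all [n]. *)
Let X n : lmodType L := match n with 0 => H'' 0 | m.+1 => H' m end.
Let Y n : lmodType L := match n with 0 => H'' 0 | m.+1 => H m end.
Let dl n : {linear H'' n -> X n} := match n with 0 => \0 | m.+1 => del m end.
Let al n : {linear X n -> Y n} := match n with 0 => idfun | m.+1 => a m end.
Let GX n : {linear X n -> X n} := match n with 0 => \0 | m.+1 => G' m end.

(** Here [k n] is the trace on the image of the connecting map out of [H'' n]. It is counted in
    [t'' n] and, one degree lower, in [t'], but never in [t]; the alternating sum of these
    corrections telescopes. *)
Lemma long_exact_trace : exists t k : nat -> L,
  [/\ forall n, is_trace (G n) (t n), forall n, t n = t' n + t'' n - (k n + k n.+1),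
      k 0 = 0 & forall n, (forall h : H'' n, h = 0) -> k n = 0].
Proof.
have exdl n : exact_at (b n) (dl n).
  by case: n => [|n] //= y; split=> // _; exact: b0.
have exal n : exact_at (dl n) (al n).
  case: n => [|n] //= y; split=> [e|[x <-] //]; by exists 0; exact: esym e.
have dlG n h : dl n (G'' n h) = GX n (dl n h) by case: n h => [|n] h //; exact: delG.
have sp1 n := ker_trace_split (@exb n) (@aG n) (@G't n).
have sp2 n := ker_trace_split (exal n) (dlG n) (@G''t n).
have /boolp.choice[k kP] n : exists k, exists e, [/\ ker_trace (dl n) (G'' n) e, ker_trace (al n) (GX n) k & t'' n = e + k].
  by have [e [k [? ? ?]]] := sp2 n; exists k, e.
exists (fun n => t' n + t'' n - (k n + k n.+1)), k; split=> //.
- move=> n; have [s [r [sP rP ->]]] := sp1 n; have [e [eP _ ->]] := kP n.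
  have [e1 [_ kP1 _]] := kP n.+1.
  have -> : k n.+1 = s by exact: ker_trace_uniq kP1 sP.
  have -> : s + r + (e + k n) - (k n + s) = r + e.
    by apply/eqP; rewrite subr_eq [k n + s]addrC [X in _ == X]addrACA [r + s]addrC.
  by have := ker_trace_join (exdl n) (@bG n) rP; apply.
- have [e [_ [h [_ hk]] _]] := kP 0%N; apply: is_trace_uniq hk _; apply: is_trace0.
  by move=> x; apply: val_inj; rewrite linear0; exact: (cycleP x).
- move=> n H0; have [e [_ [h [_ hk]] _]] := kP n; apply: is_trace_uniq hk _; apply: is_trace0.
  move=> x; apply: val_inj; have /exal[y <-] := cycleP x.
  by rewrite (H0 y) !linear0.
Qed.

Lemma long_exact_euler N :
    (forall n, (N <= n)%N -> forall h : H' n, h = 0) ->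
    (forall n, (N <= n)%N -> forall h : H'' n, h = 0) ->
  exists t : nat -> L, [/\ forall n, is_trace (G n) (t n),
    forall n, (N <= n)%N -> forall h : H n, h = 0 &
    \sum_(n < N) (-1) ^+ n * t n
    = \sum_(n < N) (-1) ^+ n * t' n + \sum_(n < N) (-1) ^+ n * t'' n].
Proof.
move=> H'0 H''0; have [t [k [Gt tE k0 kN]]] := long_exact_trace.
exists t; split=> //.
  move=> n Nn h; have /exb[h' <-] : b n h = 0 by exact: H''0.
  by rewrite (H'0 n Nn h') linear0.
have tel m : \sum_(n < m) (-1) ^+ n * (k n + k n.+1) = k 0 - (-1) ^+ m * k m.
  elim: m => [|m IH]; first by rewrite big_ord0 expr0 mul1r subrr.
  by rewrite big_ord_recr /= IH exprS mulN1r mulNr opprK mulrDr addrA subrK.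
rewrite -big_split /= -[RHS]subr0 -[X in _ - X](_ : \sum_(n < N) (-1) ^+ n * (k n + k n.+1) = 0).
  rewrite -sumrB; apply: eq_bigr => n _.
  by rewrite -mulrDr -mulrBr tE.
by rewrite tel k0 kN ?mulr0 ?subrr //; exact: H''0.
Qed.

End LongExact.

(** * Finitely supported functions and the bar complex *)

Section Generators.
Variables (L : fieldType) (X : choiceType) (M : lmodType L).

Definition fsing_fun (x : X) (m : M) (y : X) : M := if y == x then m else 0.

Lemma fsing_finsupp x m : fsing_fun x m \in @finsupp_pred L X M.
Proof.
apply/asboolP; apply: (@sub_finite_set _ _ [set x]) => [y /=|]; last exact: finite_set1.
by rewrite /fsing_fun; case: (y =P x) => // _; rewrite eqxx.
Qed.

Definition fsing x m : finsupp X M := FinSupp (fsing_finsupp x m).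

Lemma fsing_linear x : linear (fsing x).
Proof.
move=> c m m'; apply: finsupp_eq => y; rewrite finsuppPE /= /fsing_fun.
by case: eqP => //; rewrite scaler0 addr0.
Qed.

HB.instance Definition _ x :=
  GRing.isLinear.Build L M (finsupp X M) *:%R (fsing x) (fsing_linear x).

Lemma finsuppDE (c e : finsupp X M) x : (c + e) x = c x + e x.
Proof. by []. Qed.

Lemma finsuppZE a (c : finsupp X M) x : (a *: c) x = a *: c x.
Proof. by []. Qed.

Lemma finsupp_sumE (I : Type) (r : seq I) (P : pred I) (F : I -> finsupp X M) x :
  (\sum_(i <- r | P i) F i) x = \sum_(i <- r | P i) F i x.
Proof. by elim/big_rec2: _ => // i y1 y2 _ <-. Qed.

Lemma fsingE x m y : fsing x m y = if y == x then m else 0.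
Proof. by []. Qed.

Lemma finsupp_ind (P : finsupp X M -> Prop) :
    P 0 -> (forall c e, P c -> P e -> P (c + e)) -> (forall x m, P (fsing x m)) ->
  forall c, P c.
Proof.
move=> P0 PD Ps c; have /finite_seqP[s sE] := finsuppP c.
suff -> : c = \sum_(x <- undup s) fsing x (c x) by elim/big_ind: _.
apply: finsupp_eq => y; rewrite finsupp_sumE.
under eq_bigr do rewrite fsingE.
have ys : (c y != 0) = (y \in s).
  have e : is_true (c y != 0) = is_true (y \in s) := congr1 (fun A : set X => A y) sE.
  by apply/idP/idP; rewrite e.
have [cy|cy] := eqVneq (c y) 0.
  by rewrite big1 // => x _; case: eqP => // <-.
rewrite (bigD1_seq y) ?undup_uniq ?mem_undup -?ys //= eqxx big1 ?addr0 // => x xy.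
by rewrite eq_sym (negbTE xy).
Qed.

Lemma eq_on_fsing (N : lmodType L) (f g : {linear finsupp X M -> N}) :
  (forall x m, f (fsing x m) = g (fsing x m)) -> f =1 g.
Proof.
move=> fg; apply: finsupp_ind => //; first by rewrite !linear0.
by move=> c e fc fe; rewrite !linearD fc fe.
Qed.

End Generators.

Section PushGenerators.
Variable L : fieldType.

Lemma push_fsing (X Y : choiceType) (M N : lmodType L)
    (f : X -> Y) (k : X -> {linear M -> N}) x m :
  push f k (fsing x m) = fsing (f x) (k x m).
Proof.
apply: finsupp_eq => y; rewrite (@pushE _ _ _ _ _ f k _ [:: x]) // => [|x'].
  by rewrite big_mkcond big_seq1 !fsingE eqxx eq_sym.
by rewrite fsingE inE; case: (x' =P x) => // _; rewrite eqxx.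
Qed.

(** Linear extension of maps given on the generators, obtained by pushing to a one-point index set
    so that linearity comes from [push]. *)
Definition lext (X : choiceType) (M N : lmodType L) (k : X -> {linear M -> N})
    (c : finsupp X M) : N := push (fun=> tt) k c tt.

Lemma lext_linear (X : choiceType) (M N : lmodType L) (k : X -> {linear M -> N}) :
  linear (lext k).
Proof. by move=> a c e; rewrite /lext linearP. Qed.

HB.instance Definition _ (X : choiceType) (M N : lmodType L) (k : X -> {linear M -> N}) :=
  GRing.isLinear.Build L (finsupp X M) N *:%R (lext k) (lext_linear k).

Lemma lext_fsing (X : choiceType) (M N : lmodType L) (k : X -> {linear M -> N}) x m :
  lext k (fsing x m) = k x m.
Proof. by rewrite /lext push_fsing fsingE eqxx. Qed.

Lemma push_idE (X : choiceType) (M N : lmodType L) (f : {linear M -> N})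
    (c : finsupp X M) x : push idfun (fun=> f) c x = f (c x).
Proof.
elim/finsupp_ind: c => [|c e IHc IHe|y m]; first by rewrite !linear0.
  by rewrite linearD !finsuppDE IHc IHe linearD.
by rewrite push_fsing !fsingE /=; case: eqP => // _; rewrite linear0.
Qed.

(** Exactness holds coefficient by coefficient. A coefficientwise preimage under [i] keeps finite
    support because [i] is injective. *)
Lemma push_id_exact (X : choiceType) (A V B : lmodType L)
    (i : {linear A -> V}) (p : {linear V -> B}) : exact_seq i p ->
  exact_seq (push (@idfun X) (fun=> i)) (push (@idfun X) (fun=> p)).
Proof.
move=> [iinj psurj ex]; have i0 x : i x = 0 -> x = 0.
  by move=> e; apply: iinj; rewrite e linear0.
split.
- apply: linear_inj => c e; apply: finsupp_eq => x; apply: i0.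
  by rewrite -push_idE e.
- elim/finsupp_ind => [|_ _ [c <-] [e <-]|x m]; first by exists 0; rewrite linear0.
    by exists (c + e); rewrite linearD.
  by have [v <-] := psurj m; exists (fsing x v); exact: push_fsing.
- move=> c; split=> [pc|[e <-]]; last first.
    apply: finsupp_eq => x; rewrite !push_idE; apply/ex; by exists (e x).
  have /choice[g gE] : forall x, exists a, i a = c x.
    by move=> x; apply/ex; rewrite -push_idE pc.
  have gP : g \in @finsupp_pred L X A.
    apply/asboolP; apply: sub_finite_set (finsuppP c) => x /=.
    by apply: contra_neq => cx; apply: i0; rewrite gE.
  exists (FinSupp gP); apply: finsupp_eq => x; by rewrite push_idE gE.
Qed.

End PushGenerators.

Arguments fsing {L X M} x m : simpl never.
Arguments push {L X Y M N} f k c : simpl never.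
Arguments lext {L X M N} k c : simpl never.
Arguments face : simpl never.
Arguments bar_bd : simpl never.
Arguments face_coef : simpl never.

(** * Simplicial identities and functoriality of the bar complex *)

Section FaceIdentities.
Variables (L : fieldType) (Lam : zmodType).

(** The simplicial identity d_i d_j = d_(j-1) d_i for i < j. The indices on the right live in other
    ordinal types, hence the separate variables with prescribed values. *)
Lemma face_face n (i : 'I_n.+2) (j : 'I_n.+3) (j' : 'I_n.+2) (i' : 'I_n.+3)
    (t : {ffun 'I_n.+2 -> Lam}) : (i < j)%N -> j' = j.-1 :> nat -> i' = i :> nat ->
  face i (face j t) = face j' (face i' t).
Proof.
move=> ij ej ei; apply/ffunP => k; rewrite !ffunE /= /bump /= !add1n ej ei.
rewrite (_ : lift ord0 (widen_ord (leqnSn n) k) = widen_ord (leqnSn _) (lift ord0 k)); last exact: val_inj.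
case: j ij ej => [[|j] ltj] //= ij _.
case: (ltngtP k.+1 i) => ki; case: (ltngtP k.+1 j) => kj; case: (ltngtP k.+2 i) => k2i;
 case: (ltngtP k.+1 j.+1) => k1j; case: (ltngtP k.+2 j.+1) => k2j //; try lia.
all: by rewrite ?addrA.
Qed.

(** The terms with second index above the first cancel against the others under (i, j + 1) <-> (j,
    i), which changes the sign. *)
Lemma alternating_sum_face (V : lmodType L) n (a : nat -> nat -> V) :
    (forall i j, (i <= j <= n)%N -> a i j.+1 = a j i) ->
  \sum_(i < n.+1) \sum_(j < n.+2) ((-1) ^+ i * (-1) ^+ j) *: a i j = 0.
Proof.
move=> aE.
have -> : \sum_(i < n.+1) \sum_(j < n.+2) ((-1) ^+ i * (-1) ^+ j) *: a i j =
  \sum_(i < n.+1) (\sum_(j < n.+1 | (j <= i)%N) ((-1) ^+ i * (-1) ^+ j) *: a i j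
  - \sum_(j < n.+1 | (i <= j)%N) ((-1) ^+ i * (-1) ^+ j) *: a j i).
  apply: eq_bigr => i _; rewrite (bigID (fun j : 'I_n.+2 => (j <= i)%N)) /=; congr (_ + _).
    rewrite big_mkcond big_ord_recr /= [(n < i)%N]leqNgt ltn_ord /= addr0.
    by rewrite [RHS]big_mkcond.
  rewrite big_mkcond big_ord_recl /= add0r -sumrN [RHS]big_mkcond /=.
  apply: eq_bigr => j _; rewrite /bump /= add1n -ltnNge ltnS; case: leqP => // ij.
  by rewrite exprS mulN1r mulrN scaleNr aE // ij /= -ltnS ltn_ord.
rewrite sumrB; apply/eqP; rewrite subr_eq0 (exchange_big_dep predT) //=; apply/eqP.
by apply: eq_bigr => i _; apply: eq_bigr => j _; rewrite [_ * _]mulrC.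
Qed.

Section OneModule.
Variables (psi : zmod_aut Lam) (M : gmod L (Delta psi)).

Lemma bar_face_fsing n (i : 'I_n.+2) t m :
  bar_face M i (fsing t m) = fsing (face i t) (face_coef M i t m).
Proof. exact: push_fsing. Qed.

Lemma bar_bd_fsing n (t : {ffun 'I_n.+1 -> Lam}) (m : M) :
  bar_bd (fsing t m) = \sum_(i < n.+2) (-1) ^+ i *: fsing (face i t) (face_coef M i t m).
Proof. by apply: eq_bigr => i _; rewrite bar_face_fsing. Qed.

Lemma bar_bd_fsingS n (t : {ffun 'I_n.+1 -> Lam}) (m : M) :
  bar_bd (fsing t m) = fsing (face ord0 t) (act_Lam M (- t ord0) m)
    - \sum_(i < n.+1) (-1) ^+ i *: fsing (face (lift ord0 i) t) m.
Proof.
rewrite bar_bd_fsing big_ord_recl expr0 scale1r /face_coef eqxx -sumrN; congr (_ + _).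
by apply: eq_bigr => i _; rewrite exprS mulN1r scaleNr.
Qed.

Lemma bar_face_face n (i : 'I_n.+2) (j : 'I_n.+3) (j' : 'I_n.+2) (i' : 'I_n.+3) (c : bar_chain M n.+2) :
    (i < j)%N -> j' = j.-1 :> nat -> i' = i :> nat ->
  bar_face M i (bar_face M j c) = bar_face M j' (bar_face M i' c).
Proof.
move=> ij ej ei.
apply: (@eq_on_fsing _ _ _ _ (bar_face M i \o bar_face M j) (bar_face M j' \o bar_face M i')) => {c} t m.
rewrite /= !bar_face_fsing (face_face _ ij ej ei); congr (fsing _ _).
rewrite /face_coef -!val_eqE /= ei ej; case: j ij ej => [[|j] ltj] //= ij ej.
case: eqP => [i0|i0] /=; last first.
  by case: j ltj ij ej => [|j] // ltj; rewrite ltnS leqn0 => /eqP.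
rewrite !ffunE /= ?ei ?i0.
have wid0 : widen_ord (leqnSn n.+1) ord0 = ord0 by exact: val_inj.
case: j ltj ij ej => [|j] ltj ij ej /=; rewrite wid0 //.
(* The case of the faces 0 and 1: one side acts by the sum of the first two entries, the other by
   these entries one after the other. *)
by rewrite -act_LamD opprD addrC.
Qed.

Lemma bar_bd_bd n (c : bar_chain M n.+2) : bar_bd (bar_bd c) = 0.
Proof.
pose a i j := bar_face M (inord i : 'I_n.+2) (bar_face M (inord j : 'I_n.+3) c).
rewrite -[RHS](@alternating_sum_face _ n.+1 a).
  rewrite /bar_bd; apply: eq_bigr => i _.
  rewrite linear_sum scaler_sumr; apply: eq_bigr => j _.
  by rewrite linearZ /= scalerA /a !inord_val.
move=> i j /andP[ij jn]; apply: bar_face_face.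
- rewrite !inordK //; lia.
- rewrite !inordK //; lia.
- rewrite !inordK //; lia.
Qed.

End OneModule.

Section ChainMap.
Variables (psi psi' : zmod_aut Lam) (M : gmod L (Delta psi)) (N : gmod L (Delta psi')).
Variable f : {linear M -> N}.

(** Homology depends on the action of [Lambda] alone, so the two modules may live over different
    automorphisms. *)
Definition Lam_equivariant := forall a x, f (act_Lam M a x) = act_Lam N a (f x).

Definition bar_map n : {linear bar_chain M n -> bar_chain N n} := push idfun (fun=> f).

Lemma bar_map_fsing n t m : bar_map n (fsing t m) = fsing t (f m).
Proof. exact: push_fsing. Qed.

Lemma bar_mapE n (c : bar_chain M n) t : bar_map n c t = f (c t).
Proof. exact: push_idE. Qed.

Lemma bar_map_bd : Lam_equivariant -> forall n (c : bar_chain M n.+1),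
  bar_map n (bar_bd c) = bar_bd (bar_map n.+1 c).
Proof.
move=> fLam n; apply: (@eq_on_fsing _ _ _ _ (bar_map n \o @bar_bd _ _ _ M n) (@bar_bd _ _ _ N n \o bar_map n.+1)).
move=> t m /=; rewrite push_fsing !bar_bd_fsing linear_sum; apply: eq_bigr => i _.
rewrite linearZ /= push_fsing /face_coef; case: ifP => //= _; by rewrite fLam.
Qed.

End ChainMap.
End FaceIdentities.

(** * Free modules and the homology of the trivial module *)

(** The auxiliary modules of the homology computation carry an action of [Lambda] only. Over the
    identity automorphism [u] can be made to act on them as the identity. *)
Definition id_aut (V : zmodType) : zmod_aut V :=
  @ZmodAut V idfun id (fun=> erefl) (fun=> erefl).

Section MkGmod.
Variables (L : fieldType) (Lam : zmodType) (psi : zmod_aut Lam).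
Variables (V : lmodType L) (rho : Lam -> {linear V -> V}) (U Ui : {linear V -> V}).
Hypotheses (rho0 : forall x, rho 0 x = x)
  (rhoD : forall a b x, rho (a + b) x = rho a (rho b x))
  (UK : cancel U Ui) (UiK : cancel Ui U)
  (Urho : forall a x, U (rho a x) = rho (psi a) (U x)).
Local Notation M := (mk_gmod rho0 rhoD UK UiK Urho).

Lemma mk_gmod_Lam a x : act_Lam M a x = rho a x.
Proof. by []. Qed.

Lemma mk_gmod_u x : act_u M x = U x.
Proof. exact: rho0. Qed.

Lemma mk_gmod_ui x : act_ui M x = Ui x.
Proof.
apply: (can_inj UK); rewrite UiK -mk_gmod_u; exact: (act_uiK (M := M)).
Qed.

End MkGmod.

Section BarSequence.
Variables (L : fieldType) (Lam : zmodType) (psi psi' psi'' : zmod_aut Lam).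
Variables (M' : gmod L (Delta psi')) (M : gmod L (Delta psi)) (M'' : gmod L (Delta psi'')).
Variables (f : {linear M' -> M}) (p : {linear M -> M''}).

Definition bar_diff (phi : zmod_aut Lam) (N : gmod L (Delta phi)) n :
  {linear bar_chain N n.+1 -> bar_chain N n} := @bar_bd _ _ _ N n.

Hypotheses (fLam : Lam_equivariant f) (pLam : Lam_equivariant p) (ex : exact_seq f p).

Lemma bar_les : exists a b del,
  les_spec (d' := bar_diff M') (d := bar_diff M) (d'' := bar_diff M'')
    (bar_map f) (bar_map p) a b del.
Proof.
apply: les => n.
- exact: bar_map_bd.
- exact: bar_map_bd.
- exact: bar_bd_bd.
- exact: push_id_exact.
Qed.

End BarSequence.

Section Translation.
Variables (L : fieldType) (Lam X : zmodType) (kappa : {additive Lam -> X}) (V : lmodType L).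

Definition trans_act (a : Lam) : {linear finsupp X V -> finsupp X V} :=
  push (fun x => kappa a + x) (fun=> idfun).

Lemma trans_act_fsing a x v : trans_act a (fsing x v) = fsing (kappa a + x) v.
Proof. exact: push_fsing. Qed.

Lemma trans_act0 x : trans_act 0 x = x.
Proof.
apply: (@eq_on_fsing _ _ _ _ (trans_act 0) idfun) => {}x v /=.
by rewrite trans_act_fsing raddf0 add0r.
Qed.

Lemma trans_actD a b x : trans_act (a + b) x = trans_act a (trans_act b x).
Proof.
apply: (@eq_on_fsing _ _ _ _ (trans_act (a + b)) (trans_act a \o trans_act b)) => {}x v /=.
by rewrite !trans_act_fsing raddfD addrA.
Qed.

(** This is [V (x) L[X]], with [Lambda] translating through [kappa]: a free module if [kappa] is
    bijective, a trivial one if [X] is zero. *)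
Definition trans_mod : gmod L (Delta (id_aut Lam)) :=
  @mk_gmod L Lam (id_aut Lam) _ trans_act idfun idfun trans_act0 trans_actD
    (fun=> erefl) (fun=> erefl) (fun _ _ => erefl).

Lemma trans_mod_fsing a x v : act_Lam trans_mod a (fsing x v) = fsing (kappa a + x) v.
Proof. exact: trans_act_fsing. Qed.

Definition consf n (y : Lam) (g : {ffun 'I_n -> Lam}) : {ffun 'I_n.+1 -> Lam} :=
  [ffun j => if unlift ord0 j is Some k then g k else y].

Lemma consf0 n y (g : {ffun 'I_n -> Lam}) : consf y g ord0 = y.
Proof. by rewrite ffunE unlift_none. Qed.

Lemma consfS n y (g : {ffun 'I_n -> Lam}) k : consf y g (lift ord0 k) = g k.
Proof. by rewrite ffunE liftK. Qed.

Lemma face0_consf n y (g : {ffun 'I_n -> Lam}) : face ord0 (consf y g) = g.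
Proof. by apply/ffunP => j; rewrite ffunE /= consfS. Qed.

Lemma face1_consf n y (g : {ffun 'I_n.+1 -> Lam}) :
  face (lift ord0 ord0) (consf y g) = consf (y + g ord0) (face ord0 g).
Proof.
apply/ffunP => j; rewrite ffunE /= consfS /bump /= addn0.
case: (unliftP ord0 j) => [k ->|->]; last first.
  by rewrite consf0 (_ : widen_ord _ _ = ord0) ?consf0 //; exact: val_inj.
by rewrite consfS /= ffunE /=.
Qed.

Lemma faceS_consf n (i : 'I_n.+2) y (g : {ffun 'I_n.+1 -> Lam}) : i != ord0 ->
  face (lift ord0 i) (consf y g) = consf y (face i g).
Proof.
rewrite -val_eqE /= => i0; apply/ffunP => j; rewrite ffunE /= consfS /bump /= add1n ltnS eqSS.
case: (unliftP ord0 j) => [k ->|->].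
  rewrite consfS [RHS]ffunE /= (_ : widen_ord _ (lift ord0 k) = lift ord0 (widen_ord (leqnSn _) k)).
    by rewrite consfS.
  exact: val_inj.
rewrite consf0 (_ : widen_ord _ _ = ord0) ?consf0; last exact: val_inj.
by rewrite /= lt0n i0.
Qed.

Variable kinv : X -> Lam.
Hypotheses (kappaK : cancel kappa kinv) (kinvK : cancel kinv kappa).
Local Notation P := trans_mod.

(** The homotopy x (x) [g_1|...] |-> 0 (x) [-x|g_1|...]. Face 0 acts by the inverse of the first
    entry, that is by x, and so restores the generator. *)
Definition contraction n : {linear bar_chain P n -> bar_chain P n.+1} :=
  lext (fun g => lext (fun x =>
    (fsing (consf (- kinv x) g) : {linear finsupp X V -> bar_chain P n.+1}) \o fsing 0)).

Lemma contraction_fsing n g x v :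
  contraction n (fsing g (fsing x v)) = fsing (consf (- kinv x) g) (fsing 0 v).
Proof. apply: etrans (lext_fsing _ _ _) _; exact: lext_fsing. Qed.

Lemma eq_on_fsing2 (Y : choiceType) (N : lmodType L) (f g : {linear finsupp Y P -> N}) :
  (forall y x v, f (fsing y (fsing x v)) = g (fsing y (fsing x v))) -> f =1 g.
Proof.
move=> fg; pose s y : {linear finsupp X V -> finsupp Y P} := fsing y.
exact: (@eq_on_fsing _ _ _ _ f g (fun y => @eq_on_fsing _ _ _ _ (f \o s y) (g \o s y) (fg y))).
Qed.

Lemma kinvB x b : - kinv x + b = - kinv (kappa (- b) + x).
Proof. by apply: (can_inj kappaK); rewrite raddfD !raddfN !kinvK opprD opprK addrC. Qed.

Lemma contraction_bd n (c : bar_chain P n.+1) :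
  bar_bd (contraction n.+1 c) + contraction n (bar_bd c) = c.
Proof.
apply: (@eq_on_fsing2 _ _ ((bar_diff P n.+1 \o contraction n.+1) \+ (contraction n \o bar_diff P n)) idfun).
move=> g x v.
change (bar_bd (contraction n.+1 (fsing g (fsing x v)))
  + contraction n (bar_bd (fsing g (fsing x v) : bar_chain P n.+1)) = fsing g (fsing x v)).
rewrite contraction_fsing !bar_bd_fsingS face0_consf !trans_mod_fsing consf0 opprK kinvK addr0.
(* The face that merges the new entry with the first old one cancels against the contraction of face
   0, by [kinvB]. The remaining faces cancel one by one. *)
rewrite (linearB (contraction n)) contraction_fsing (linear_sum (contraction n)) big_ord_recl expr0 scale1r face1_consf kinvB.
set u := fsing (consf _ _) _; rewrite opprD -addrA [- u - _]addrC -addrA addKr.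
rewrite addrA -addrA -opprD -big_split big1 ?subr0 // => i _.
rewrite (linearZ_LR (contraction n)) contraction_fsing exprS mulN1r scaleNr faceS_consf //; exact: addNr.
Qed.

Lemma trans_acyclic n (h : group_homology P n.+1) : h = 0.
Proof.
apply: (@homology_eq0 _ _ _ _ (@bar_bd _ _ _ P n.+1) (bar_out P n.+1)) => z /= z0.
exists (contraction n.+1 z); rewrite -[RHS]contraction_bd z0 linear0 addr0 //.
Qed.

(** The augmentation [aug] forgets the point of [X] and kills boundaries, and the contraction moves
    each chain to the point 0; so [j] and [aug] identify the homology in degree 0 with [V]. *)
Lemma trans_homology0 d : has_dim V d -> has_dim (group_homology P 0) d.
Proof.
pose t0 : {ffun 'I_0 -> Lam} := [ffun=> 0].
have t0E (t : {ffun 'I_0 -> Lam}) : t = t0 by apply/ffunP; case.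
pose j : {linear V -> bar_chain P 0} := (fsing t0 : {linear finsupp X V -> bar_chain P 0}) \o fsing 0.
pose aug : {linear bar_chain P 0 -> V} := lext (fun=> lext (fun=> idfun)).
have augE t x w : aug (fsing t (fsing x w)) = w.
  by apply: etrans (lext_fsing _ _ _) _; exact: lext_fsing.
have augbd (t : bar_chain P 1) : aug (bar_bd t) = 0.
  apply: (@eq_on_fsing2 _ _ (aug \o bar_diff P 0) \0) => {}t x w.
  change (aug (bar_bd (fsing t (fsing x w) : bar_chain P 1)) = 0).
  by rewrite bar_bd_fsingS big_ord1 expr0 scale1r linearB trans_mod_fsing !augE subrr.
have cP (z : bar_chain P 0) : bar_bd (contraction 0 z) = z - j (aug z).
  apply: (@eq_on_fsing2 _ _ (bar_diff P 0 \o contraction 0) (idfun \- (j \o aug))) => t x v.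
  change (bar_bd (contraction 0 (fsing t (fsing x v))) =
    fsing t (fsing x v) - fsing t0 (fsing 0 (aug (fsing t (fsing x v))))).
  rewrite contraction_fsing bar_bd_fsingS big_ord1 expr0 scale1r.
  by rewrite face0_consf trans_mod_fsing consf0 opprK kinvK addr0 augE (t0E t) (t0E (face _ _)).
have [|v||q qP] := @linear_of_rel _ V (group_homology P 0) (fun v h => class_of (j v) h).
- move=> c x y x' y' xy xy'; rewrite linearP; exact: class_of_linear.
- exact: class_of_ex.
- by move=> y; rewrite linear0 => /class_of_uniq; apply; exact: class_of00.
move=> [phi bij]; have [g [phiK gK]] := linear_inv bij.
apply: (@has_dimP _ _ _ (q \o g)); apply: bij_comp; last by exists phi.
apply: linear_bij.
  apply: linear_inj => v qv; have /qP := esym qv; rewrite class_of0 => -[_ [t tE]].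
  by have := augbd t; rewrite tE augE.
move=> h; have [z zh] := class_of_surj h.
exists (aug z); symmetry; apply/qP.
have /(class_of0 _ _ _).2 t0h : bar_out P 0 (z - j (aug z)) = 0 /\
  exists t, bar_bd t = z - j (aug z) by split=> //; exists (contraction 0 z); exact: cP.
have := class_of_linear (-1) t0h zh.
by rewrite scaler0 add0r scaleN1r opprB subrK.
Qed.

End Translation.

(** * Triviality of the action on homology *)

Section TrivialAction.
Variables (L : fieldType) (Lam : zmodType).

Section Presentation.
Variables (psi : zmod_aut Lam) (M : gmod L (Delta psi)).
Local Notation P := (trans_mod (idfun : {additive Lam -> Lam}) M).

(** [P] is built on the vector space underlying [M], hence free and acyclic in positive degrees; the
    action on [M] enters through this map. *)
Definition presentation : {linear P -> M} := lext (fun x => act_Lam M x).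

Lemma presentation_Lam : Lam_equivariant presentation.
Proof.
move=> a; apply: (@eq_on_fsing _ _ _ _ (presentation \o act_Lam P a) (act_Lam M a \o presentation)).
by move=> x m; rewrite /= trans_mod_fsing /presentation /= !lext_fsing act_LamD.
Qed.

Lemma presentation_surj m : exists x, presentation x = m.
Proof. by exists (fsing 0 m); rewrite /presentation /= lext_fsing act_Lam0. Qed.

Let rho a := projT1 (cid (ker_endo (presentation_Lam a))).
Let rhoE a x : val (rho a x) = act_Lam P a (val x).
Proof. exact: (projT2 (cid (ker_endo (presentation_Lam a))) x). Qed.

Let rho0 x : rho 0 x = x.
Proof. by apply: val_inj; rewrite rhoE act_Lam0. Qed.

Let rhoD a b x : rho (a + b) x = rho a (rho b x).
Proof. by apply: val_inj; rewrite !rhoE act_LamD. Qed.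

Definition relations : gmod L (Delta (id_aut Lam)) :=
  @mk_gmod L Lam (id_aut Lam) _ rho idfun idfun rho0 rhoD
    (fun=> erefl) (fun=> erefl) (fun _ _ => erefl).

Definition relations_incl : {linear relations -> P} := val.

Lemma relations_Lam : Lam_equivariant relations_incl.
Proof. by move=> a x; exact: rhoE. Qed.

Lemma presentation_exact : exact_seq relations_incl presentation.
Proof.
split; [exact: val_inj | exact: presentation_surj |].
by move=> y; split; [exact: cycle_ex | case=> x <-; exact: cycleP].
Qed.

End Presentation.

Lemma act_Lam_equivariant (psi : zmod_aut Lam) (M : gmod L (Delta psi)) a :
  Lam_equivariant (act_Lam M a).
Proof. by move=> b x; rewrite -!act_LamD addrC. Qed.

(* Dimension shifting along [0 -> relations -> L[Lam] (x) M -> M -> 0]. *)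
Lemma homology_Lam_trivial i (psi : zmod_aut Lam) (M : gmod L (Delta psi)) a :
  induces (bar_map (act_Lam M a) i) (@id (group_homology M i)).
Proof.
elim: i psi M => [|i IH] psi M.
  move=> z h zh.
  have [h' zh'] := @class_of_ex _ _ _ _ (@bar_bd _ _ _ M 0) (bar_out M 0)
    (bar_map (act_Lam M a) 0 z) erefl.
  suff <- : h' = h by [].
  apply/eqP; rewrite -subr_eq0 addrC; apply/eqP.
  have := class_of_linear (-1) zh zh'; rewrite !scaleN1r => /class_of_uniq; apply; apply/class_of0.
  split=> //.
  (* Face 0 acts by the inverse of the entry, so the entry [- a] produces the boundary [a m - m]. *)
  pose t : {linear bar_chain M 0 -> bar_chain M 1} :=
    push (fun=> [ffun=> - a] : {ffun 'I_1 -> Lam}) (fun=> idfun).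
  exists (t z).
  have E0 (s s' : {ffun 'I_0 -> Lam}) : s = s' by apply/ffunP; case.
  rewrite addrC; apply: (@eq_on_fsing _ _ _ _ (bar_diff M 0 \o t) ((bar_map (act_Lam M a) 0) \- idfun)).
  move=> {zh zh'} s m.
  change (bar_bd (t (fsing s m)) = bar_map (act_Lam M a) 0 (fsing s m) - fsing s m).
  have -> : t (fsing s m) = fsing [ffun=> - a] m by exact: push_fsing.
  rewrite bar_bd_fsingS big_ord1 expr0 scale1r ffunE opprK bar_map_fsing.
  by rewrite (E0 (face _ _) s) (E0 (face _ _) s).
move=> z h zh.
have [a' [b [del lesP]]] := bar_les (@relations_Lam psi M) (@presentation_Lam psi M) (presentation_exact M).
have [h' zh'] : exists h' : group_homology M i.+1, class_of (bar_map (act_Lam M a) i.+1 z) h'.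
  apply: class_of_ex; have := class_of_cycle zh => /= bz.
  by rewrite -bar_map_bd ?bz ?linear0 //; exact: act_Lam_equivariant.
suff <- : h' = h by [].
pose G := @homology_map _ _ _ _ _ _ _ _ _ _ _ _ _ _ (bar_map_bd (@act_Lam_equivariant psi M a) (n := i.+1))
   (bar_map_bd (@act_Lam_equivariant psi M a) (n := i) : forall x, bar_map _ _ (bar_out M i.+1 x) = bar_out M i.+1 (bar_map _ _ x)).
have GP : induces (bar_map (act_Lam M a) i.+1) G by exact: homology_map_induces.
have -> : h' = G h by apply: class_of_uniq zh' _; exact: GP.
(* The middle module has no homology in positive degrees. The connecting map is therefore injective
   and carries the claim to [relations], one degree lower. *)
have del_inj : injective (del i).
  apply: linear_inj => x /(les_bd lesP)[y <-].
  by rewrite (@trans_acyclic L Lam Lam idfun M id (fun=> erefl) (fun=> erefl) i y) linear0.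
apply: del_inj.
have gd n x : bar_map (act_Lam (trans_mod idfun M) a) n (bar_diff (trans_mod idfun M) n x) =
    bar_diff (trans_mod idfun M) n (bar_map (act_Lam (trans_mod idfun M) a) n.+1 x).
  by apply: bar_map_bd; exact: act_Lam_equivariant.
have gf n x : bar_map (relations_incl M) n (bar_map (act_Lam (relations M) a) n x) =
    bar_map (act_Lam (trans_mod idfun M) a) n (bar_map (relations_incl M) n x).
  by rewrite /bar_map /= !push_comp; apply: eq_push => // t y; exact: relations_Lam.
have gp n x : bar_map (presentation M) n (bar_map (act_Lam (trans_mod idfun M) a) n x) =
    bar_map (act_Lam M a) n (bar_map (presentation M) n x).
  by rewrite /bar_map /= !push_comp; apply: eq_push => // t y; exact: presentation_Lam.
exact: (les_natural_del lesP gd gf gp GP (IH _ _) h).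
Qed.

End TrivialAction.

Section HomologyIso.
Variable L : fieldType.

Lemma homology_map_bij (U V W U' V' W' : lmodType L)
    (f : {linear U -> V}) (g : {linear V -> W})
    (f' : {linear U' -> V'}) (g' : {linear V' -> W'})
    (pU : {linear U -> U'}) (pV : {linear V -> V'}) (pW : {linear W -> W'})
    (pf : forall x, pV (f x) = f' (pU x)) (pg : forall x, pW (g x) = g' (pV x)) :
  bijective pU -> bijective pV -> bijective pW -> bijective (homology_map pf pg).
Proof.
move=> /linear_inv[qU [pUK qUK]] /linear_inv[qV [pVK qVK]] bW.
have ind := homology_map_induces pf pg; apply: linear_bij.
  apply: linear_inj => h Fh; have [z zh] := class_of_surj h.
  have := ind _ _ zh; rewrite Fh => /class_of0[_ [t' tE]].
  apply: (class_of_uniq zh); apply/class_of0; split; first exact: class_of_cycle zh.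
  by exists (qU t'); apply: (can_inj pVK); rewrite pf qUK tE.
move=> h'; have [z' zh'] := class_of_surj h'.
have gz : g (qV z') = 0.
  by apply: (bij_inj bW); rewrite pg qVK linear0 (class_of_cycle zh').
have [h zh] := class_of_ex f gz; exists h.
by have := ind _ _ zh; rewrite qVK => /class_of_uniq; apply.
Qed.

Lemma has_dim_bij (V W : lmodType L) (f : {linear V -> W}) d :
  bijective f -> has_dim V d -> has_dim W d.
Proof.
move=> bf [phi /linear_inv[g [gK Kg]]].
apply: (has_dimP (g := f \o g)); apply: bij_comp => //; by exists phi.
Qed.

Lemma has_dim0 (V : lmodType L) : (forall x : V, x = 0) -> has_dim V 0.
Proof.
move=> V0; exists \0; apply: linear_bij => [x y _|y]; first by rewrite (V0 x) (V0 y).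
by exists 0; apply/rowP; case.
Qed.

Lemma has_dim_regular : has_dim L^o 1.
Proof.
have [|x||phi phiP] := @linear_of_rel L L^o 'rV[L]_1 (fun x w => w = const_mx x).
- by move=> c x _ y _ -> ->; apply/rowP => i; rewrite !mxE.
- by exists (const_mx x).
- by move=> _ ->; apply/rowP => i; rewrite !mxE.
have phiE x : phi x = const_mx x by symmetry; apply/phiP.
exists phi; apply: linear_bij => [x y|y].
  by rewrite !phiE => /rowP/(_ 0); rewrite !mxE.
by exists (y 0 0); rewrite phiE; apply/rowP => i; rewrite mxE (ord1 i).
Qed.

Variables (Lam : zmodType) (psi psi' : zmod_aut Lam).
Variables (M : gmod L (Delta psi)) (N : gmod L (Delta psi')) (f : {linear M -> N}).

Lemma bar_map_bij n : bijective f -> bijective (bar_map f n).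
Proof.
move=> /linear_inv[g [fK gK]]; exists (bar_map g n).
  by move=> c; apply: finsupp_eq => x; rewrite !bar_mapE fK.
by move=> c; apply: finsupp_eq => x; rewrite !bar_mapE gK.
Qed.

Lemma group_homology_iso : Lam_equivariant f -> bijective f ->
  forall i, exists F : {linear group_homology M i -> group_homology N i},
    bijective F /\ induces (bar_map f i) F.
Proof.
move=> fLam bf i.
have pf := @bar_map_bd _ _ _ _ M N f fLam.
have pg : forall x, bar_map f i.-1 (bar_out M i x) = bar_out N i (bar_map f i x).
  by case: i => [|i] x; [exact: linear0 | exact: pf].
exists (homology_map (pf i) pg); split; last exact: homology_map_induces.
by apply: homology_map_bij; exact: bar_map_bij.
Qed.

End HomologyIso.

Section ScalarModule.
Variables (L : fieldType) (Lam : zmodType) (psi : zmod_aut Lam) (V : lmodType L).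
Variables (chi : Lam -> L) (c : L).
Hypotheses (chi0 : chi 0 = 1) (chiD : forall a b, chi (a + b) = chi a * chi b)
  (chipsi : forall a, chi (psi a) = chi a) (c0 : c != 0).

Definition scal_map (k : L) : {linear V -> V} := k \*: idfun.

Let rho a := scal_map (chi a).
Let rho0 x : rho 0 x = x. Proof. by rewrite /rho /= chi0 scale1r. Qed.
Let rhoD a b x : rho (a + b) x = rho a (rho b x).
Proof. by rewrite /rho /= chiD scalerA. Qed.
Let UK : cancel (scal_map c) (scal_map c^-1).
Proof. by move=> x; rewrite /= scalerA mulVf // scale1r. Qed.
Let UiK : cancel (scal_map c^-1) (scal_map c).
Proof. by move=> x; rewrite /= scalerA mulfV // scale1r. Qed.
Let Urho a x : scal_map c (rho a x) = rho (psi a) (scal_map c x).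
Proof. by rewrite /rho /= chipsi !scalerA mulrC. Qed.

Definition scal_mod : gmod L (Delta psi) := mk_gmod rho0 rhoD UK UiK Urho.

Lemma scal_mod_Lam a x : act_Lam scal_mod a x = chi a *: x. Proof. by []. Qed.
Lemma scal_mod_u x : act_u scal_mod x = c *: x. Proof. exact: mk_gmod_u. Qed.

End ScalarModule.

Section ShiftExact.
Variables (L : fieldType) (X : zmodType) (V : lmodType L).
Local Notation C := (finsupp (int * X)%type V).

Definition shift1 : {linear C -> C} := push (fun kx : int * X => (1 + kx.1, kx.2)) (fun=> idfun).
Definition sum_out : {linear C -> finsupp X V} := push snd (fun=> idfun).

Lemma shift1_fsing k x v : shift1 (fsing (k, x) v) = fsing (1 + k, x) v.
Proof. exact: push_fsing. Qed.

Lemma sum_out_fsing k x v : sum_out (fsing (k, x) v) = fsing x v.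
Proof. exact: push_fsing. Qed.

Lemma shift1E (c : C) k x : shift1 c (1 + k, x) = c (k, x).
Proof.
elim/finsupp_ind: c => [|c e IHc IHe|[l y] m]; first by rewrite linear0.
  by rewrite linearD !finsuppDE IHc IHe.
by rewrite shift1_fsing !fsingE !xpair_eqE (inj_eq (addrI 1)).
Qed.

(** A finitely supported function that is invariant under the shift vanishes, and modulo the image
    of the shift minus 1 each generator at [(k, x)] agrees with the one at [(0, x)]. *)
Lemma shift1_exact : exact_seq (shift1 \- idfun : {linear C -> C}) sum_out.
Proof.
split.
- apply: linear_inj => c /= /eqP; rewrite subr_eq0 => /eqP sc.
  have cE k x : c (1 + k, x) = c (k, x) by rewrite -{1}sc shift1E.
  have cn n k x : c (n%:Z + k, x) = c (k, x).
    by elim: n => [|n IH]; rewrite ?add0r // -IH -[RHS]cE addrA -intS.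
  apply: finsupp_eq => -[k x]; apply: contrapT => ckx; apply: infinite_nat.
  have finj : injective (fun n => (n%:Z + k, x)) by move=> m n [] /addIr [].
  apply: sub_finite_set (finite_preimage (in2W finj) (finsuppP c)).
  by move=> n _ /=; rewrite cn; apply/eqP.
- elim/finsupp_ind => [|_ _ [c <-] [e <-]|x m]; first by exists 0; rewrite linear0.
    by exists (c + e); rewrite linearD.
  by exists (fsing (0, x) m); rewrite sum_out_fsing.
move=> c; split=> [cz|[b <-]]; last first.
  apply: (@eq_on_fsing _ _ _ _ (sum_out \o (shift1 \- idfun)) \0) => -[k x] m.
  change (sum_out (shift1 (fsing (k, x) m) - fsing (k, x) m) = 0).
  by rewrite linearB shift1_fsing !sum_out_fsing subrr.
pose io : {linear finsupp X V -> C} := push (fun x => (0, x)) (fun=> idfun).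
suff [b bE] : exists b, (shift1 \- idfun : {linear C -> C}) b = c - io (sum_out c).
  by exists b; rewrite bE cz linear0 subr0.
elim/finsupp_ind: c {cz} => [|c e [b1 b1E] [b2 b2E]|[k x] m].
- by exists 0; rewrite !linear0 addr0.
- by exists (b1 + b2); rewrite linearD b1E b2E !linearD /= addrACA.
have ioE : io (sum_out (fsing (k, x) m)) = fsing (0, x) m.
  by rewrite sum_out_fsing; exact: push_fsing.
rewrite ioE; elim: k {ioE} => [|k [b bE]|k [b bE]].
- by exists 0; rewrite linear0 subrr.
- exists (b + fsing (k%:Z, x) m); rewrite linearD bE.
  have -> : (shift1 \- idfun : {linear C -> C}) (fsing (k%:Z, x) m) =
    fsing (1 + k%:Z, x) m - fsing (k%:Z, x) m by rewrite -shift1_fsing.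
  by rewrite intS addrC addrA subrK.
exists (b - fsing (- k.+1%:Z, x) m); rewrite linearB bE.
have -> : (shift1 \- idfun : {linear C -> C}) (fsing (- k.+1%:Z, x) m) =
  fsing (1 - k.+1%:Z, x) m - fsing (- k.+1%:Z, x) m by rewrite -shift1_fsing.
have -> : 1 - k.+1%:Z = - k%:Z by lia.
by rewrite opprB addrC addrA subrK.
Qed.

End ShiftExact.

(** * Dimensions of the homology of the trivial module *)

Section TrivialHomology.
Variables (L : fieldType) (Lam : zmodType) (r : nat) (phi : {additive Lam -> 'rV[int]_r}).
Hypothesis phi_bij : bijective phi.

(** Coordinates are indexed by natural numbers, with value 0 from [r] on, to fit the recursion on
    the rank. *)
Definition coord_fun (k : nat) (a : Lam) : int := oapp (phi a 0) 0 (insub k).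

Lemma coord_zmod k : zmod_morphism (coord_fun k).
Proof.
move=> a b; rewrite /coord_fun; case: insubP => [i _ _|_] /=; last by rewrite subr0.
by rewrite raddfB !mxE.
Qed.

HB.instance Definition _ k := GRing.isZmodMorphism.Build Lam int (coord_fun k) (coord_zmod k).

Lemma coord0 k : coord_fun k 0 = 0. Proof. exact: raddf0. Qed.

(** Z^j as nested pairs, so that the passage from [j] to [j.+1] is the product with [int] of
    [shift1_exact]. *)
Fixpoint lattice (j : nat) : zmodType := if j is j'.+1 then (int * lattice j')%type else 'rV[int]_0.

Fixpoint lat_fun (j : nat) : Lam -> lattice j :=
  match j with 0 => fun=> 0 | j'.+1 => fun a => (coord_fun j' a, lat_fun j' a) end.

Lemma lat_zmod j : zmod_morphism (lat_fun j).
Proof. by elim: j => [|j IH] a b /=; [rewrite subr0 | rewrite raddfB IH]. Qed.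

HB.instance Definition _ j := GRing.isZmodMorphism.Build Lam (lattice j) (lat_fun j) (lat_zmod j).

Lemma eq_lat_fun j a b :
  (forall k, (k < j)%N -> coord_fun k a = coord_fun k b) -> lat_fun j a = lat_fun j b.
Proof.
elim: j => //= j IH e; rewrite e // IH // => k kj; apply: e; exact: ltnW.
Qed.

Lemma coord_basis k : (k < r)%N ->
  exists e, forall l, coord_fun l e = (l == k)%:R.
Proof.
move=> kr; have [phi' _ phiK] := phi_bij.
exists (phi' (delta_mx 0 (Ordinal kr))) => l; rewrite /coord_fun phiK.
case: insubP => [i _ <-|] /=; first by rewrite mxE eqxx -val_eqE /=.
by case: eqP => // ->; rewrite kr.
Qed.

Lemma lat_basis j : (j < r)%N -> exists e, lat_fun j.+1 e = (1, 0).
Proof.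
move=> jr; have [e eE] := coord_basis jr; exists e; rewrite /= eE eqxx; congr pair.
rewrite -(raddf0 (lat_fun j : {additive Lam -> lattice j})); apply: eq_lat_fun => k kj.
by rewrite eE ltn_eqF // coord0.
Qed.

Lemma lat_surj j x : (j <= r)%N ->
  exists a, lat_fun j a = x /\ forall k, (j <= k)%N -> coord_fun k a = 0.
Proof.
elim: j x => [|j IH] x jr.
  by exists 0; split=> [|k _]; [apply/rowP; case | rewrite coord0].
case: x => m x; have [a [ax a0]] := IH x (ltnW jr); have [e eE] := coord_basis jr.
have cE k : coord_fun k (a + e *~ m) = coord_fun k a + (k == j)%:R * m.
  by rewrite raddfD raddfMz /= eE -mulrzr intz.
exists (a + e *~ m); split=> [|k jk].
  rewrite /= cE a0 // eqxx mul1r add0r -ax; congr pair; apply: eq_lat_fun => k kj.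
  by rewrite cE ltn_eqF // mul0r addr0.
by rewrite cE a0 ?(ltnW jk) // gtn_eqF // mul0r addr0.
Qed.

Lemma lat_inj : injective (lat_fun r).
Proof.
have coordE j a b : lat_fun j a = lat_fun j b -> forall k, (k < j)%N -> coord_fun k a = coord_fun k b.
  elim: j => //= j IH [e /IH ej] k; rewrite ltnS leq_eqVlt => /predU1P[->|] //; exact: ej.
move=> a b /coordE e; apply: (bij_inj phi_bij); apply/rowP => i.
by have := e i (ltn_ord i); rewrite /coord_fun valK.
Qed.

Definition lat_mod j : gmod L (Delta (id_aut Lam)) := trans_mod (lat_fun j) L^o.

(** Only the coordinates below [r - m] act, and the kernel of this action has rank [m], whence the
    binomial coefficient. In the step, a basis vector minus 1 is injective on [L[Z^(j+1)]] with
    cokernel [L[Z^j]] and induces zero on homology; the long exact sequence splits and gives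
    Pascal's rule. For [m = 0] the module is free, for [m = r] it is trivial. *)
Lemma lat_mod_homology m i : (m <= r)%N -> has_dim (group_homology (lat_mod (r - m)) i) 'C(m, i).
Proof.
elim: m i => [|m IH] i mr.
  rewrite subn0.
  have /choice[kinv kinvK] : forall x, exists a, lat_fun r a = x.
    by move=> x; have [a [ax _]] := lat_surj x (leqnn r); exists a.
  have latK : cancel (lat_fun r) kinv by move=> a; apply: lat_inj; rewrite kinvK.
  case: i => [|i]; last by apply: has_dim0; exact: (trans_acyclic latK kinvK).
  rewrite bin0; exact: (@trans_homology0 L Lam (lattice r) (lat_fun r) L^o kinv kinvK 1%N (has_dim_regular L)).
have jr : (r - m.+1 < r)%N by rewrite subnS; lia.
have eS : (r - m = (r - m.+1).+1)%N by lia.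
move: (r - m.+1)%N jr eS => j jr eS; rewrite eS in IH.
have [e eE] := lat_basis jr.
pose M1 := lat_mod j.+1; pose M0 := lat_mod j.
pose D : {linear M1 -> M1} := shift1 (lattice j) L^o \- idfun.
pose q : {linear M1 -> M0} := sum_out (lattice j) L^o.
have shE x : shift1 (lattice j) L^o x = act_Lam M1 e x.
  apply: (@eq_on_fsing _ _ _ _ (shift1 (lattice j) L^o) (act_Lam M1 e)) => -[k y] v.
  rewrite shift1_fsing trans_mod_fsing; congr (fsing _ _).
  transitivity ((1, 0) + (k, y) : lattice j.+1); last by rewrite -eE.
  by rewrite -{1}[y]add0r.
have DE x : D x = act_Lam M1 e x - x by rewrite -shE.
have DLam : Lam_equivariant D.
  move=> a x; rewrite !DE linearB; congr (_ - _).
  exact: (@act_Lam_equivariant _ _ _ M1 e).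
have qLam : Lam_equivariant q.
  move=> a; apply: (@eq_on_fsing _ _ _ _ (q \o act_Lam M1 a) (act_Lam M0 a \o q)) => -[k x] v.
  change (q (act_Lam M1 a (fsing (k, x) v)) = act_Lam M0 a (q (fsing (k, x) v))).
  by rewrite trans_mod_fsing !sum_out_fsing trans_mod_fsing.
have [a [b [del lesP]]] := bar_les DLam qLam (shift1_exact (lattice j) L^o).
have a0 n h : a n h = 0.
  have [z zh] := class_of_surj h.
  have := les_a lesP zh; have -> : bar_map D n z = bar_map (act_Lam M1 e) n z - z.
    by apply: finsupp_eq => t; rewrite [RHS]finsuppDE !bar_mapE DE.
  move/class_of_uniq; apply.
  have := class_of_linear (-1) zh (@homology_Lam_trivial _ _ n _ M1 e _ _ zh).
  by rewrite !scaleN1r addNr addrC.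
have [exs bij] := long_exact_short (les_ab lesP) (les_bd lesP) (les_da lesP) (les_b0 lesP) a0.
case: i => [|i].
  by apply: has_dim_bij bij _; have := IH 0%N (ltnW mr); rewrite !bin0.
by rewrite binS; apply: exact_dim (exs i) (IH _ (ltnW mr)) (IH _ (ltnW mr)).
Qed.

End TrivialHomology.

(** * Principal minors *)

Section Minors.
Variable R : comNzRingType.

Lemma det_perm_conj n (X : 'M[R]_n) (s : 'S_n) :
  \det (\matrix_(i, j) X (s i) (s j)) = \det X.
Proof.
have -> : \matrix_(i, j) X (s i) (s j) = row_perm s (col_perm s X).
  by apply/matrixP => i j; rewrite !mxE.
rewrite row_permE col_permE !det_mulmx !det_perm mulrC -mulrA -signr_addb.
by rewrite odd_permV addbb mulr1.
Qed.

(** Listing the image of [s] first and then that of [s'], its complement, makes the matrix block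
    triangular with an identity block. *)
Lemma det_minor n m (r : nat) (A : 'M[R]_r) (s : 'I_n -> 'I_r) (s' : 'I_m -> 'I_r) :
    (n + m)%N = r -> injective s -> injective s' -> (forall a b, s a != s' b) ->
  \det (\matrix_(i, j) (if i \in codom s then A i j else (i == j)%:R))
  = \det (\matrix_(a, b) A (s a) (s b)).
Proof.
move=> e; subst r => sinj s'inj ss'.
pose f (k : 'I_(n + m)) := match fintype.split k with inl a => s a | inr b => s' b end.
have finj : injective f.
  move=> k l; rewrite /f; case: (splitP k) => a ka; case: (splitP l) => b lb.
  - by move=> /sinj ab; apply: val_inj; rewrite /= ka lb ab.
  - by move=> ab; have := ss' a b; rewrite ab eqxx.
  - by move=> ab; have := ss' b a; rewrite ab eqxx.
  - by move=> /s'inj ab; apply: val_inj; rewrite /= ka lb ab.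
set X := \matrix_(i, j) _; rewrite -(det_perm_conj X (perm finj)).
have fl a : f (lshift m a) = s a.
  by rewrite /f; case: splitP => b /= ab; [congr s; exact: val_inj | have := ltn_ord a; rewrite ab ltnNge leq_addr].
have fr b : f (rshift n b) = s' b.
  rewrite /f; case: splitP => a /= ab; last by congr s'; apply: val_inj; apply: (@addnI n).
  by have := ltn_ord a; rewrite -ab ltnNge leq_addr.
have s'S b : (s' b \in codom s) = false.
  by apply/negbTE/negP => /codomP[a] /esym/eqP; exact/negP.
have -> : \matrix_(i, j) X (perm finj i) (perm finj j) =
   block_mx (\matrix_(a, b) A (s a) (s b)) (\matrix_(a, b) A (s a) (s' b)) 0 1%:M.
  rewrite -[LHS]submxK; congr block_mx; apply/matrixP => a b; rewrite !mxE !permE ?fl ?fr ?codom_f ?s'S //.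
    by rewrite eq_sym (negbTE (ss' _ _)).
  by rewrite (inj_eq s'inj).
by rewrite det_ublock det1 mulr1.
Qed.

(** Each row of 1 - A is split into a row of -A and a row of 1; [S] collects the rows taken from
    -A. *)
Lemma det_1sub (r : nat) (A : 'M[R]_r) :
  \det (1%:M - A) = \sum_(S : {set 'I_r})
     (-1) ^+ #|S| * \det (\matrix_(i, j) (if i \in S then A i j else (i == j)%:R)).
Proof.
rewrite /determinant.
under eq_bigr => s _.
  under eq_bigr => i _ do rewrite !mxE addrC.
  rewrite bigA_distr mulr_sumr; over.
rewrite exchange_big /=; apply: eq_bigr => S _; rewrite mulr_sumr; apply: eq_bigr => s _.
rewrite mulrCA; congr (_ * _).
under [in RHS]eq_bigr do rewrite mxE.
rewrite -prodr_const [X in X * _]big_mkcond -big_split /=; apply: eq_bigr => i _.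
by case: ifP; rewrite ?mulN1r ?mul1r.
Qed.

End Minors.

(** In a space of dimension [d], duality with [d] functionals makes the [e k] a basis, with the
    [l k] as its coordinates. *)
Lemma is_trace_dual (L : fieldType) (V : lmodType L) d (f : {linear V -> V})
    (l : 'I_d -> {linear V -> L^o}) (e : 'I_d -> V) :
    has_dim V d -> (forall k m, l k (e m) = (k == m)%:R) ->
  is_trace f (\sum_k l k (f (e k))).
Proof.
move=> [phi0 /linear_inv[g [phi0K gK]]] le.
have [|v||phi phiP] := @linear_of_rel L V 'rV[L]_d (fun v y => y = \row_k l k v).
- by move=> b x _ y _ -> ->; apply/rowP => k; rewrite !mxE linearP.
- by exists (\row_k l k v).
- by move=> _ ->; apply/rowP => k; rewrite !mxE linear0.
have phiE v : phi v = \row_k l k v by symmetry; apply/phiP.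
have phie m : phi (e m) = delta_mx 0 m.
  by rewrite phiE; apply/rowP => k; rewrite !mxE le eqxx.
have phiS (y : 'rV[L]_d) : phi (\sum_k y 0 k *: e k) = y.
  rewrite linear_sum [RHS]row_sum_delta; apply: eq_bigr => k _.
  by rewrite linearZ_LR phie.
have [B BE] := linear_mx (phi \o g).
pose E : 'M[L]_d := \matrix_k phi0 (e k).
have EB : E *m B = 1%:M.
  by apply/row_matrixP => k; rewrite row_mul rowK -BE /= phi0K phie rowE mulmx1.
have BE1 := mulmx1C EB.
have bij : bijective phi.
  apply: linear_bij => [|y]; last by exists (\sum_k y 0 k *: e k).
  apply: linear_inj => x px; rewrite -[x]phi0K.
  have : phi0 x *m B = 0 by rewrite -BE /= phi0K.
  move=> /(congr1 (mulmx^~ E)); rewrite -mulmxA BE1 mulmx1 mul0mx => ->.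
  exact: linear0.
have [A AE] := mx_of_endo f bij; exists d, phi, A; split=> //.
apply: eq_bigr => k _; have := AE (e k); rewrite phie => /rowP/(_ k).
by rewrite -rowE phiE !mxE => <-.
Qed.

(** * Alternating cycles and products of homomorphisms *)

Section TrivialTrace.
Variables (L : closedFieldType) (charL : [pchar L] =i pred0).
Variables (Lam : zmodType) (psi : zmod_aut Lam).
Variables (M : gmod L (Delta psi)) (w : M) (ell : {linear M -> L^o}) (c : L).
Hypotheses (M_Lam : forall a x, act_Lam M a x = x) (M_u : forall x, act_u M x = c *: x)
  (ellw : ell w = 1).

Definition cup n (f : 'I_n -> Lam -> L) : {linear bar_chain M n -> L^o} :=
  lext (fun t : {ffun 'I_n -> Lam} => (\prod_j f j (t j)) \*: ell).

Lemma cup_fsing n (f : 'I_n -> Lam -> L) t m : cup f (fsing t m) = (\prod_j f j (t j)) * ell m.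
Proof. exact: lext_fsing. Qed.

Lemma alternating_telescope m (A : nat -> L) :
  \sum_(i < m.+1) (-1) ^+ i * ((if (i < m)%N then A i else 0) + (if (0 < i)%N then A i.-1 else 0)) = 0.
Proof.
rewrite (eq_bigr (fun i : 'I_m.+1 => (-1) ^+ i * (if (i < m)%N then A i else 0) +
  (-1) ^+ i * (if (0 < i)%N then A i.-1 else 0))); last by move=> i _; rewrite mulrDr.
rewrite big_split /= big_ord_recr /= ltnn mulr0 addr0 [X in _ + X]big_ord_recl /= mulr0 add0r.
rewrite -big_split big1 // => i _ /=.
by rewrite ltn_ord /bump add1n exprS mulN1r mulNr subrr.
Qed.

(** Let [A k] be the product formed with entry [k] of [t] left out. By additivity, an inner face
    [i], which adds two neighbours, contributes [A i + A i.-1], and each outer face contributes one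
    product; the alternating sum telescopes. *)
Lemma cup_bd n (f : 'I_n -> Lam -> L) (z : bar_chain M n.+1) :
  (forall j a b, f j (a + b) = f j a + f j b) -> cup f (bar_bd z) = 0.
Proof.
move=> fD; apply: (@eq_on_fsing _ _ _ _ (cup f \o bar_diff M n) \0) => t m.
change (cup f (bar_bd (fsing t m)) = 0).
pose A k := \prod_j f j (if (j < k)%N then t (widen_ord (leqnSn n) j) else t (lift ord0 j)).
rewrite bar_bd_fsing linear_sum.
suff E (i : 'I_n.+2) : cup f ((-1) ^+ i *: fsing (face i t) (face_coef M i t m)) =
    (-1) ^+ i * ((if (i < n.+1)%N then A i else 0) + (if (0 < i)%N then A i.-1 else 0)) * ell m.
  rewrite (eq_bigr _ (fun i _ => E i)).
  have := congr1 (fun x : L => x * ell m) (alternating_telescope n.+1 A).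
  by rewrite mulr_suml mul0r.
rewrite linearZ_LR cup_fsing /= -mulrA; congr (_ * _).
have -> : ell (face_coef M i t m) = ell m by rewrite /face_coef; case: ifP; rewrite ?M_Lam.
congr (_ * _); case: (posnP i) => [i0|i0].
  rewrite i0 /= addr0; apply: eq_bigr => j _; by rewrite ffunE i0.
have [ilt|ige] := ltnP i n.+1; last first.
  have ei : i = n.+1 :> nat by apply/eqP; rewrite eqn_leq ige -ltnS ltn_ord.
  rewrite add0r ei; apply: eq_bigr => j _; by rewrite ffunE ei ltnS ltn_ord.
have ltk : (i.-1 < n)%N by lia.
rewrite /A (bigD1 (Ordinal ltk)) // [X in _ = X + _](bigD1 (Ordinal ltk)) // [X in _ = _ + X](bigD1 (Ordinal ltk)) //=.
rewrite ffunE /= prednK // ltnn eqxx fD mulrDl leqnn.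
have -> : (i <= i.-1)%N = false by lia.
congr (_ + _); congr (_ * _).
- apply: eq_bigr => j; rewrite -val_eqE /= ffunE => jk.
  have -> : (j.+1 == i) = false by lia.
  by have -> : (j.+1 < i)%N = (j < i)%N by lia.
- apply: eq_bigr => j; rewrite -val_eqE /= ffunE => jk.
  have -> : (j.+1 == i) = false by lia.
  by have -> : (j.+1 < i)%N = (j < i.-1)%N by lia.
Qed.

(** The antisymmetrised chain, a representative of the exterior product of the [v i] in the homology
    of [Lambda]. *)
Definition alt n (v : 'I_n -> Lam) : bar_chain M n :=
  \sum_(s : 'S_n) (-1) ^+ s *: fsing [ffun j => v (s j)] w.

(** The cyclic shift: it turns dropping the last entry into dropping the first. *)
Lemma sign_perm_shift m : exists s : 'S_m.+1,
  odd_perm s = odd m /\ forall j : 'I_m, s (widen_ord (leqnSn m) j) = lift ord0 j.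
Proof.
exists (lift_perm ord_max ord0 1%g); split; first by rewrite odd_lift_perm odd_perm1 /= addbF addbF.
move=> j; have -> : widen_ord (leqnSn m) j = lift ord_max j.
  by apply: val_inj; rewrite /= /bump leqNgt ltn_ord.
by rewrite lift_perm_lift perm1.
Qed.

Lemma neq0_2 : (2%:R : L) != 0.
Proof.
by have := charL 2%N; rewrite !inE /= => /negbT.
Qed.

(** An inner face is symmetric in the two entries it adds, so a transposition shows that its total
    equals its negative and vanishes, 2 being invertible. The two outer faces are exchanged by the
    cyclic shift, with opposite signs. *)
Lemma alt_cycle n (v : 'I_n -> Lam) : bar_out M n (alt v) = 0.
Proof.
case: n v => [|m] v //=; rewrite /alt linear_sum.
pose F (i : 'I_m.+2) : bar_chain M m :=
  \sum_(s : 'S_m.+1) (-1) ^+ s *: fsing (face i [ffun j => v (s j)]) w.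
transitivity (\sum_(i < m.+2) (-1) ^+ i *: F i).
  under [RHS]eq_bigr do rewrite scaler_sumr.
  rewrite [RHS]exchange_big; apply: eq_bigr => s _.
  rewrite linearZ_LR /= bar_bd_fsing scaler_sumr; apply: eq_bigr => i _.
  rewrite !scalerA mulrC; congr (_ *: fsing _ _).
  by rewrite /face_coef; case: ifP => // _; exact: M_Lam.
have Fin (i : 'I_m.+2) : (0 < i < m.+1)%N -> F i = 0.
  move=> /andP[i0 im]; have i1 : (i.-1 < m.+1)%N by lia.
  pose t := tperm (Ordinal i1) (Ordinal im).
  have : F i = - F i.
    rewrite {1}/F (reindex_inj (mulgI t)) -sumrN; apply: eq_bigr => s _ /=.
    rewrite odd_permM odd_tperm.
    have -> : Ordinal i1 != Ordinal im by rewrite -val_eqE /=; lia.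
    rewrite signr_addb expr1 mulN1r scaleNr; congr (- (_ *: fsing _ _)).
    apply/ffunP => j; rewrite !ffunE /= !permM.
    have tD (k : 'I_m.+1) : k != i.-1 :> nat -> k != i :> nat -> t k = k.
      by move=> k1 k2; rewrite tpermD // -val_eqE /= eq_sym.
    have [ji|ij|ji] := ltngtP j.+1 i.
    - by rewrite tD //=; lia.
    - by rewrite tD //= /bump; lia.
    have -> : widen_ord (leqnSn m) j = Ordinal i1 by apply: val_inj => /=; lia.
    have -> : lift ord0 j = Ordinal im by apply: val_inj => /=; rewrite /bump; lia.
    by rewrite tpermL tpermR addrC.
  move/eqP; rewrite -subr_eq0 opprK -mulr2n -scaler_nat scaler_eq0 (negbTE neq0_2) /=.
  by move/eqP.
rewrite big_ord_recl big_ord_recr big1 /=; last first.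
  by move=> i _; rewrite Fin ?scaler0 // /= /bump; have := ltn_ord i; lia.
rewrite add0r expr0 scale1r.
have [s [sodd sE]] := sign_perm_shift m.
have -> : F (lift ord0 ord_max) = (-1) ^+ m *: F ord0.
  rewrite {1}/F (reindex_inj (mulgI s)) scaler_sumr; apply: eq_bigr => t _.
  rewrite odd_permM signr_addb sodd signr_odd scalerA; congr (_ *: fsing _ _).
  apply/ffunP => j; rewrite !ffunE /= /bump /= add1n ltnS ltn_ord.
  by rewrite permM sE.
by rewrite scalerA /bump /= add1n -exprD addSn addnn -signr_odd /= odd_double /= expr1 scaleN1r subrr.
Qed.

Lemma cup_alt n (f : 'I_n -> Lam -> L) (v : 'I_n -> Lam) :
  cup f (alt v) = \det (\matrix_(i, j) f i (v j)).
Proof.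
rewrite /alt linear_sum; apply: eq_bigr => s _.
rewrite linearZ_LR cup_fsing ellw mulr1; congr (_ * _).
by apply: eq_bigr => i _; rewrite !mxE ffunE.
Qed.

Lemma bar_u_alt n (v : 'I_n -> Lam) : bar_u M n (alt v) = c *: alt (psi \o v).
Proof.
rewrite /alt linear_sum scaler_sumr; apply: eq_bigr => s _.
rewrite linearZ_LR /= push_fsing M_u linearZ_LR scalerA mulrC -scalerA.
by congr (_ *: (_ *: fsing _ _)); apply/ffunP => j; rewrite !ffunE.
Qed.

Variables (r : nat) (phi : {additive Lam -> 'rV[int]_r}).
Hypothesis phi_bij : bijective phi.
Hypothesis M_dim : forall n, has_dim (group_homology M n) 'C(r, n).

(** Row [k] holds the coordinates of the image of basis vector [k]. This vector is found by [xget],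
    the inverse of a bijective [phi] not being given as a function. *)
Definition aut_mx : 'M[int]_r :=
  \matrix_(k, l) phi (psi (xget 0 [set a | phi a = delta_mx 0 k])) 0 l.

Let b k := xget 0 [set a | phi a = delta_mx 0 k].
Let bE k : phi (b k) = delta_mx 0 k.
Proof.
have [g _ phiK] := phi_bij.
by rewrite /b; case: xgetP => // /(_ (g (delta_mx 0 k))); rewrite /= phiK.
Qed.

(** For the sets [S] of [n] indices, the alternating cycles on the basis vectors in [S] and the cup
    products of the coordinates in [S] are dual to each other. Their number is the dimension, so the
    trace is a sum of diagonal entries, which are principal minors. *)
Lemma trivial_trace n : is_trace (group_homology_u M n)
  (c * \sum_(S : {set 'I_r} | #|S| == n)
    \det (\matrix_(i, j) (if i \in S then map_mx intr aut_mx i j else (i == j)%:R : L))).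
Proof.
pose A := finset (fun S : {set 'I_r} => #|S| == n).
have cA : #|A| = 'C(r, n) by rewrite card_draws card_ord.
have cS (k : 'I_#|A|) : n = #|enum_val k|.
  by have := enum_valP k; rewrite inE => /eqP.
pose s (k : 'I_#|A|) (j : 'I_n) : 'I_r := enum_val (cast_ord (cS k) j).
have sinj k : injective (s k) by move=> i j /enum_val_inj/cast_ord_inj.
have sS k i : (i \in codom (s k)) = (i \in enum_val k).
  apply/codomP/idP => [[j ->]|iS]; first exact: enum_valP.
  exists (cast_ord (esym (cS k)) (enum_rank_in iS i)).
  by rewrite /s cast_ordKV enum_rankK_in.
pose f k j a : L := (phi a 0 (s k j))%:~R.
have fD k j x y : f k j (x + y) = f k j x + f k j y by rewrite /f raddfD !mxE intrD.
pose v k j := b (s k j).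
have lS k : {l : {linear group_homology M n -> L^o} |
    forall z h, class_of z h -> l h = cup (f k) z}.
  apply/cid.
  have [|h|y|l lP] := @linear_of_rel _ (group_homology M n) L^o
      (fun h y => exists z, class_of z h /\ cup (f k) z = y).
  - move=> a x y x' y' [z [zx <-]] [z' [zx' <-]]; exists (a *: z + z').
    by rewrite linearP; split=> //; exact: class_of_linear.
  - by have [z zh] := class_of_surj h; exists (cup (f k) z), z.
  - by move=> [z [/class_of0[_ [t <-]] <-]]; rewrite cup_bd.
  by exists l => z h zh; symmetry; apply/lP; exists z.
pose l k := projT1 (lS k).
have lP k z h : class_of z h -> l k h = cup (f k) z by exact: (projT2 (lS k)).
have /choice[e eP] : forall k, exists h : group_homology M n, class_of (alt (v k)) h.
  by move=> k; apply: class_of_ex; exact: alt_cycle.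
have := @is_trace_dual L (group_homology M n) #|A| (group_homology_u M n) l e.
rewrite {1}cA => /(_ (M_dim n)); have -> : c * \sum_(S : {set 'I_r} | #|S| == n)
    \det (\matrix_(i, j) (if i \in S then map_mx intr aut_mx i j else (i == j)%:R : L)) =
   \sum_k l k (group_homology_u M n (e k)).
  rewrite mulr_sumr (eq_bigl (fun S => S \in A)); last by move=> S; rewrite inE.
  rewrite big_enum_val; apply: eq_bigr => k _.
  have ue : class_of (bar_u M n (alt (v k))) (group_homology_u M n (e k)).
    exact: (homology_map_induces (bar_u_bd (n := n)) (bar_u_out (n := n)) (eP k)).
  rewrite (lP _ _ _ ue) bar_u_alt linearZ_LR cup_alt; congr (_ * _).
  have := @det_minor L n #|~: enum_val k| r (map_mx intr aut_mx) (s k) (fun i => enum_val i).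
  rewrite [X in (X + _)%N](cS k) cardsC card_ord => /(_ erefl (sinj k) (@enum_val_inj _ _)) H.
  transitivity (\det (\matrix_(i, j) (if i \in codom (s k) then map_mx intr aut_mx i j else (i == j)%:R : L))).
    by congr (\det _); apply/matrixP => i j; rewrite !mxE sS.
  rewrite H; first by rewrite -det_tr; congr (\det _); apply/matrixP => i j; rewrite !mxE.
  move=> i j; apply/eqP => eij; have := enum_valP j; rewrite inE -eij.
  by rewrite -sS codom_f.
apply=> k m; rewrite (lP _ _ _ (eP m)) cup_alt.
have fv i j : f k i (v m j) = (s k i == s m j)%:R.
  by rewrite /f /v bE mxE eqxx /=; case: eqP.
have [km|km] := eqVneq k m.
  subst m.
  rewrite -[RHS](det1 L n); congr (\det _); apply/matrixP => i j.
  by rewrite !mxE fv (inj_eq (sinj k)).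
(* Two distinct sets of the same size: an index of the one outside the other gives a zero row in the
   determinant. *)
have [i0 i0P] : exists i0, s k i0 \notin enum_val m.
  apply/existsP; apply: contra_neqT km; rewrite negb_exists => /forallP H.
  apply: enum_val_inj; apply/eqP; rewrite eqEcard -!cS leqnn andbT.
  by apply/fintype.subsetP => i; rewrite -sS => /codomP[j ->]; have := H j; rewrite negbK.
rewrite /determinant big1 // => t _; rewrite (bigD1 i0) //= mxE fv.
rewrite (_ : (s k i0 == s m (t i0)) = false) ?mul0r ?mulr0 //.
apply/negbTE; apply: contraNneq i0P => ->; by rewrite -sS codom_f.
Qed.

Lemma trivial_euler : exists t : nat -> L,
  (forall n, is_trace (group_homology_u M n) (t n)) /\
  \sum_(n < r.+1) (-1) ^+ n * t n = c * (\det (1%:M - aut_mx))%:~R.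
Proof.
exists (fun n => c * \sum_(S : {set 'I_r} | #|S| == n)
    \det (\matrix_(i, j) (if i \in S then map_mx intr aut_mx i j else (i == j)%:R : L))).
split; first exact: trivial_trace.
rewrite -det_map_mx map_mxB map_mx1 det_1sub.
under eq_bigr do rewrite mulrCA mulr_sumr.
rewrite -mulr_sumr; congr (_ * _).
rewrite [RHS](partition_big (fun S : {set 'I_r} => inord #|S| : 'I_r.+1) predT) //=.
apply: eq_bigr => i _; apply: congr_big => // S.
  rewrite -val_eqE /= inordK // ltnS; by have := max_card S; rewrite card_ord.
move=> /eqP <-; by [].
Qed.

End TrivialTrace.

(** * Conjugacy classes in the coset *)

Section AutMatrix.
Variables (Lam : zmodType) (psi : zmod_aut Lam) (r : nat) (phi : {additive Lam -> 'rV[int]_r}).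
Hypothesis phi_bij : bijective phi.
Local Notation Psi := (aut_mx psi phi).

Lemma aut_mxE a : phi (psi a) = phi a *m Psi.
Proof.
have [g gK phiK] := phi_bij.
pose b k := xget 0 [set a | phi a = delta_mx 0 k].
have bE k : phi (b k) = delta_mx 0 k.
  by rewrite /b; case: xgetP => // /(_ (g (delta_mx 0 k))); rewrite /= phiK.
have -> : a = \sum_k b k *~ phi a 0 k.
  apply: (can_inj gK); rewrite raddf_sum [LHS]row_sum_delta; apply: eq_bigr => k _.
  by rewrite raddfMz bE -scaler_int intz.
rewrite [in RHS]raddf_sum mulmx_suml !raddf_sum; apply: eq_bigr => k _.
rewrite !raddfMz bE -!scaler_int !intz -scalemxAl; congr (_ *: _).
by apply/rowP => l; rewrite -rowE !mxE.
Qed.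

Lemma aut_mx_iter m a : phi (iter m psi a) = phi a *m iter m (mulmx Psi) 1%:M.
Proof.
elim: m a => [|m IH] a; first by rewrite mulmx1.
by rewrite iterSr IH aut_mxE -mulmxA.
Qed.

Lemma det_elliptic_neq0 : elliptic psi -> \det (1%:M - Psi) != 0.
Proof.
move=> ell; have [g gK phiK] := phi_bij.
apply/negP => /det0P[v v0]; rewrite mulmxBr mulmx1 => /eqP; rewrite subr_eq0 => /eqP vE.
have gv0 : g v = 0 by apply/ell/(can_inj gK); rewrite aut_mxE phiK -vE.
by move/eqP: v0; apply; rewrite -[v]phiK gv0 raddf0.
Qed.

(** If the determinant were negative, the characteristic polynomial, negative at 1 and positive far
    out, would have a real root t >= 1. Finite order forces t = 1, where the value is not 0. *)
Lemma det_elliptic_gt0 n : aut_order psi n -> elliptic psi -> 0 < \det (1%:M - Psi).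
Proof.
move=> [n0 psin _] ell; rewrite lt_def det_elliptic_neq0 //= leNgt; apply/negP => det_lt0.
pose A : 'M[realalg]_r := map_mx intr Psi.
have An : iter n (mulmx A) 1%:M = 1%:M.
  have [g gK phiK] := phi_bij.
  have Pn : iter n (mulmx Psi) 1%:M = 1%:M.
    apply/row_matrixP => k; rewrite !rowE mulmx1 -[delta_mx 0 k]phiK -aut_mx_iter.
    by rewrite psin.
  have mapn m : map_mx intr (iter m (mulmx Psi) 1%:M) = iter m (mulmx A) 1%:M.
    by elim: m => [|m IH] /=; rewrite ?map_mx1 // map_mxM IH.
  by rewrite -mapn Pn map_mx1.
have p1 : (char_poly A).[1] = (\det (1%:M - Psi))%:~R.
  rewrite -[LHS]/(horner_eval 1 _) /char_poly -det_map_mx -det_map_mx.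
  congr (\det _); apply/matrixP => i j.
  by rewrite !mxE /= /horner_eval !hornerE rmorphB /= hornerMn hornerX rmorph_nat.
have [b bP] := poly_pinfty_gt_lc (p := char_poly A) ltac:(by rewrite (monicP (char_poly_monic A)) ltr01).
rewrite (monicP (char_poly_monic A)) in bP.
have [||t /andP[t1 _] rt] := @numfield.Num.Theory.poly_ivt _ (char_poly A) 1 (Num.max 1 b).
- by rewrite le_max lexx.
- rewrite p1 ltW ?ltrz0 //=; apply: le_trans ler01 (bP _ _).
  by rewrite le_max lexx orbT.
have := rt; rewrite -eigenvalue_root_char => /eigenvalueP[v vA v0].
have vAm m : v *m iter m (mulmx A) 1%:M = t ^+ m *: v.
  elim: m => [|m IH]; first by rewrite mulmx1 scale1r.
  by rewrite iterS mulmxA vA -scalemxAl IH scalerA exprS.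
have := vAm n; rewrite An mulmx1 => /eqP; rewrite -subr_eq0 -{1}[v]scale1r -scalerBl scaler_eq0 (negbTE v0) orbF.
rewrite subr_eq0 eq_sym pexpr_eq1 ?(le_trans ler01 t1) // => /eqP t1'.
move: rt; rewrite t1' rootE p1 intr_eq0 => /eqP d0.
by rewrite d0 ltxx in det_lt0.
Qed.

(** Conjugating [a u] by [b] gives [(a + b - psi b) u]: the classes are the cosets of the image of 1
    - psi. *)
Lemma Lam_conjE (a a' : Lam) : Lam_conj (dLam psi a * du psi)%g (dLam psi a' * du psi)%g <->
  exists b, phi a' - phi a = phi b *m (1%:M - Psi).
Proof.
have E b : (dLam psi b * (dLam psi a * du psi) * (dLam psi b)^-1)%g =
    (dLam psi (a + (b - psi b)) * du psi)%g.
  apply/(canLR (mulgK _)); congr pair; rewrite /= ?addr0 ?add0r //.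
  by rewrite -addrA subrK addrC.
split=> [[b]|[b bE]].
  rewrite E => /(congr1 (@lam_part _ _)); rewrite /lam_part /= !addr0 => ->.
  by exists b; rewrite raddfD addrAC subrr add0r raddfB aut_mxE mulmxBr mulmx1.
exists b; rewrite E; congr (dLam psi _ * _)%g; apply: (bij_inj phi_bij).
by rewrite raddfD raddfB aut_mxE -[X in X - _]mulmx1 -mulmxBr -bE addrC subrK.
Qed.

End AutMatrix.

Section Count.
Variables (Lam : zmodType) (psi : zmod_aut Lam) (r : nat) (phi : {additive Lam -> 'rV[int]_r}).
Hypothesis phi_bij : bijective phi.
Hypothesis ell : elliptic psi.
Local Notation Psi := (aut_mx psi phi).

Lemma unit_int_norm1 (m : int) : m \is a GRing.unit -> `|m|%N = 1%N.
Proof. by rewrite unfold_in => /orP[/eqP->|/eqP->]. Qed.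

Lemma coset_invariant : exists (d : 'I_r -> nat) (theta : Lam -> {dffun forall i : 'I_r, 'I_(d i)}),
  [/\ (\prod_i d i)%N = `|\det (1%:M - Psi)|%N,
      forall g, exists a, theta a = g
    & forall a a', theta a = theta a' <-> exists b, phi a' - phi a = phi b *m (1%:M - Psi)].
Proof.
have [P uP [Q uQ [d _ dE]]] := int_Smith_normal_form (1%:M - Psi).
have [g gK phiK] := phi_bij.
pose e (i : 'I_r) : int := d`_i.
set D := \matrix_(i, j) _ in dE.
have detD : \det D = \prod_i e i.
  have -> : D = diag_mx (\row_i e i) by apply/matrixP => i j; rewrite !mxE.
  by rewrite det_diag; apply: eq_bigr => i _; rewrite mxE.
have detE : `|\det (1%:M - Psi)|%N = `|(\prod_i e i)%R|%N.
  have uP' := uP; have uQ' := uQ; rewrite unitmxE in uP'; rewrite unitmxE in uQ'.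
  by rewrite dE !det_mulmx detD !abszM (unit_int_norm1 uP') (unit_int_norm1 uQ') mul1n muln1.
have d0 (i : 'I_r) : e i != 0.
  have : (`|\det (1%:M - Psi)|%N != 0)%N by rewrite absz_eq0 det_elliptic_neq0.
  rewrite detE absz_eq0.
  by apply: contra_neq => di; rewrite (bigD1 i) //= di mul0r.
have dgt (i : 'I_r) : (0 < `|e i|)%N by rewrite absz_gt0.
pose th a (i : 'I_r) : int := (phi a *m invmx Q) 0 i.
have lt a i : (`|(th a i %% e i)%Z| < `|e i|)%N.
  by have := ltz_mod (th a i) (d0 i); rewrite -{1}(gez0_abs (modz_ge0 (th a i) (d0 i))) ltz_nat.
exists (fun i => `|e i|%N), (fun a => [ffun i => Ordinal (lt a i)] : {dffun forall i : 'I_r, 'I_(`|e i|)}).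
split.
- by rewrite detE (big_morph absz abszM absz1).
- move=> f; exists (g ((\row_i (f i : nat)%:Z) *m Q)).
  apply/ffunP => i; apply: val_inj; rewrite ffunE /= /th phiK mulmxK // mxE.
  by rewrite -modz_abs modz_nat absz_nat modn_small.
move=> a a'; split=> [aa|[b bE]].
  have dv i : exists k, th a' i - th a i = k * e i.
    have := congr1 (fun h : {dffun forall i : 'I_r, 'I_(`|e i|)} => val (h i)) aa; rewrite !ffunE /= => ei.
    exists ((th a' i %/ e i)%Z - (th a i %/ e i)%Z).
    rewrite {1}(divz_eq (th a' i) (e i)) {1}(divz_eq (th a i) (e i)).
    have -> : (th a i %% e i)%Z = (th a' i %% e i)%Z.
      by rewrite -(gez0_abs (modz_ge0 (th a i) (d0 i))) ei gez0_abs // modz_ge0.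
    by rewrite opprD addrACA subrr addr0 -mulrBl.
  have /choice[k kE] := dv.
  exists (g ((\row_i k i) *m invmx P)); rewrite phiK dE !mulmxA mulmxKV //.
  have -> : (\row_i k i) *m D = (phi a' - phi a) *m invmx Q.
    apply/rowP => j; rewrite mulmxBl !mxE (bigD1 j) //= !mxE eqxx -kE big1 ?addr0 => [|i ij].
      by rewrite /th !mxE.
    by rewrite !mxE (_ : (i == j :> nat) = false) ?mulr0n ?mulr0 //; exact: negbTE ij.
  by rewrite mulmxKV.
apply/ffunP => i; apply: val_inj; rewrite !ffunE /=; congr absz.
apply/eqP; rewrite eq_sym eqz_mod_dvd.
have -> : th a' i - th a i = (phi b *m P *m D) 0 i.
  have -> : phi b *m P *m D = (phi a' - phi a) *m invmx Q.
    by rewrite bE dE !mulmxA mulmxK.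
  by rewrite mulmxBl [RHS]mxE [X in _ = _ + X]mxE.
rewrite mxE (bigD1 i) //= [D i i]mxE eqxx mulr1n [X in _ + X]big1 ?addr0 ?dvdz_mull // => j ji.
by rewrite [D j i]mxE (_ : (j == i :> nat) = false) ?mulr0n ?mulr0 //; exact: negbTE ji.
Qed.

Lemma transversal_seq (S : set (Delta psi)) : conj_transversal S ->
  exists s : seq (Delta psi), [/\ uniq s, S = [set` s] & size s = `|\det (1%:M - Psi)|%N].
Proof.
move=> [Ssub Suniq]; have [d [theta [dprod thsurj thP]]] := coset_invariant.
have conjP a a' : Lam_conj (dLam psi a * du psi)%g (dLam psi a' * du psi)%g <-> theta a = theta a'.
  by rewrite (Lam_conjE psi phi_bij) thP.
have cos a : Lam_coset (psi := psi) (dLam psi a * du psi)%g by exists a.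
have /choice[rep repP] : forall g, exists w, S w /\ theta (lam_part w) = g.
  move=> g; have [a <-] := thsurj g; have [w [[Sw aw] _]] := Suniq _ (cos a).
  exists w; split=> //; symmetry; apply/conjP.
  by rewrite -(Lam_cosetE (Ssub _ Sw)).
have Sinj w w' : S w -> S w' -> theta (lam_part w) = theta (lam_part w') -> w = w'.
  move=> Sw Sw' e; have [w0 [_ w0P]] := Suniq _ (Ssub _ Sw).
  have <- : w0 = w.
    by apply: w0P; split=> //; rewrite (Lam_cosetE (Ssub _ Sw)); apply/conjP.
  apply: w0P; split=> //; rewrite (Lam_cosetE (Ssub _ Sw)) (Lam_cosetE (Ssub _ Sw')); exact/conjP.
exists [seq rep g | g <- enum {dffun forall i : 'I_r, 'I_(d i)}]; split.
- rewrite map_inj_uniq ?enum_uniq // => g g' e.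
  by rewrite -(repP g).2 -(repP g').2 e.
- apply/seteqP; split=> [w Sw|w /mapP[g _ ->]]; last exact: (repP g).1.
  apply/mapP; exists (theta (lam_part w)); first by rewrite mem_enum.
  by apply: Sinj => //; [exact: (repP _).1 | rewrite (repP _).2].
rewrite size_map -cardE card_dep_ffun -dprod foldrE big_map enumT.
by apply: eq_bigr => i _; rewrite card_ord.
Qed.

End Count.

(** * Finitely generated locally finite modules *)

Section Action.
Variables (L : fieldType) (Lam : zmodType) (psi : zmod_aut Lam).
Implicit Types M N : gmod L (Delta psi).

Lemma gactE M (g : Delta psi) x :
  gact M g x = act_Lam M g.1 (ziter (act_u M) (act_ui M) g.2 x).
Proof.
case: g => a i /=.
have -> : (a, i) = (dLam psi a * ((0, i) : Delta psi))%g :> Delta psi.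
  by congr pair; rewrite /= ?addr0 ?add0r.
rewrite gactM; congr (act_Lam M a _).
have uE (k : int) y : gact M ((0, 1 + k) : Delta psi) y = act_u M (gact M ((0, k) : Delta psi) y).
  by rewrite -gactM; congr (gact M _ y); congr pair; rewrite /= raddf0 addr0.
have uiE (k : int) y :
    gact M ((0, - 1 + k) : Delta psi) y = act_ui M (gact M ((0, k) : Delta psi) y).
  apply: (can_inj (act_uK (M := M))); rewrite act_uiK -uE addrA subrr add0r //.
have NE k : Negz k.+1 = - 1 + Negz k by rewrite !NegzE; lia.
case: i => k; rewrite /ziter.
  elim: k => [|k IH]; first exact: gact1.
  by rewrite intS uE IH.
elim: k => [|k IH]; last by rewrite NE uiE IH.
rewrite (_ : Negz 0 = - 1 + 0) // uiE; congr (act_ui M _); exact: gact1.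
Qed.

Lemma submoduleP M (W : set M) :
    W 0 -> (forall c x y, W x -> W y -> W (c *: x + y)) ->
    (forall a x, W x -> W (act_Lam M a x)) -> (forall x, W x -> W (act_u M x)) ->
    (forall x, W x -> W (act_ui M x)) ->
  submodule W.
Proof.
move=> W0 Wl WL Wu Wui; split=> // g x Wx; rewrite gactE; apply: WL.
by case: g.2 => k /=; [elim: k => //= k /Wu | elim: k => [|k /Wui] //=; exact: Wui].
Qed.

Lemma equivariantP M N (f : M -> N) :
    (forall a x, f (act_Lam M a x) = act_Lam N a (f x)) ->
    (forall x, f (act_u M x) = act_u N (f x)) ->
  equivariant f.
Proof.
move=> fL fu g x; have fui y : f (act_ui M y) = act_ui N (f y).
  by apply: (can_inj (act_uK (M := N))); rewrite -fu !act_uiK.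
rewrite (gactE g x) (gactE g (f x)) fL; congr (act_Lam N _ _).
case: g.2 => k /=; first by elim: k => //= k <-.
by elim: k => /= [|k <-]; rewrite fui.
Qed.

Lemma equivariant_Lam M N (f : {linear M -> N}) : equivariant f -> Lam_equivariant f.
Proof. by move=> fe a x; exact: fe. Qed.

Lemma quotient_ex M (U : lmodType L) (f : {linear U -> M}) :
    (forall g x, exists y, f y = gact M g (f x)) ->
  exists (Q : gmod L (Delta psi)) (q : {linear M -> Q}), [/\ equivariant q,
    forall z, exists y, q y = z & forall y, q y = 0 <-> exists x, f x = y].
Proof.
(* With the zero map as outgoing map, every vector is a cycle and the homology is the cokernel of
   [f]. *)
move=> fg; pose Q := homology f (\0 : {linear M -> M}).
have [|x|y|q qP] := @linear_of_rel _ M Q (fun x h => class_of x h).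
- by move=> *; exact: class_of_linear.
- exact: class_of_ex.
- by move=> /class_of_uniq; apply; exact: class_of00.
have qx x : class_of x (q x) by apply/qP.
have q0 y : q y = 0 <-> exists x, f x = y.
  split; first by move=> qy; have := qx y; rewrite qy => /class_of0[_].
  by move=> ex; apply: (class_of_uniq (qx y)); apply/class_of0.
have qS z : exists y, q y = z.
  by have [y yz] := class_of_surj z; exists y; symmetry; apply/qP.
have gS g : {h : {linear Q -> Q} | forall x, h (q x) = q (gact M g x)}.
  apply/cid; apply: (@linear_factor _ _ _ _ q (q \o gact M g)) => // x /q0[y <-] /=.
  exact/q0.
pose act g := projT1 (gS g).
have actE g x : act g (q x) = q (gact M g x) by exact: (projT2 (gS g)).
have act1 x : act 1%g x = x by have [y <-] := qS x; rewrite actE gact1.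
have actM g h x : act (g * h)%g x = act g (act h x).
  by have [y <-] := qS x; rewrite !actE gactM.
by exists (GMod act1 actM), q; split=> // g x; symmetry; exact: actE.
Qed.

End Action.

Section FG.
Variables (L : fieldType) (Lam : zmodType) (psi : zmod_aut Lam).
Implicit Types M N : gmod L (Delta psi).

Lemma fgulf_surj M N (p : {linear M -> N}) :
  equivariant p -> (forall z, exists y, p y = z) -> fgulf M -> fgulf N.
Proof.
move=> pe psurj [[s sP] lf]; split.
  exists (map p s) => W [W0 Wl Wg] Ws.
  have pW : [set x | W (p x)] = [set: M].
    apply: sP => [|x xs]; last by apply: Ws; exact: map_f.
    split=> [|c x y /= Wx Wy|g x /= Wx]; rewrite /= ?linear0 // ?linearP ?pe //; [exact: Wl | exact: Wg].
  apply/seteqP; split=> // z _; have [y <-] := psurj z.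
  by have : [set x | W (p x)] y by rewrite pW.
move=> z; have [x <-] := psurj z; have [W [[d [phi ->]] Wu [w _ wx]]] := lf x.
exists (range (p \o phi)); split; first by exists d, (p \o phi).
  move=> _ [y _ <-]; have [|y' _ y'E] := Wu (phi y); first by exists y.
  by exists y'; rewrite //= y'E pe.
by exists w; rewrite //= wx.
Qed.

Section Twisted.
Variables (M N : gmod L (Delta psi)) (g : {linear M -> N}) (z : L).
Hypotheses (z0 : z != 0) (gL : Lam_equivariant g)
  (gu : forall x, g (z *: act_u M x) = act_u N (g x)).

Lemma twisted_ui x : g (act_ui M x) = z *: act_ui N (g x).
Proof.
by apply: (can_inj (act_uK (M := N))); rewrite -gu act_uiK !linearZ_LR /= act_uiK.
Qed.

Lemma fgulf_twisted : (forall y, exists x, g x = y) -> fgulf M -> fgulf N.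
Proof.
move=> gsurj [[s sP] lf]; split.
  exists (map g s) => W [W0 Wl Wg] Ws.
  have WZ c x : W x -> W (c *: x) by move=> Wx; rewrite -[_ *: _]addr0; exact: Wl.
  have pW : [set x | W (g x)] = [set: M].
    apply: sP => [|x xs]; last by apply: Ws; exact: map_f.
    apply: submoduleP => /=.
    - by rewrite linear0.
    - by move=> c x y Wx Wy; rewrite linearP; exact: Wl.
    - by move=> a x Wx; rewrite gL; exact: Wg.
    - move=> x Wx; have -> : g (act_u M x) = z^-1 *: act_u N (g x).
        by rewrite -gu linearZ_LR /= scalerA mulVf // scale1r.
      by apply: WZ; exact: Wg.
    - by move=> x Wx; rewrite twisted_ui; apply: WZ; exact: Wg.
  apply/seteqP; split=> // y _; have [x <-] := gsurj y.
  by have : [set x | W (g x)] x by rewrite pW.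
move=> y; have [x <-] := gsurj y; have [W [[d [phi ->]] Wu [w _ wx]]] := lf x.
exists (range (g \o phi)); split; first by exists d, (g \o phi).
  move=> _ [y' _ <-]; have [|y2 _ y2E] := Wu (phi y'); first by exists y'.
  exists (z *: y2); rewrite //= -gu; congr (g _); by rewrite linearZ_LR /= y2E.
by exists w; rewrite //= wx.
Qed.

End Twisted.

Section TensorOne.
Variables (M : gmod L (Delta psi)) (z : L).
Hypothesis z0 : z != 0.

Lemma scalar_unit : (z%:M : 'M[L]_1) \in unitmx.
Proof. by rewrite unitmxE det_scalar1 unitfE. Qed.

Definition char_twist := tensor M scalar_unit.

Lemma char_twist_Lam a (x : {ffun 'I_1 -> M}) :
  (act_Lam char_twist a x : {ffun 'I_1 -> M}) 0 = act_Lam M a (x 0).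
Proof. by rewrite mk_gmod_Lam ffunE big_ord1 mxE eqxx scale1r. Qed.

Lemma char_twist_u (x : {ffun 'I_1 -> M}) :
  (act_u char_twist x : {ffun 'I_1 -> M}) 0 = z *: act_u M (x 0).
Proof. by rewrite mk_gmod_u ffunE big_ord1 mxE eqxx mulr1n. Qed.

Definition to_twist (x : M) : char_twist := [ffun=> x].

Lemma to_twist_linear : linear to_twist.
Proof. by move=> c x y; apply/ffunP => i; rewrite !ffunE. Qed.

HB.instance Definition _ := GRing.isLinear.Build L M char_twist *:%R to_twist to_twist_linear.

Lemma fgulf_char_twist : fgulf M -> fgulf char_twist.
Proof.
have eq0 (x y : {ffun 'I_1 -> M}) : x 0 = y 0 -> x = y.
  by move=> e; apply/ffunP => i; rewrite (ord1 i).
apply: (@fgulf_twisted _ _ to_twist z z0).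
- by move=> a x; apply: eq0; rewrite char_twist_Lam !ffunE.
- by move=> x; apply: eq0; rewrite char_twist_u !ffunE.
- by move=> y; exists ((y : {ffun 'I_1 -> M}) 0); apply: eq0; rewrite ffunE.
Qed.

End TensorOne.

(* An exact sequence [0 -> V (x) M' -> M -> M'' -> 0], where [u] acts by [z] on
   the line [V]. *)
Definition twisted_seq (z : L) (M' M M'' : gmod L (Delta psi))
    (f : {linear M' -> M}) (p : {linear M -> M''}) :=
  [/\ Lam_equivariant f, forall x, f (z *: act_u M' x) = act_u M (f x),
    equivariant p & exact_seq f p].

(** The sequence is exact and equivariant once its first term is read as [char_twist M'], and the
    tensor axiom for the 1 by 1 matrix [z] evaluates that term. *)
Lemma gen_trace_twisted (T : gmod L (Delta psi) -> L) z (M' M M'' : gmod L (Delta psi))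
    (f : {linear M' -> M}) (p : {linear M -> M''}) :
    is_gen_trace T -> z != 0 -> twisted_seq z f p -> fgulf M' -> fgulf M -> fgulf M'' ->
  T M = z * T M' + T M''.
Proof.
move=> [Tadd Ttens _] z0 [fL fu pe [finj psurj ex]] gM' gM gM''.
have eq0 (x y : {ffun 'I_1 -> M'}) : x 0 = y 0 -> x = y.
  by move=> e; apply/ffunP => i; rewrite (ord1 i).
pose e0 (x : {ffun 'I_1 -> M'}) : M' := x 0.
have e0l : linear e0 by move=> c x y; rewrite /e0 !ffunE.
pose e : {linear char_twist M' z0 -> M'} :=
  HB.pack e0 (GRing.isLinear.Build L {ffun 'I_1 -> M'} M' *:%R e0 e0l).
have trz : \tr (z%:M : 'M[L]_1) = z by rewrite mxtrace_scalar mulr1n.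
rewrite -{1}trz -(Ttens _ _ (scalar_unit z0) _ gM').
apply: (Tadd _ _ _ (f \o e : {linear char_twist M' z0 -> M}) p) => //.
  exact: fgulf_char_twist.
split=> //.
- apply: equivariantP => [a x|x].
    change (f ((act_Lam (char_twist M' z0) a x : {ffun 'I_1 -> M'}) 0) = act_Lam M a (f (e0 x))).
    by rewrite char_twist_Lam fL.
  change (f ((act_u (char_twist M' z0) x : {ffun 'I_1 -> M'}) 0) = act_u M (f (e0 x))).
  by rewrite char_twist_u fu.
- by move=> x y /finj; exact: eq0.
- move=> y; split=> [/ex[x <-]|[x <-]]; last by apply/ex; exists (e x).
  by exists (to_twist z0 x); rewrite /= /e0 ffunE.
Qed.

End FG.

Section Twist.
Variables (L : fieldType) (Lam : zmodType) (psi : zmod_aut Lam).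
Implicit Types M N : gmod L (Delta psi).

Lemma twist_actu mu M x : act_u (twist mu M) x = act_Lam M mu (act_u M x).
Proof. exact: mk_gmod_u. Qed.

Lemma twist_actui mu M x : act_ui (twist mu M) x = act_ui M (act_Lam M (- mu) x).
Proof. exact: mk_gmod_ui. Qed.

Lemma twisted_seq_twist mu z M' M M'' (f : {linear M' -> M}) (p : {linear M -> M''}) :
  twisted_seq z f p ->
  twisted_seq z (f : {linear twist mu M' -> twist mu M}) (p : {linear twist mu M -> twist mu M''}).
Proof.
move=> [fL fu pe ex]; split=> //.
  move=> x; change (f (z *: act_u (twist mu M') x) = act_u (twist mu M) (f x)).
  by rewrite !twist_actu -fu !linearZ_LR -fL.
apply: equivariantP => [a x|x]; first exact: pe.
change (p (act_u (twist mu M) x) = act_u (twist mu M'') (p x)).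
by rewrite !twist_actu !pe.
Qed.

Lemma iter_act_Lam_u mu M m x :
  iter m (fun y => act_Lam M mu (act_u M y)) x
  = act_Lam M (\sum_(k < m) iter k psi mu) (iter m (act_u M) x).
Proof.
elim: m => [|m IH]; first by rewrite big_ord0 act_Lam0.
rewrite iterS IH act_uLam -act_LamD big_ord_recl raddf_sum.
by congr (act_Lam M (_ + _) _); apply: eq_bigr.
Qed.

(** The norm of [mu] is fixed by [psi]. As a consequence [(mu u)^n = u^n]. *)
Lemma norm_elliptic n mu : aut_order psi n -> elliptic psi -> \sum_(k < n) iter k psi mu = 0.
Proof.
move=> [n0 psin _]; apply; apply: (addrI mu).
have -> : mu + psi (\sum_(k < n) iter k psi mu) = \sum_(k < n.+1) iter k psi mu.
  by rewrite big_ord_recl raddf_sum; congr (_ + _); apply: eq_bigr.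
by rewrite big_ord_recr /= psin addrC.
Qed.

Definition iter_sum M (v : M -> M) (W : set M) n : set M :=
  [set x | exists w : nat -> M, (forall j, W (w j)) /\ x = \sum_(j < n) iter j v (w j)].

Lemma iter_sum_fd M (v : {linear M -> M}) (W : set M) n :
  fd_subspace W -> fd_subspace (iter_sum v W n).
Proof.
move=> [d [phi WE]]; have W0 : W 0 by rewrite WE; exists 0; rewrite ?linear0.
elim: n => [|n [e [chi eE]]].
  exists 0, \0; apply/seteqP; split=> [x [w [_ ->]]|_ [y _ <-]].
    by exists 0; rewrite ?big_ord0.
  by exists (fun=> 0); rewrite big_ord0.
exists (d + e)%N, ((phi \o lsubmx) \+ (v \o (chi \o rsubmx))); apply/seteqP; split.
  move=> _ [w [Ww ->]]; have [y _ yE] : range phi (w 0%N) by rewrite -WE.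
  have [y' _ y'E] : range chi (\sum_(j < n) iter j v (w j.+1)).
    by rewrite -eE; exists (fun j => w j.+1).
  exists (row_mx y y') => //=; rewrite row_mxKl row_mxKr yE y'E big_ord_recl linear_sum.
  by congr (_ + _); apply: eq_bigr.
move=> _ [y _ <-] /=.
have [w [Ww wE]] : iter_sum v W n (chi (rsubmx y)) by rewrite eE; exists (rsubmx y).
exists (fun j => if j is j'.+1 then w j' else phi (lsubmx y)); split.
  by case=> [|j] //; rewrite WE; exists (lsubmx y).
by rewrite big_ord_recl wE linear_sum; congr (_ + _); apply: eq_bigr.
Qed.

(** A [u]-stable [W] is stable under the n-th power of [v = mu u], which equals [u^n]; hence W + v W
    + ... + v^(n-1) W is [v]-stable. *)
Lemma fgulf_twist n mu M : aut_order psi n -> elliptic psi -> fgulf M -> fgulf (twist mu M).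
Proof.
move=> ord ell [[s sP] lf]; have [n0 _ _] := ord; split.
  exists s => W [W0 Wl Wg] Ws; apply: sP => //; apply: submoduleP => //.
  - by move=> a x; exact: (Wg (dLam psi a)).
  - move=> x Wx; have -> : act_u M x = act_Lam M (- mu) (act_u (twist mu M) x).
      by rewrite twist_actu -act_LamD addNr act_Lam0.
    by apply: (Wg (dLam psi (- mu))); exact: Wg.
  - move=> x Wx; have -> : act_ui M x = act_ui (twist mu M) (act_Lam M mu x).
      by rewrite twist_actui -act_LamD addNr act_Lam0.
    by apply: (Wg (du psi)^-1%g); exact: (Wg (dLam psi mu)).
move=> x; have [W [Wfd Wu Wx]] := lf x.
pose v := act_Lam M mu \o act_u M : {linear M -> M}.
have vn y : W y -> W (iter n v y).
  move=> Wy; rewrite (iter_act_Lam_u mu n y) norm_elliptic // act_Lam0.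
  by elim: {n0 ord} n => //= m; exact: Wu.
have W0 : W 0 by case: Wfd => d [phi ->]; exists 0; rewrite ?linear0.
exists (iter_sum v W n); split; first exact: iter_sum_fd.
  move=> _ [w [Ww ->]]; set y := \sum_(_ < _) _.
  have -> : gact (twist mu M) (du psi) y = v y by exact: twist_actu.
  rewrite /y {y}.
  case: n {ord} n0 vn => // m _ vn.
  (* Applying [v] moves each summand up by one; the last one reaches the n-th power of [v], falls
     back into [W] and becomes the new first summand. *)
  exists (fun j => if j is j'.+1 then w j' else iter m.+1 v (w m)); split.
    by case=> [|j] //; exact: vn.
  rewrite linear_sum big_ord_recr [RHS]big_ord_recl [RHS]addrC /=; congr (_ + _).
case: n {ord vn} n0 => // m _.
exists (fun j => if j is 0 then x else 0); split; first by case.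
rewrite big_ord_recl big1 ?addr0 // => j _ /=.
have v0 k : iter k v 0 = 0 by elim: k => // k IH; rewrite iterS IH linear0.
exact: (v0 j.+1).
Qed.

Section GenTrace.
Variables (T : gmod L (Delta psi) -> L) (TP : is_gen_trace T).

Lemma gen_trace_zero M : (forall x : M, x = 0) -> T M = 0.
Proof.
move=> M0; rewrite (gen_trace_findim TP); last exact: is_trace_findim (is_trace0 id M0).
by apply: traceE; exact: is_trace0.
Qed.

Lemma gen_trace_iso z M N (f : {linear M -> N}) : z != 0 -> Lam_equivariant f ->
    (forall x, f (z *: act_u M x) = act_u N (f x)) -> bijective f -> fgulf M ->
  T N = z * T M.
Proof.
move=> z0 fL fu bf gM; have [f' fK f'K] := bf.
have gN : fgulf N by apply: (fgulf_twisted z0 fL fu _ gM) => y; exists (f' y).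
(* The quotient of [N] by itself provides the zero module that ends the exact sequence. *)
have [Q [q [qe qS q0]]] := @quotient_ex _ _ _ N N idfun (fun g x => ex_intro _ (gact N g x) erefl).
have Q0 (x : Q) : x = 0 by have [y <-] := qS x; apply/q0; exists y.
rewrite (gen_trace_twisted (f := f) (p := q) TP z0 _ gM gN (fgulf_surj qe qS gN)).
  by rewrite (gen_trace_zero Q0) addr0.
split=> //; split=> [||y] //; first exact: bij_inj.
by split=> [_|_]; [exists (f' y) | exact: Q0].
Qed.

Lemma gen_trace_conj n a M : aut_order psi n -> elliptic psi -> fgulf M ->
  gen_trace_at T (dLam psi a * du psi * (dLam psi a)^-1)%g M = T M.
Proof.
move=> ord ell gM; rewrite /gen_trace_at.
have -> : lam_part (dLam psi a * du psi * (dLam psi a)^-1)%g = a - psi a.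
  have : (dLam psi a * du psi * (dLam psi a)^-1)%g = (dLam psi (a - psi a) * du psi)%g.
    by apply/(canLR (mulgK _)); congr pair; rewrite /= ?addr0 ?add0r // subrK.
  by move=> ->; rewrite /lam_part /= addr0.
rewrite -[RHS]mul1r; apply: (@gen_trace_iso 1 M (twist (a - psi a) M) (act_Lam M a)) => //.
- exact: oner_neq0.
- exact: act_Lam_equivariant.
- move=> x; rewrite scale1r twist_actu act_uLam -!act_LamD subrK //.
- by exists (act_Lam M (- a)) => x; rewrite -act_LamD ?addNr ?subrr act_Lam0.
Qed.

End GenTrace.
End Twist.

(** * Noetherian induction *)

Section PolyAction.
Variables (L : fieldType) (M : lmodType L) (f : {linear M -> M}).

(** The polynomial [q] evaluated at [f] and applied to [x], for a space of possibly infinite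
    dimension. *)
Definition pact (q : {poly L}) (x : M) : M := \sum_(k < size q) q`_k *: iter k f x.

Lemma pactE n (q : {poly L}) x : (size q <= n)%N -> pact q x = \sum_(k < n) q`_k *: iter k f x.
Proof.
move=> qn; rewrite /pact (big_ord_widen n (fun k => q`_k *: iter k f x) qn) big_mkcond.
by apply: eq_bigr => k _; case: ltnP => // qk; rewrite nth_default // scale0r.
Qed.

Lemma pactB p q x : pact (p - q) x = pact p x - pact q x.
Proof.
set n := maxn (size p) (size q).
have nB : (size (p - q)%R <= n)%N by rewrite (leq_trans (size_polyD _ _)) // size_polyN.
rewrite (pactE x nB) (pactE (n := n) (q := p)) ?leq_maxl // (pactE (n := n) (q := q)) ?leq_maxr //.
by rewrite -sumrB; apply: eq_bigr => k _; rewrite coefB scalerBl.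
Qed.

Lemma pactZ c q x : pact (c *: q) x = c *: pact q x.
Proof.
rewrite (pactE x (size_scale_leq c q)) scaler_sumr.
by apply: eq_bigr => k _; rewrite coefZ scalerA.
Qed.

Lemma pactX q x : pact ('X * q) x = f (pact q x).
Proof.
have nX : (size ('X * q)%R <= (size q).+1)%N.
  by rewrite mulrC (leq_trans (size_polyMleq _ _)) // size_polyX addn2.
rewrite (pactE x nX) big_ord_recl coefXM /= scale0r add0r linear_sum.
by apply: eq_bigr => k _; rewrite coefXM /= linearZ_LR.
Qed.

(** Apply the linear factors one at a time: the last nonzero vector is an eigenvector. *)
Lemma pact_root (rs : seq L) x : x != 0 -> pact (\prod_(z <- rs) ('X - z%:P)) x = 0 ->
  exists c y, y != 0 /\ f y = c *: y.
Proof.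
move=> x0; elim: rs => [|z rs IH].
  by rewrite big_nil /pact size_poly1 big_ord1 coef1 scale1r => e; case/eqP: x0; exact: e.
rewrite big_cons mulrBl pactB pactX mul_polyC pactZ.
have [/IH//|y0] := eqVneq (pact (\prod_(j <- rs) ('X - j%:P)) x) 0.
by move=> /eqP; rewrite subr_eq0 => /eqP fy; exists z, (pact (\prod_(j <- rs) ('X - j%:P)) x).
Qed.

Lemma fd_annihilator (W : set M) x : fd_subspace W -> (forall y, W y -> W (f y)) -> W x ->
  exists q, q != 0 /\ pact q x = 0.
Proof.
move=> [d [phi WE]] Wf Wx.
have /choice[w wP] : forall k : 'I_d.+1, exists v, phi v = iter k f x.
  move=> k; have : W (iter k f x) by elim: (k : nat) => //= m; exact: Wf.
  by rewrite WE => -[v _ vE]; exists v.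
pose X := \matrix_k w k.
have : kermx X != 0.
  by rewrite -mxrank_eq0 mxrank_ker subn_eq0 -ltnNge ltnS rank_leq_col.
case/rowV0Pn => v /sub_kermxP vX v0; exists (rVpoly v); split.
  by apply: contra_neq v0 => e; rewrite -[v]rVpolyK e linear0.
rewrite (pactE x (size_poly _ _)).
transitivity (phi (v *m X)); last by rewrite vX linear0.
rewrite mulmx_sum_row linear_sum; apply: eq_bigr => k _.
by rewrite linearZ_LR rowK wP coef_rVpoly_ord.
Qed.

(** A polynomial with nonzero constant term that annihilates [x] writes [x] as [f] of an element of
    [W]. A zero constant term can be divided out, since [f] is injective. *)
Lemma fd_inverse_stable (g : M -> M) (W : set M) x : cancel f g ->
  fd_subspace W -> (forall y, W y -> W (f y)) -> W x -> W (g x).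
Proof.
move=> fK Wfd Wf Wx; have [d [phi WE]] := Wfd.
have W0 : W 0 by rewrite WE; exists 0; rewrite ?linear0.
have Wl c y z : W y -> W z -> W (c *: y + z).
  by rewrite WE => -[y' _ <-] [z' _ <-]; exists (c *: y' + z'); rewrite ?linearP.
have finj : injective f := can_inj fK.
have [q [q0 qx]] := fd_annihilator Wfd Wf Wx.
have [m] := ubnP (size q); elim: m q q0 qx => // m IH q q0 qx; rewrite ltnS => qm.
have [e|c0] := eqVneq q`_0 0.
  have qE : q = 'X * \poly_(k < (size q).-1) q`_k.+1.
    apply/polyP => -[|k]; rewrite coefXM //= coef_poly; case: ltnP => // kq.
    by rewrite nth_default //; lia.
  set q' := \poly_(k < _) _ in qE.
  have q'0 : q' != 0 by apply: contra_neq q0 => e'; rewrite qE e' mulr0.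
  apply: (IH q' q'0); first by apply: finj; rewrite -pactX -qE qx linear0.
  have := qm; rewrite qE mulrC size_mulX //.
have sq : size q = (size q).-1.+1 by rewrite prednK // lt0n size_poly_eq0.
have xE : x = f (- (q`_0)^-1 *: \sum_(k < (size q).-1) q`_k.+1 *: iter k f x).
  move: qx; rewrite (@pactE (size q).-1.+1 q x) ?leqSpred // big_ord_recl => /eqP.
  rewrite addrC addr_eq0 => /eqP e; rewrite linearZ_LR linear_sum /=.
  rewrite (eq_bigr (fun k : 'I_(size q).-1 => q`_(lift ord0 k) *: iter (lift ord0 k) f x)).
    by rewrite e scalerN scaleNr opprK scalerA mulVf // scale1r.
  by move=> k _; rewrite linearZ_LR.
rewrite {1}xE fK -[_ *: _]addr0; apply: (Wl) => //.
elim/big_rec: _ => [|k y _ Wy] //; apply: Wl => //.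
by elim: (k : nat) => //= l; exact: Wf.
Qed.

End PolyAction.

Lemma closed_eigen (L : closedFieldType) (M : lmodType L) (f : {linear M -> M}) q x :
  x != 0 -> q != 0 -> pact f q x = 0 -> exists c y, y != 0 /\ f y = c *: y.
Proof.
move=> x0 q0; have [rs qE] := closed_field_poly_normal q; rewrite qE pactZ => /eqP.
by rewrite scaler_eq0 lead_coef_eq0 (negbTE q0) => /eqP; exact: pact_root.
Qed.

Section Noetherian.
Variables (L : fieldType) (Lam : zmodType) (psi : zmod_aut Lam) (M : gmod L (Delta psi)).

Definition subspace (W : set M) := W 0 /\ forall c x y, W x -> W y -> W (c *: x + y).
Definition stable (s : seq Lam) (W : set M) := forall a, a \in s -> forall x, W x -> W (act_Lam M a x).
(** Relative to a list of operators, so that the basis theorem can be proved by adding one operator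
    at a time. *)
Definition noeth (s : seq Lam) (V : set M) := forall N : nat -> set M,
  (forall i, [/\ subspace (N i), stable s (N i) & N i `<=` V]) ->
  (forall i, N i `<=` N i.+1) -> exists m, forall i, N i `<=` N m.

Lemma chain_le (N : nat -> set M) : (forall i, N i `<=` N i.+1) ->
  forall i j, (i <= j)%N -> N i `<=` N j.
Proof.
move=> NS i j /subnK <-; elim: (j - i)%N => // k IH.
exact: subset_trans IH (NS _).
Qed.

Lemma subspaceD W x y : subspace W -> W x -> W y -> W (x + y).
Proof. by move=> [_ Wl] Wx Wy; rewrite -[x]scale1r; exact: Wl. Qed.

Lemma subspaceZ W c x : subspace W -> W x -> W (c *: x).
Proof. by move=> [W0 Wl] Wx; rewrite -[_ *: _]addr0; exact: Wl. Qed.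

Lemma subspaceB W x y : subspace W -> W x -> W y -> W (x - y).
Proof. by move=> sW Wx Wy; apply: subspaceD => //; rewrite -scaleN1r; exact: subspaceZ. Qed.

(** Either some [N i] contains a vector [u0 + w], and from then on the terms are determined by their
    intersections with [U], or all of them lie in [U]. *)
Lemma noeth_line U w : subspace U -> noeth [::] U ->
  noeth [::] [set x | exists u c, U u /\ x = u + c *: w].
Proof.
move=> sU nU N NP NS; have Nle := chain_le NS.
have [|i|m1 m1P] := nU (fun i => N i `&` U).
- move=> i; have [sN _ _] := NP i; split=> [|a|x []] //.
  split; first by split; [case: sN | case: sU].
  by move=> c x y [Nx Ux] [Ny Uy]; split; [apply: sN.2 | apply: sU.2].
- by move=> x [Nx Ux]; split=> //; exact: NS.
have [[i0 [u0 [Uu0 Nu0]]]|noP] := pselect (exists i, exists u, U u /\ N i (u + w)).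
  exists (maxn m1 i0) => i x Nx; have [_ _ /(_ x Nx)[u [c [Uu xE]]]] := NP i.
  pose j := maxn i (maxn m1 i0).
  have Nj : N j (u0 + w) by apply: Nle Nu0; rewrite /j !leq_max leqnn !orbT.
  have Njx : N j x by apply: Nle Nx; rewrite leq_maxl.
  have [sNj _ _] := NP j; have [sNm _ _] := NP (maxn m1 i0).
  have xc : x - c *: (u0 + w) = u - c *: u0.
    by rewrite xE scalerDr opprD [- (c *: u0) - _]addrC addrA addrK.
  have : (N j `&` U) (x - c *: (u0 + w)).
    split; first by apply: subspaceB => //; exact: subspaceZ.
    by rewrite xc; apply: subspaceB => //; exact: subspaceZ.
  move=> /m1P[Nm1 _]; rewrite -[x](subrK (c *: (u0 + w))); apply: subspaceD => //.
    by apply: Nle Nm1; rewrite leq_maxl.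
  by apply: subspaceZ => //; apply: Nle Nu0; rewrite leq_maxr.
exists m1 => i x Nx; have [sN _ /(_ x Nx)[u [c [Uu xE]]]] := NP i.
have [c0|c0] := eqVneq c 0.
  by have [] := m1P i x; rewrite // xE c0 scale0r addr0 in Nx *.
case: noP; exists i, (c^-1 *: u); split; first exact: subspaceZ.
by rewrite -[w in _ + w]scale1r -(mulVf c0) -scalerA -scalerDr -xE; exact: subspaceZ.
Qed.

Lemma fd_subspaceP W : fd_subspace W -> subspace W.
Proof.
move=> [d [phi ->]]; split; first by exists 0; rewrite ?linear0.
by move=> c _ _ [x _ <-] [y _ <-]; exists (c *: x + y); rewrite ?linearP.
Qed.

Lemma noeth_fd W : fd_subspace W -> noeth [::] W.
Proof.
move=> [d [phi WE]].
pose w j : M := if insub j is Some i then phi (delta_mx 0 i) else 0.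
pose F k := [set x : M | exists c : nat -> L, x = \sum_(j < k) c j *: w j].
have sF k : subspace (F k).
  split; first by exists (fun=> 0); rewrite big1 // => j _; rewrite scale0r.
  move=> c _ _ [a ->] [b ->]; exists (fun j => c * a j + b j).
  by rewrite scaler_sumr -big_split; apply: eq_bigr => j _ /=; rewrite scalerDl scalerA.
have -> : W = F d.
  rewrite WE; apply/seteqP; split=> [_ [y _ <-]|_ [c ->]].
    exists (fun j => if insub j is Some i then y 0 i else 0).
    by rewrite linear_rowE; apply: eq_bigr => j _; rewrite /w valK.
  exists (\sum_(j < d) c j *: delta_mx 0 j); rewrite // linear_sum; apply: eq_bigr => j _.
  by rewrite linearZ_LR /w valK.
suff H k : noeth [::] (F k) by exact: H.
elim: k => [|k IH].
  move=> N NP _; exists 0%N => i x Nx; have [_ _ /(_ x Nx)[c ->]] := NP i.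
  by rewrite big_ord0; have [[]] := NP 0%N.
have -> : F k.+1 = [set x | exists u c, F k u /\ x = u + c *: w k]; last exact: noeth_line.
apply/seteqP; split=> [_ [c ->]|_ [_ [c [[a ->] ->]]]].
  by exists (\sum_(j < k) c j *: w j), (c k); split; [exists c | rewrite big_ord_recr].
exists (fun j => if j == k then c else a j); rewrite big_ord_recr /= eqxx; congr (_ + _).
by apply: eq_bigr => j _; rewrite ltn_eqF.
Qed.

(** * Hilbert's basis theorem for one more operator *)

Section AddOperator.
Variables (s : seq Lam) (a : Lam) (U : set M).
Hypotheses (sU : subspace U) (stU : stable s U) (nU : noeth s U).

(** The analogue of polynomials in [a] of degree less than [k] with coefficients in [U]. *)
Definition layer k := [set x : M | exists u : nat -> M,
  (forall j, U (u j)) /\ x = \sum_(j < k) act_Lam M (a *+ j) (u j)].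
Definition layers := [set x | exists k, layer k x].

Lemma layer_subspace k : subspace (layer k).
Proof.
split; first by exists (fun=> 0); split=> [_|]; [case: sU | rewrite big1 // => j _; rewrite linear0].
move=> c _ _ [u [Uu ->]] [v [Uv ->]]; exists (fun j => c *: u j + v j); split.
  by move=> j; apply: sU.2.
by rewrite scaler_sumr -big_split; apply: eq_bigr => j _; rewrite linearP.
Qed.

Lemma layer_stable k : stable s (layer k).
Proof.
move=> b bs _ [u [Uu ->]]; exists (fun j => act_Lam M b (u j)); split=> [j|]; first exact: stU.
by rewrite linear_sum; apply: eq_bigr => j _; rewrite -!act_LamD addrC.
Qed.

Lemma layerS k : layer k `<=` layer k.+1.
Proof.
move=> _ [u [Uu ->]]; exists (fun j => if (j < k)%N then u j else 0); split.
  by move=> j; case: ifP => // _; case: sU.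
rewrite big_ord_recr /= ltnn linear0 addr0; apply: eq_bigr => j _; by rewrite ltn_ord.
Qed.

Lemma layer_act k x : layer k x -> layer k.+1 (act_Lam M a x).
Proof.
move=> [u [Uu ->]]; exists (fun j => if j is j'.+1 then u j' else 0); split.
  by case=> [|j] //; case: sU.
rewrite big_ord_recl linear0 add0r linear_sum; apply: eq_bigr => j _.
by rewrite -act_LamD /= /bump add1n mulrS.
Qed.

Lemma layer_le i j : (i <= j)%N -> layer i `<=` layer j.
Proof. exact: chain_le layerS i j. Qed.

Lemma layers_subspace : subspace layers.
Proof.
split; first by exists 0%N; case: (layer_subspace 0).
move=> c x y [i xi] [j yj]; exists (maxn i j); apply: (layer_subspace _).2.
  by apply: layer_le xi; rewrite leq_maxl.
by apply: layer_le yj; rewrite leq_maxr.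
Qed.

Lemma layers_stable : stable (a :: s) layers.
Proof.
move=> b; rewrite inE => /predU1P[->|bs] x [k xk]; first by exists k.+1; exact: layer_act.
by exists k; exact: layer_stable.
Qed.

Lemma sub_layers : U `<=` layers.
Proof.
move=> x Ux; exists 1%N, (fun=> x); split=> //.
by rewrite big_ord1 mulr0n act_Lam0.
Qed.

Lemma layers_min V : subspace V -> stable [:: a] V -> U `<=` V -> layers `<=` V.
Proof.
move=> sV stV UV _ [k [u [Uu ->]]].
elim/big_rec: _ => [|j x _ Vx]; first by case: sV.
apply: subspaceD => //; elim: (j : nat) (u j) (Uu j) => [|i IH] v Uv.
  by rewrite mulr0n act_Lam0; exact: UV.
by rewrite mulrS act_LamD; apply: stV; rewrite ?mem_head //; exact: IH.
Qed.

(* Coefficients of [a^k] modulo lower order terms in elements of [N]. *)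
Definition leading (N : set M) k :=
  [set v | U v /\ exists x, layer k x /\ N (act_Lam M (a *+ k) v + x)].

Lemma leading_subspace N k : subspace N -> subspace (leading N k).
Proof.
move=> sN; have sF := layer_subspace k; split.
  split; first by case: sU.
  by exists 0; split; [case: sF | rewrite linear0 addr0; case: sN].
move=> c v v' [Uv [x [xk Nx]]] [Uv' [x' [xk' Nx']]]; split; first exact: sU.2.
exists (c *: x + x'); split; first exact: sF.2.
by rewrite linearP addrACA -scalerDr; exact: sN.2.
Qed.

Lemma leading_stable N k : stable s N -> stable s (leading N k).
Proof.
move=> stN b bs v [Uv [x [xk Nx]]]; split; first exact: stU.
exists (act_Lam M b x); split; first exact: layer_stable.
by rewrite act_Lam_equivariant -linearD; exact: stN.
Qed.

Lemma leadingS N k : stable [:: a] N -> leading N k `<=` leading N k.+1.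
Proof.
move=> stN v [Uv [x [xk Nx]]]; split=> //.
exists (act_Lam M a x); split; first exact: layer_act.
by rewrite mulrS act_LamD -linearD; apply: stN; rewrite ?mem_head.
Qed.

Lemma leading_mono N N' k : N `<=` N' -> leading N k `<=` leading N' k.
Proof. by move=> NN' v [Uv [x [xk Nx]]]; split=> //; exists x; split=> //; exact: NN'. Qed.

(** By induction on the degree: subtract an element of [N] with the same leading coefficient. *)
Lemma leading_determines N N' : subspace N -> subspace N' -> N `<=` N' -> N' `<=` layers ->
  (forall k, leading N' k `<=` leading N k) -> N' `<=` N.
Proof.
move=> sN sN' NN' N'V le; suff H k : forall x, layer k x -> N' x -> N x.
  by move=> x Nx; have [k /H] := N'V x Nx; exact.
elim: k => [|k IH] x [u [Uu xE]] N'x; first by rewrite xE big_ord0; case: sN.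
move: xE; rewrite big_ord_recr /=; set y := \sum_(_ < k) _ => xE.
have yk : layer k y by exists u.
have /le[_ [y' [yk' Ny']]] : leading N' k (u k).
  by split=> //; exists y; split=> //; rewrite addrC -xE.
rewrite -[x](subrK (act_Lam M (a *+ k) (u k) + y')); apply: subspaceD => //.
apply: IH; last by apply: subspaceB => //; exact: NN'.
rewrite xE [y + _]addrC opprD addrACA subrr add0r; apply: subspaceB => //; exact: layer_subspace.
Qed.

(** The diagonal chain [leading (N i) i] becomes stationary at some [m0], which settles the degrees
    from [m0] on; each of the finitely many lower degrees becomes stationary by itself. *)
Lemma noeth_layers : noeth (a :: s) layers.
Proof.
move=> N NP NS; have Nle := chain_le NS.
have sN i : subspace (N i) by case: (NP i).
have stNs i : stable s (N i).
  by move=> b bs; case: (NP i) => _ st _; apply: st; rewrite inE bs orbT.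
have stNa i : stable [:: a] (N i).
  by move=> b; rewrite inE => /eqP ->; case: (NP i) => _ st _; apply: st; rewrite mem_head.
have lk i k l : (k <= l)%N -> leading (N i) k `<=` leading (N i) l.
  by apply: chain_le => j; exact: leadingS.
have li i j k : (i <= j)%N -> leading (N i) k `<=` leading (N j) k.
  by move=> ij; apply: leading_mono; exact: Nle.
have lP i k : [/\ subspace (leading (N i) k), stable s (leading (N i) k) & leading (N i) k `<=` U].
  by split; [exact: leading_subspace | exact: leading_stable | move=> x []].
have [i|i|m0 m0P] := @nU (fun i => leading (N i) i).
- exact: lP.
- exact: subset_trans (li _ _ _ (leqnSn i)) (lk _ _ _ (leqnSn i)).
have /choice[mf mfP] : forall k, exists m, forall i, leading (N i) k `<=` leading (N m) k.
  by move=> k; apply: nU => i; [exact: lP | exact: li].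
exists (maxn m0 (\max_(k < m0) mf k)) => i; set m := maxn _ _.
have mP j k : leading (N j) k `<=` leading (N m) k.
  have [km|km] := ltnP k m0.
    apply: subset_trans (mfP k j) (li _ _ _ _); rewrite leq_max; apply/orP; right.
    exact: (leq_bigmax (Ordinal km)).
  apply: subset_trans (li _ _ _ (leq_maxl j k)) _.
  apply: subset_trans (lk _ _ _ (leq_maxr j k)) _.
  apply: subset_trans (m0P _) _.
  by apply: subset_trans (li _ _ _ (leq_maxl _ _)) (lk _ _ _ km).
apply: (subset_trans (Nle _ _ (leq_maxl i m))).
apply: leading_determines => //; first by apply: Nle; rewrite leq_maxr.
by case: (NP (maxn i m)).
Qed.

End AddOperator.

Lemma noeth_span (s : seq Lam) W : fd_subspace W ->
  exists V, [/\ subspace V, stable s V, noeth s V, W `<=` V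
    & forall V', subspace V' -> stable s V' -> W `<=` V' -> V `<=` V'].
Proof.
move=> Wfd; elim: s => [|a s [V [sV stV nV WV Vmin]]].
  by exists W; split=> //; [exact: fd_subspaceP | exact: noeth_fd].
exists (layers a V); split.
- exact: layers_subspace.
- exact: layers_stable.
- exact: noeth_layers.
- by apply: subset_trans WV _; exact: sub_layers.
move=> V' sV' stV' WV'; apply: layers_min => //.
  by move=> b; rewrite inE => /eqP ->; apply: stV'; rewrite mem_head.
by apply: Vmin => // b bs; apply: stV'; rewrite inE bs orbT.
Qed.

Lemma fd_subspace_add (W1 W2 : set M) : fd_subspace W1 -> fd_subspace W2 ->
  fd_subspace [set x | exists y z, [/\ W1 y, W2 z & x = y + z]].
Proof.
move=> [d [phi ->]] [e [chi ->]].
exists (d + e)%N, ((phi \o lsubmx) \+ (chi \o rsubmx)); apply/seteqP; split.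
  move=> _ [_ [_ [[y _ <-] [z _ <-] ->]]].
  by exists (row_mx y z); rewrite //= row_mxKl row_mxKr.
by move=> _ [y _ <-]; exists (phi (lsubmx y)), (chi (rsubmx y)); split; [exists (lsubmx y) | exists (rsubmx y) |].
Qed.

Lemma locally_finite_seq (s : seq M) : locally_finite (du psi) M ->
  exists W, [/\ fd_subspace W, forall x, W x -> W (act_u M x) & forall x, x \in s -> W x].
Proof.
move=> lf; elim: s => [|x s [W [Wfd Wu Ws]]].
  by have [W [Wfd Wu _]] := lf 0; exists W; split.
have [W' [W'fd W'u W'x]] := lf x.
exists [set x | exists y z, [/\ W' y, W z & x = y + z]]; split; first exact: fd_subspace_add.
  move=> _ [y [z [Wy Wz ->]]]; exists (act_u M y), (act_u M z); rewrite linearD.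
  by split=> //; [exact: W'u | exact: Wu].
move=> y; rewrite inE => /predU1P[->|ys].
  by exists x, 0; rewrite addr0; split=> //; case: (fd_subspaceP Wfd).
by exists 0, y; rewrite add0r; split; [case: (fd_subspaceP W'fd) | exact: Ws |].
Qed.

End Noetherian.

(** The list generates [Lambda] as a monoid, hence contains negatives: the layers involve only
    nonnegative multiples of an operator. *)
Lemma fg_free_seq (Lam : zmodType) : fg_free Lam -> exists s : seq Lam,
  forall P : Lam -> Prop, P 0 -> (forall a b, P a -> P b -> P (a + b)) ->
    (forall a, a \in s -> P a) -> forall a, P a.
Proof.
move=> [r [phi [g gK phiK]]]; pose b k := g (delta_mx 0 k).
exists ([seq b k | k <- enum 'I_r] ++ [seq - b k | k <- enum 'I_r]) => P P0 PD Ps a.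
have Pb k : P (b k) by apply: Ps; rewrite mem_cat map_f // mem_enum.
have PNb k : P (- b k) by apply: Ps; rewrite mem_cat; apply/orP; right; apply/mapP; exists k; rewrite ?mem_enum.
have -> : a = \sum_k b k *~ phi a 0 k.
  apply: (can_inj gK); rewrite raddf_sum [LHS]row_sum_delta; apply: eq_bigr => k _.
  by rewrite raddfMz phiK -scaler_int intz.
elim/big_ind: _ => // k _; case: (phi a 0 k) => m.
  elim: m => [|m IH]; first by rewrite mulr0z.
  by rewrite intS mulrzDr mulr1z; exact: PD.
rewrite NegzE; elim: m => [|m IH]; first by rewrite mulrN1z.
by rewrite intS opprD mulrzDr mulrN1z; exact: PD.
Qed.

Section Induction.
Variables (L : fieldType) (Lam : zmodType) (psi : zmod_aut Lam).
Hypothesis Lam_free : fg_free Lam.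

(** The [Lambda]-span of a finite-dimensional [u]-stable subspace [W] containing the generators is
    stable under [u] and its inverse, hence is all of [M]. *)
Lemma submodule_chain (M : gmod L (Delta psi)) (N : nat -> set M) : fgulf M ->
  (forall i, submodule (N i)) -> (forall i, N i `<=` N i.+1) -> exists m, forall i, N i `<=` N m.
Proof.
move=> [[t tP] lf] sN NS; have [W [Wfd Wu Wt]] := locally_finite_seq t lf.
have [s sP] := fg_free_seq Lam_free.
have [V [sV stV nV WV Vmin]] := noeth_span s Wfd.
have VL a x : V x -> V (act_Lam M a x).
  move: a x; apply: sP => [x|a b Va Vb x Vx|a as_ x]; first by rewrite act_Lam0.
    by rewrite act_LamD; apply: Va; exact: Vb.
  exact: stV.
have VT : V = [set: M].
  apply: tP => [|x xt]; last by apply: WV; exact: Wt.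
  apply: submoduleP => //; [by case: sV | by case: sV | |].
    apply: (Vmin [set x | V (act_u M x)]).
    - split=> /=; first by rewrite linear0; case: sV.
      by move=> c x y Vx Vy; rewrite linearP; exact: sV.2.
    - by move=> a _ x /= Vx; rewrite act_uLam; exact: VL.
    - by move=> x Wx /=; apply: WV; exact: Wu.
  apply: (Vmin [set x | V (act_ui M x)]).
  - split=> /=; first by rewrite linear0; case: sV.
    by move=> c x y Vx Vy; rewrite linearP; exact: sV.2.
  - move=> a _ x /= Vx; have -> : act_ui M (act_Lam M a x) = act_Lam M (aut_inv psi a) (act_ui M x).
      by apply: (can_inj (act_uK (M := M))); rewrite act_uiK act_uLam act_uiK aut_invK.
    exact: VL.
  - by move=> x Wx /=; apply: WV; exact: (fd_inverse_stable (act_uK (M := M)) Wfd Wu).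
apply: (nV N) => // i; have [N0 Nl Ng] := sN i; split=> //; last by rewrite VT.
by move=> a _ x; exact: Ng.
Qed.

(** A counterexample would give, by choice, an endless sequence of bad quotients, each a proper
    quotient of the one before. Their kernels in [M] form a strictly increasing chain of
    submodules. *)
Lemma noetherian_induction (P : gmod L (Delta psi) -> Prop) :
  (forall Q : gmod L (Delta psi), fgulf Q ->
     (forall (Q' : gmod L (Delta psi)) (p : {linear Q -> Q'}), equivariant p -> (forall z, exists y, p y = z) ->
        fgulf Q' -> (exists x, x != 0 /\ p x = 0) -> P Q') -> P Q) ->
  forall M, fgulf M -> P M.
Proof.
move=> step M gM; apply: contrapT => nPM.
pose bad (W : set M) := exists (Q : gmod L (Delta psi)) (p : {linear M -> Q}),
  [/\ equivariant p, forall z, exists y, p y = z, fgulf Q, ~ P Q & W = [set x | p x = 0]].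
have next (W : {W | bad W}) : exists W' : {W | bad W}, projT1 W `<=` projT1 W' /\ ~ (projT1 W' `<=` projT1 W).
  case: W => W [Q [p [pe pS gQ nPQ WE]]] /=.
  have [Q' [q [qe qS gQ' [[x [x0 qx]] nPQ']]]] : exists (Q' : gmod L (Delta psi)) (q : {linear Q -> Q'}),
      [/\ equivariant q, forall z, exists y, q y = z, fgulf Q' & (exists x, x != 0 /\ q x = 0) /\ ~ P Q'].
    apply: contrapT => no; apply: nPQ; apply: step => // Q' q qe qS gQ' ex.
    by apply: contrapT => nP; apply: no; exists Q', q.
  have W'bad : bad [set x | q (p x) = 0].
    exists Q', (q \o p); split=> //; first by move=> g y /=; rewrite pe qe.
    by move=> z; have [y <-] := qS z; have [w <-] := pS y; exists w.
  exists (exist _ _ W'bad) => /=; split=> [y|]; first by rewrite WE /= => ->; rewrite linear0.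
  move=> sub; have [y yx] := pS x; have := sub y; rewrite WE /= yx qx => /(_ erefl) e.
  by rewrite e eqxx in x0.
have /choice[f fP] := next.
have bad0 : bad [set x | (idfun : {linear M -> M}) x = 0].
  by exists M, idfun; split=> // z; exists z.
pose N i := iter i f (exist _ _ bad0).
have [|i|m mP] := @submodule_chain M (fun i => projT1 (N i)) gM.
- move=> i; case: (N i) => W [Q [p [pe pS gQ nPQ WE]]] /=; rewrite {}WE.
  split=> /= [|c x y px py|g x px]; first exact: linear0.
    by rewrite linearP px py scaler0 addr0.
  by rewrite pe px linear0.
- by have [] := fP (N i).
by have [_] := fP (N m); apply; exact: (mP m.+1).
Qed.

End Induction.

(** * Devissage *)

Lemma closed_prim_root (L : closedFieldType) n : [pchar L] =i pred0 -> (0 < n)%N ->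
  exists z : L, n.-primitive_root z.
Proof.
move=> charL n_gt0.
have nn0 : n%:R != 0 :> L by have /pcharf0P -> := charL; rewrite -lt0n.
have [r rE] := closed_field_poly_normal ('X^n - 1 : {poly L}).
rewrite (monicP (monicXnsubC _ n_gt0)) scale1r in rE.
suff /hasP[z _ zP] : has n.-primitive_root r by exists z.
apply: (has_prim_root n_gt0).
- by apply/allP => z; rewrite -root_prod_XsubC -rE.
- by rewrite -separable_prod_XsubC -rE separable_Xn_sub_1.
- by rewrite -ltnS -(size_prod_XsubC r id) -rE size_XnsubC.
Qed.

Lemma sum_unity (L : fieldType) (w : L) n : w ^+ n = 1 -> w != 1 -> \sum_(k < n) w ^+ k = 0.
Proof.
move=> wn w1; have := subrX1 w n; rewrite wn subrr => /esym/eqP.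
by rewrite mulf_eq0 subr_eq0 (negbTE w1) => /eqP.
Qed.

Lemma is_trace_bij (L : fieldType) (V W : lmodType L) (b : {linear V -> W})
    (f : V -> V) (g : W -> W) t :
  bijective b -> (forall x, b (f x) = g (b x)) -> is_trace g t -> is_trace f t.
Proof.
move=> bb bf [d [phi [A [bphi AP ->]]]]; exists d, (phi \o b), A; split=> //.
  exact: bij_comp.
by move=> v; rewrite /= bf AP.
Qed.

Section EulerFormula.
Variables (L : fieldType) (Lam : zmodType) (psi : zmod_aut Lam).
Implicit Types M : gmod L (Delta psi).
Variable T : gmod L (Delta psi) -> L.
Hypothesis TP : is_gen_trace T.

(** The values [t] are tied to the maps by [is_trace], which contains finite dimension, whereas
    [trace] would default to 0. *)
Definition euler_formula M : Prop := exists (N : nat) (t : nat -> L),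
  [/\ forall i, (N <= i)%N -> forall h : group_homology M i, h = 0,
      forall i, is_trace (group_homology_u M i) (t i)
    & forall s : seq (Delta psi), uniq s -> conj_transversal [set` s] ->
      \sum_(i < N) (-1) ^+ i * t i = \sum_(w <- s) gen_trace_at T w M].

Lemma sum_vanish (V : nat -> lmodType L) (g : forall i, V i -> V i) (t : nat -> L) N N' :
    (forall i, is_trace (@g i) (t i)) -> (N <= N')%N ->
    (forall i, (N <= i)%N -> forall h : V i, h = 0) ->
  \sum_(i < N') (-1) ^+ i * t i = \sum_(i < N) (-1) ^+ i * t i.
Proof.
move=> gt NN' V0; rewrite -(subnKC NN') big_split_ord /= [X in _ + X]big1 ?addr0 // => i _.
rewrite (is_trace_uniq (gt _) (is_trace0 _ (V0 _ _))) ?mulr0 //.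
exact: leq_addr.
Qed.

Lemma bar_u_fsing M i t m :
  bar_u M i (fsing t m) = fsing [ffun j => psi (t j)] (act_u M m).
Proof. exact: push_fsing. Qed.

Lemma group_homology_u_induces M i : induces (bar_u M i) (group_homology_u M i).
Proof. exact: homology_map_induces. Qed.

Lemma inducesZ (U V W : lmodType L) (f : {linear U -> V}) (g : {linear V -> W})
    (phi : V -> V) (a : homology f g -> homology f g) c :
  induces phi a -> induces (fun x => c *: phi x) (fun h => c *: a h).
Proof.
move=> ind z h zh; have := class_of_linear c (ind _ _ zh) (class_of00 f g).
by rewrite !addr0.
Qed.

Section Sequence.
Variables (n : nat) (psi_order : aut_order psi n) (psi_ell : elliptic psi).
Variables (z : L) (M' M M'' : gmod L (Delta psi)).
Variables (f : {linear M' -> M}) (p : {linear M -> M''}).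
Hypotheses (z0 : z != 0) (fp : twisted_seq z f p).
Hypotheses (gM' : fgulf M') (gM : fgulf M) (gM'' : fgulf M'').

Lemma gen_trace_at_twisted w :
  gen_trace_at T w M = z * gen_trace_at T w M' + gen_trace_at T w M''.
Proof.
exact: (gen_trace_twisted TP z0 (twisted_seq_twist (lam_part w) fp)
  (fgulf_twist _ psi_order psi_ell gM') (fgulf_twist _ psi_order psi_ell gM)
  (fgulf_twist _ psi_order psi_ell gM'')).
Qed.

(** The chain map of [M'] that corresponds to [u] on [M] is [z u], the action of [u] on
    [V (x) M']. *)
Lemma twisted_les : exists a b del,
  [/\ les_spec (d' := bar_diff M') (d := bar_diff M) (d'' := bar_diff M'')
        (bar_map f) (bar_map p) a b del,
     forall i h, a i (z *: group_homology_u M' i h) = group_homology_u M i (a i h),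
     forall i h, b i (group_homology_u M i h) = group_homology_u M'' i (b i h)
   & forall i h, del i (group_homology_u M'' i.+1 h) = z *: group_homology_u M' i (del i h)].
Proof.
have [fL fu pe ex] := fp; have pL := equivariant_Lam pe.
have [a [b [del lesP]]] := bar_les fL pL ex; exists a, b, del.
pose g' i : {linear bar_chain M' i -> bar_chain M' i} := z \*: bar_u M' i.
have ind' i := inducesZ z (@group_homology_u_induces M' i).
have gd i (x : bar_chain M i.+1) : bar_u M i (bar_diff M i x) = bar_diff M i (bar_u M i.+1 x).
  exact: bar_u_bd.
have gf i x : bar_map f i (g' i x) = bar_u M i (bar_map f i x).
  apply: (@eq_on_fsing _ _ _ _ (bar_map f i \o g' i) (bar_u M i \o bar_map f i)) => t m.
  change (bar_map f i (z *: bar_u M' i (fsing t m)) = bar_u M i (bar_map f i (fsing t m))).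
  by rewrite !bar_u_fsing -[z *: fsing _ _]linearZ_LR !bar_map_fsing bar_u_fsing fu.
have gp i x : bar_map p i (bar_u M i x) = bar_u M'' i (bar_map p i x).
  apply: (@eq_on_fsing _ _ _ _ (bar_map p i \o bar_u M i) (bar_u M'' i \o bar_map p i)) => t m.
  change (bar_map p i (bar_u M i (fsing t m)) = bar_u M'' i (bar_map p i (fsing t m))).
  by rewrite bar_map_fsing !bar_u_fsing bar_map_fsing pe.
split=> // i h.
- exact: (les_natural_a lesP gf (ind' i) (group_homology_u_induces (i := i)) h).
- exact: (les_natural_b lesP gp (group_homology_u_induces (i := i)) (group_homology_u_induces (i := i)) h).
- exact: (les_natural_del lesP gd gf gp (group_homology_u_induces (i := i.+1)) (ind' i) h).
Qed.

Lemma euler_formula_extension : euler_formula M' -> euler_formula M'' -> euler_formula M.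
Proof.
move=> [N' [t' [van' tr' R']]] [N'' [t'' [van'' tr'' R'']]].
have [a [b [del [lesP aG bG delG]]]] := twisted_les.
pose N := maxn N' N''.
have tr'z i : is_trace (z \*: group_homology_u M' i) (z * t' i).
  by apply: is_traceZ (tr' i) => x.
have vn' i : (N <= i)%N -> forall h : group_homology M' i, h = 0.
  by rewrite geq_max => /andP[Ni _]; exact: van'.
have vn'' i : (N <= i)%N -> forall h : group_homology M'' i, h = 0.
  by rewrite geq_max => /andP[_ Ni]; exact: van''.
have [t [trt van eul]] := long_exact_euler (les_ab lesP) (les_bd lesP) (les_da lesP) (les_b0 lesP)
  (G' := fun i => z \*: group_homology_u M' i) (G := group_homology_u M)
  (G'' := group_homology_u M'') aG bG delG tr'z tr'' vn' vn''.
exists N, t; split=> // s us Ss; rewrite eul.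
rewrite (sum_vanish tr'' (leq_maxr _ _) van'') (R'' _ us Ss).
under eq_bigr do rewrite mulrCA.
rewrite -mulr_sumr (sum_vanish tr' (leq_maxl _ _) van') (R' _ us Ss) mulr_sumr -big_split.
by apply: eq_bigr => w _; rewrite gen_trace_at_twisted.
Qed.

End Sequence.

Lemma euler_formula_zero n M : aut_order psi n -> elliptic psi -> (forall x : M, x = 0) -> euler_formula M.
Proof.
move=> ord ell M0; have H0 i (h : group_homology M i) : h = 0.
  have c0 (c : bar_chain M i) : c = 0 by apply: finsupp_eq => t; exact: M0.
  have [y yh] := class_of_surj h; rewrite (c0 y) in yh.
  exact: class_of_uniq yh (class_of00 _ _).
exists 0%N, (fun=> 0); split=> // [i|s us Ss]; first exact: (is_trace0 _ (@H0 i)).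
rewrite big_ord0 big1 // => w _; apply: (gen_trace_zero TP); exact: M0.
Qed.

(** Since [f] kills homology, [H_(i+1)(M'')] is an extension of [H_i(M)], with [u] scaled by [z], by
    [H_(i+1)(M)]. This bounds the homology of [M] and multiplies its Euler characteristic by 1 - z,
    the factor that additivity also gives for the generalized traces. *)
Lemma euler_formula_selfmap n z M M'' (f : {linear M -> M}) (p : {linear M -> M''}) :
    aut_order psi n -> elliptic psi -> z != 0 -> z != 1 -> twisted_seq z f p ->
    fgulf M -> fgulf M'' ->
    (forall i, induces (bar_map f i) (fun _ : group_homology M i => 0 : group_homology M i)) ->
  euler_formula M'' -> euler_formula M.
Proof.
move=> ord ell z0 z1 fp gM gM'' f0 [N [t'' [van'' tr'' R'']]].
have [a [b [del [lesP aG bG delG]]]] := twisted_les fp.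
have a0 i h : a i h = 0.
  by have [y yh] := class_of_surj h; exact: class_of_uniq (les_a lesP yh) (f0 i _ _ yh).
have [exs bij] := long_exact_short (les_ab lesP) (les_bd lesP) (les_da lesP) (les_b0 lesP) a0.
have /choice[t trt] : forall i, exists t, is_trace (group_homology_u M i) t.
  move=> i; apply: findim_trace; have fd := is_trace_findim (tr'' i).
  case: i fd => [|i] fd; first exact: findim_inj (bij_inj bij) fd.
  by case: (exs i) => binj _ _; exact: findim_inj binj fd.
have t0 : t'' 0%N = t 0%N by exact: is_trace_uniq (is_trace_bij bij (bG 0%N) (tr'' 0%N)) (trt 0%N).
have tS i : t'' i.+1 = t i.+1 + z * t i.
  apply: is_trace_uniq (tr'' i.+1) _.
  apply: (exact_trace (exs i) (fB := z \*: group_homology_u M i) (bG i.+1) (delG i) (trt i.+1)).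
  by apply: is_traceZ (trt i) => x.
have van i : (N <= i)%N -> forall h : group_homology M i, h = 0.
  move=> Ni h; case: (exs i) => _ dS _; have [h'' <-] := dS h.
  by rewrite (van'' i.+1 (leqW Ni) h'') linear0.
exists N, t; split=> // s us Ss.
have E : \sum_(i < N) (-1) ^+ i * t'' i = (1 - z) * \sum_(i < N) (-1) ^+ i * t i.
  (* One further degree, where the homology of [M''] is zero, makes both shifted sums of the [t i]
     complete. *)
  rewrite -(sum_vanish tr'' (leqnSn N) van'') big_ord_recl t0 /=.
  rewrite (eq_bigr (fun i : 'I_N => (-1) ^+ i.+1 * t i.+1 - z * ((-1) ^+ i * t i))); last first.
    by move=> i _; rewrite /bump add1n tS mulrDr; congr (_ + _); rewrite exprS mulN1r mulNr mulrCA.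
  rewrite sumrB addrA -mulr_sumr mulrBl mul1r; congr (_ - _).
  by rewrite -(sum_vanish trt (leqnSn N) van) big_ord_recl mul1r expr0 mul1r.
apply: (mulfI (x := 1 - z)); first by rewrite subr_eq0 eq_sym.
rewrite -E (R'' _ us Ss) mulr_sumr; apply: eq_bigr => w _.
have := gen_trace_at_twisted ord ell z0 fp gM gM gM'' w.
by move=> e; rewrite mulrBl mul1r {1}e addrAC subrr add0r.
Qed.

End EulerFormula.

(** * Constraints on a minimal counterexample *)

Section Step.
Variables (L : closedFieldType) (charL : [pchar L] =i pred0).
Variables (Lam : zmodType) (psi : zmod_aut Lam) (n : nat).
Hypotheses (psi_order : aut_order psi n) (psi_ell : elliptic psi).
Variable T : gmod L (Delta psi) -> L.
Hypothesis TP : is_gen_trace T.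
Variable Q : gmod L (Delta psi).
Hypothesis gQ : fgulf Q.
Hypothesis IH : forall (Q' : gmod L (Delta psi)) (p : {linear Q -> Q'}), equivariant p ->
  (forall z, exists y, p y = z) -> fgulf Q' -> (exists x, x != 0 /\ p x = 0) -> euler_formula T Q'.

Section TwistedEndo.
Variables (f : {linear Q -> Q}) (z : L).
Hypotheses (z0 : z != 0) (fL : Lam_equivariant f)
  (fu : forall x, f (z *: act_u Q x) = act_u Q (f x)).

Let fui x : f (act_ui Q x) = z *: act_ui Q (f x).
Proof. exact: twisted_ui. Qed.

Lemma image_quotient : exists (Q2 : gmod L (Delta psi)) (q2 : {linear Q -> Q2}),
  [/\ equivariant q2, forall w, exists y, q2 y = w & forall y, q2 y = 0 <-> exists x, f x = y].
Proof.
have sub : submodule [set y | exists x, f x = y].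
  apply: submoduleP => /=.
  - by exists 0; rewrite linear0.
  - by move=> c _ _ [x <-] [y <-]; exists (c *: x + y); rewrite linearP.
  - by move=> a _ [x <-]; exists (act_Lam Q a x); rewrite fL.
  - by move=> _ [x <-]; exists (z *: act_u Q x); rewrite fu.
  - move=> _ [x <-]; exists (z^-1 *: act_ui Q x).
    by rewrite linearZ_LR fui scalerA mulVf // scale1r.
by apply: quotient_ex => g x; case: sub => _ _ sg; apply: (sg g (f x)); exists x.
Qed.

Lemma twisted_endo : [\/ euler_formula T Q, forall x, f x = 0 | injective f].
Proof.
have [[x [x0 fx]]|inj] := pselect (exists x, x != 0 /\ f x = 0); last first.
  apply: Or33; apply: linear_inj => x fx; apply: contrapT => /eqP x0.
  by apply: inj; exists x.
have [[y fy]|f0] := pselect (exists y, f y != 0); last first.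
  by apply: Or32 => y; apply: contrapT => /eqP fy; apply: f0; exists y.
apply: Or31; have [Q2 [q2 [q2e q2S q20]]] := image_quotient.
have sub : submodule [set x | f x = 0].
  apply: submoduleP => /=.
  - exact: linear0.
  - by move=> c a b fa fb; rewrite linearP fa fb scaler0 addr0.
  - by move=> a b fb; rewrite fL fb linear0.
  - move=> b fb; apply: (scalerI z0); rewrite -linearZ_LR fu fb linear0 scaler0 //.
  - by move=> b fb; rewrite fui fb linear0 scaler0.
have [Q1 [q1 [q1e q1S q10]]] : exists (Q1 : gmod L (Delta psi)) (q1 : {linear Q -> Q1}),
    [/\ equivariant q1, forall w, exists y, q1 y = w
      & forall y, q1 y = 0 <-> exists x : Defs.cycle f, val x = y].
  apply: (@quotient_ex _ _ _ _ _ (val : {linear Defs.cycle f -> Q})) => g b.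
  by apply: cycle_ex; case: sub => _ _ sg; apply: sg; exact: cycleP.
have q1f b : q1 b = 0 <-> f b = 0.
  by rewrite q10; split; [case=> c <-; exact: cycleP | exact: cycle_ex].
have [|b /q1f //|fb fbE] := @linear_factor _ _ _ _ q1 f; first exact: q1S.
have fbQ2 : twisted_seq z fb q2.
  split=> //.
  - move=> a w; have [b <-] := q1S w.
    by rewrite -(equivariant_Lam q1e) !fbE fL.
  - move=> w; have [b <-] := q1S w.
    by rewrite fbE -fu -fbE; congr (fb _); rewrite linearZ_LR; congr (_ *: _); rewrite [RHS]q1e.
  split=> //.
    by apply: linear_inj => w; have [b <-] := q1S w; rewrite fbE => /q1f.
  move=> b; rewrite q20; split=> [[c <-]|[w <-]]; first by exists (q1 c).
  by have [c <-] := q1S w; exists c; rewrite fbE.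
have g1 := fgulf_surj q1e q1S gQ; have g2 := fgulf_surj q2e q2S gQ.
(* Both quotients are proper: [x] dies in the one by the kernel, [f y] in the one by the image. *)
apply: (euler_formula_extension TP psi_order psi_ell z0 fbQ2 g1 gQ g2).
  by apply: (IH q1e q1S g1); exists x; split=> //; apply/q1f.
by apply: (IH q2e q2S g2); exists (f y); split=> //; apply/q20; exists y.
Qed.

Lemma twisted_endo_inj : injective f -> z != 1 -> (exists x : Q, x != 0) ->
  (forall i, induces (bar_map f i) (fun _ : group_homology Q i => 0 : group_homology Q i)) ->
  euler_formula T Q.
Proof.
move=> finj z1 [x x0] f0; have [Q2 [q2 [q2e q2S q20]]] := image_quotient.
have g2 := fgulf_surj q2e q2S gQ.
apply: (euler_formula_selfmap TP psi_order psi_ell z0 z1 (f := f) (p := q2) _ gQ g2) => //.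
apply: (IH q2e q2S g2); exists (f x); split; last by apply/q20; exists x.
by apply: contra_neq x0 => e; apply: finj; rewrite e linear0.
Qed.

End TwistedEndo.

Section Average.
Variables (w : L) (a : Lam).
Hypotheses (wn : w ^+ n = 1) (w1 : w != 1).

(* [Lam] acts trivially on its homology, so [average] acts there by the vanishing
   sum of the powers of [w]. *)
Definition average (x : Q) : Q := \sum_(k < n) w ^+ k *: act_Lam Q (iter k psi a) x.

Lemma average_linear : linear average.
Proof.
move=> c x y; rewrite /average scaler_sumr -big_split; apply: eq_bigr => k _ /=.
by rewrite linearP scalerDr !scalerA mulrC.
Qed.

HB.instance Definition _ := GRing.isLinear.Build L Q Q *:%R average average_linear.

Let w0 : w != 0.
Proof.
case: psi_order => n0 _ _; apply: contra_eq_neq wn => ->.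
by rewrite expr0n gtn_eqF // eq_sym oner_neq0.
Qed.

Lemma average_Lam : Lam_equivariant average.
Proof.
move=> b x; rewrite /average linear_sum; apply: eq_bigr => k _.
by rewrite linearZ_LR act_Lam_equivariant.
Qed.

(** Moving [u] through a term replaces psi^k(a) by psi^(k+1)(a). The resulting cyclic shift costs
    the factor w^-1 and closes up because w and [psi] have n-th power 1. *)
Lemma average_u x : average (w^-1 *: act_u Q x) = act_u Q (average x).
Proof.
pose G k := w ^+ k *: act_Lam Q (iter k psi a) (act_u Q x).
have -> : average (w^-1 *: act_u Q x) = w^-1 *: \sum_(k < n) G k by rewrite linearZ_LR.
have -> : act_u Q (average x) = w^-1 *: \sum_(k < n) G k.+1.
  rewrite /average linear_sum scaler_sumr; apply: eq_bigr => k _.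
  by rewrite linearZ_LR act_uLam /G scalerA exprS mulrA mulVf // mul1r.
congr (_ *: _); have Gn : G n = G 0%N.
  by case: psi_order => _ psin _; rewrite /G wn psin.
case: n psi_order Gn => [[]//|m] _ Gn.
by rewrite big_ord_recl [RHS]big_ord_recr Gn addrC.
Qed.

Lemma average_homology i :
  induces (bar_map average i) (fun _ : group_homology Q i => 0 : group_homology Q i).
Proof.
move=> c h ch; have -> : bar_map average i c = \sum_(k < n) w ^+ k *: bar_map (act_Lam Q (iter k psi a)) i c.
  apply: finsupp_eq => t; rewrite finsupp_sumE bar_mapE; apply: eq_bigr => k _.
  by rewrite finsuppZE bar_mapE.
have -> : (0 : group_homology Q i) = \sum_(k < n) w ^+ k *: h.
  by rewrite -scaler_suml sum_unity // scale0r.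
elim/big_ind2: _ => [|x1 h1 x2 h2 c1 c2|k _]; first exact: class_of00.
  by have := class_of_linear 1 c1 c2; rewrite !scale1r.
have := class_of_linear (w ^+ k) (@homology_Lam_trivial _ _ i _ Q (iter k psi a) _ _ ch) (class_of00 _ _).
by rewrite !addr0.
Qed.

Lemma average_zero : (exists x : Q, x != 0) -> euler_formula T Q \/ forall x, average x = 0.
Proof.
move=> Qn0; have wV0 : w^-1 != 0 by rewrite invr_eq0.
have wV1 : w^-1 != 1 by rewrite invr_eq1.
have [gd|f0|finj] := twisted_endo wV0 average_Lam average_u; [by left | by right |].
by left; exact: (twisted_endo_inj wV0 average_Lam average_u finj wV1 Qn0 average_homology).
Qed.

End Average.

Hypothesis Q_neq0 : exists x : Q, x != 0.
Hypothesis Q_bad : ~ euler_formula T Q.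

(** Fourier inversion: [n] times the action of [b] is the sum of its averages over all n-th roots of
    unity. Only the average for the root 1 survives, and it takes the same value at [a] and
    [psi a]. *)
Lemma psi_acts_trivially a x : act_Lam Q (psi a) x = act_Lam Q a x.
Proof.
have [n0 psin _] := psi_order; have [z zP] := closed_prim_root charL n0.
have zn := prim_expr_order zP.
have avg b : n%:R *: act_Lam Q b x = \sum_(k < n) act_Lam Q (iter k psi b) x.
  transitivity (\sum_(j < n) average (z ^+ j) b x).
    rewrite /average exchange_big /= (bigD1 (Ordinal n0)) //= [X in _ + X]big1 ?addr0 => [|k k0].
      under eq_bigr do rewrite expr0 scale1r.
      by rewrite sumr_const card_ord scaler_nat.
    under eq_bigr do rewrite -exprM mulnC exprM.
    rewrite -scaler_suml sum_unity ?scale0r //; first by rewrite -exprM mulnC exprM zn expr1n.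
    by rewrite -(prim_order_dvd zP) gtnNdvd // lt0n.
  rewrite (bigD1 (Ordinal n0)) //= big1 ?addr0 => [|j j0].
    by rewrite /average; apply: eq_bigr => k _; rewrite expr0 expr1n scale1r.
  have wn : (z ^+ j) ^+ n = 1 by rewrite -exprM mulnC exprM zn expr1n.
  have w1 : z ^+ j != 1 by rewrite -(prim_order_dvd zP) gtnNdvd // lt0n.
  by have [|->] := average_zero b wn w1 Q_neq0.
have nn0 : n%:R != 0 :> L by have /pcharf0P -> := charL; rewrite -lt0n.
apply: (scalerI nn0); rewrite !avg.
case: n psin => [|m] psin; first by rewrite !big_ord0.
rewrite big_ord_recr big_ord_recl /= -iterSr psin addrC; congr (_ + _).
by apply: eq_bigr => k _; rewrite -iterSr.
Qed.

Lemma Lam_acts_scalar a : exists c, forall x, act_Lam Q a x = c *: x.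
Proof.
have [n0 _ _] := psi_order; have [x x0] := Q_neq0.
have aD k b y : act_Lam Q (iter k psi b) y = act_Lam Q b y.
  by elim: k => //= k IHk; rewrite psi_acts_trivially.
have an y : iter n (act_Lam Q a) y = y.
  have itE m : iter m (act_Lam Q a) y = act_Lam Q (\sum_(k < m) iter k psi a) y.
    elim: m => [|m IHm]; first by rewrite big_ord0 act_Lam0.
    by rewrite iterS IHm big_ord_recr /= addrC act_LamD aD.
  by rewrite itE (norm_elliptic _ psi_order psi_ell) act_Lam0.
have [||c [y [y0 yc]]] := @closed_eigen L Q (act_Lam Q a) ('X^n - 1) x x0.
- by rewrite -size_poly_eq0 size_XnsubC.
- rewrite pactB; have nX : (size ('X^n : {poly L}) <= n.+1)%N by rewrite size_polyXn.
  rewrite (pactE _ _ nX) big_ord_recr /= coefXn eqxx scale1r big1 => [|k _]; last first.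
    by rewrite coefXn ltn_eqF // scale0r.
  by rewrite /pact size_poly1 big_ord1 coef1 scale1r add0r an subrr.
exists c; pose f : {linear Q -> Q} := act_Lam Q a \- c \*: idfun.
have fE b : f b = act_Lam Q a b - c *: b by [].
have [|||f0|finj] := @twisted_endo f 1 (oner_neq0 _).
- by move=> b d; rewrite !fE linearB (linearZ_LR (act_Lam Q b)) act_Lam_equivariant.
- by move=> b; rewrite scale1r !fE linearB (linearZ_LR (act_u Q)) act_uLam psi_acts_trivially.
- by move=> /Q_bad.
- by move=> b; apply/eqP; rewrite -subr_eq0 -fE f0.
by case/eqP: y0; apply: finj; rewrite linear0 fE yc subrr.
Qed.

Lemma u_acts_scalar : exists c, c != 0 /\ forall x, act_u Q x = c *: x.
Proof.
have [x x0] := Q_neq0; have [W [Wfd Wu Wx]] := gQ.2 x.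
have [q [q0 qx]] := fd_annihilator (f := act_u Q) Wfd Wu Wx.
have [c [y [y0 yc]]] := closed_eigen x0 q0 qx.
exists c; split.
  apply: contra_neq y0 => c0; rewrite c0 scale0r in yc.
  by rewrite -[y](act_uK (M := Q)) yc linear0.
pose f : {linear Q -> Q} := act_u Q \- c \*: idfun.
have fE b : f b = act_u Q b - c *: b by [].
have [|||f0 b|finj] := @twisted_endo f 1 (oner_neq0 _).
- by move=> b d; rewrite !fE linearB (linearZ_LR (act_Lam Q b)) act_uLam psi_acts_trivially.
- by move=> b; rewrite scale1r !fE linearB (linearZ_LR (act_u Q)).
- by move=> /Q_bad.
- by apply/eqP; rewrite -subr_eq0 -fE f0.
by case/eqP: y0; apply: finj; rewrite linear0 fE yc subrr.
Qed.

End Step.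

(** * One-dimensional modules *)

Section Line.
Variables (L : closedFieldType) (charL : [pchar L] =i pred0).
Variables (Lam : zmodType) (psi : zmod_aut Lam) (n : nat).
Variables (r : nat) (phi : {additive Lam -> 'rV[int]_r}).
Hypothesis phi_bij : bijective phi.
Hypotheses (psi_order : aut_order psi n) (psi_ell : elliptic psi).
Variable T : gmod L (Delta psi) -> L.
Hypothesis TP : is_gen_trace T.

(** A line encoded so as to have the same underlying space as [lat_mod] of rank 0, whose homology is
    known. *)
Definition line : lmodType L := finsupp 'rV[int]_0 L^o.
Definition line_gen : line := fsing 0 1.
Definition line_coord : {linear line -> L^o} := lext (fun=> idfun).

Lemma line_coordK (x : line) : x = (line_coord x : L) *: line_gen.
Proof.
have scl : linear (fun y : line => (line_coord y : L) *: line_gen).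
  by move=> c y y'; rewrite linearP scalerDl scalerA.
pose g : {linear line -> line} := HB.pack (fun y : line => (line_coord y : L) *: line_gen)
  (GRing.isLinear.Build L line line *:%R _ scl).
apply: (@eq_on_fsing _ _ _ _ idfun g) => t m.
change (fsing t m = (line_coord (fsing t m) : L) *: line_gen).
have -> : line_coord (fsing t m) = m by exact: lext_fsing.
have -> : t = 0 by apply/rowP; case.
by rewrite /line_gen -linearZ_LR; congr (fsing 0 _); rewrite /= [RHS]mulr1.
Qed.

Lemma line_coord_gen : line_coord line_gen = 1.
Proof. exact: lext_fsing. Qed.

Lemma line_trace : is_trace (idfun : line -> line) 1.
Proof.
have [f bf] := has_dim_regular L.
exists 1%N, (f \o line_coord), 1%:M; split=> [|v|]; last by rewrite mxtrace1.
  apply: bij_comp bf _; apply: linear_bij => [|y].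
    by apply: linear_inj => x x0; rewrite [x]line_coordK x0 scale0r.
  by exists ((y : L) *: line_gen); rewrite linearZ_LR line_coord_gen; exact: mulr1.
by rewrite mulmx1.
Qed.

Variables (chi : Lam -> L) (c : L).
Hypotheses (chi0 : chi 0 = 1) (chiD : forall a b, chi (a + b) = chi a * chi b)
  (chipsi : forall a, chi (psi a) = chi a) (c0 : c != 0).
Definition char_mod := scal_mod line chi0 chiD chipsi c0.

Lemma fgulf_char_mod : fgulf char_mod.
Proof.
split.
  exists [:: line_gen : char_mod] => W [W0 Wl _] Wg; apply/seteqP; split=> // x _.
  rewrite [x]line_coordK -[_ *: _]addr0; apply: Wl => //.
  by apply: Wg; rewrite inE.
move=> x; exists [set: char_mod]; split=> //.
have [f /linear_inv[g [fK gK]]] := has_dim_regular L.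
have [h hE] : exists h : {linear 'rV[L]_1 -> line}, forall y, h y = (g y : L) *: line_gen.
  have [|y||h hP] := @linear_of_rel L 'rV[L]_1 line (fun y v => v = (g y : L) *: line_gen).
  - by move=> a y _ y' _ -> ->; rewrite linearP scalerDl scalerA.
  - by exists ((g y : L) *: line_gen).
  - by move=> _ ->; rewrite linear0 scale0r.
  by exists h => y; symmetry; apply/hP.
exists 1%N, h; apply/seteqP; split=> // y _.
exists (f (line_coord y)) => //; by rewrite hE fK -line_coordK.
Qed.

Lemma gen_trace_char_mod mu : T (twist mu char_mod) = chi mu * c.
Proof.
have uE x : act_u (twist mu char_mod) x = (chi mu * c) *: (idfun x : line).
  by rewrite twist_actu scal_mod_u scal_mod_Lam scalerA.
have tr := is_traceZ uE line_trace; rewrite mulr1 in tr.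
by rewrite (gen_trace_findim TP) ?(traceE tr) //; exact: is_trace_findim tr.
Qed.

(** Being [psi]-invariant, [chi] is constant on conjugacy classes. Translation by [a0] permutes the
    classes and multiplies the sum by [chi a0]. *)
Lemma sum_nontrivial_character (s : seq (Delta psi)) a0 : uniq s -> conj_transversal [set` s] ->
  chi a0 != 1 -> \sum_(w <- s) chi (lam_part w) = 0.
Proof.
move=> us [Ssub Suniq] chi1.
have cos a : Lam_coset (psi := psi) (dLam psi a * du psi)%g by exists a.
have conj_chi a a' : Lam_conj (dLam psi a * du psi)%g (dLam psi a' * du psi)%g -> chi a' = chi a.
  move/(Lam_conjE psi phi_bij) => [b bE].
  have -> : a' = a + (b - psi b).
    apply: (bij_inj phi_bij); rewrite raddfD raddfB (aut_mxE psi phi_bij).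
    by rewrite -[X in X - _]mulmx1 -mulmxBr -bE addrC subrK.
  have -> : chi (a + (b - psi b)) = chi a * chi (b - psi b) by rewrite chiD.
  suff -> : chi (b - psi b) = 1 by rewrite mulr1.
  have cb : chi (psi b) * chi (b - psi b) = chi (psi b) by rewrite -chiD addrC subrK chipsi.
  apply: (mulfI (x := chi (psi b))); last by rewrite cb mulr1.
  apply/eqP => e; have := chi0; rewrite -(subrr (psi b)) chiD e mul0r => /eqP.
  by rewrite eq_sym oner_eq0.
have /choice[rep repP] : forall w : Delta psi, exists w', w' \in s /\
    Lam_conj (dLam psi (a0 + lam_part w) * du psi)%g w'.
  by move=> w; have [w' [[]]] := Suniq _ (cos (a0 + lam_part w)); exists w'.
have repchi w : chi (lam_part (rep w)) = chi a0 * chi (lam_part w).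
  have [rs cj] := repP w; rewrite -chiD; apply: conj_chi.
  by rewrite -(Lam_cosetE (Ssub _ rs)).
have repinj : {in s &, injective rep}.
  move=> w w' ws w's e; have [rs cj] := repP w; have [_ cj'] := repP w'.
  rewrite -e in cj'; rewrite (Lam_cosetE (Ssub _ rs)) in cj cj'.
  move/(Lam_conjE psi phi_bij): cj => [b bE]; move/(Lam_conjE psi phi_bij): cj' => [b' b'E].
  have [w0 [_ w0P]] := Suniq _ (Ssub _ ws).
  have <- : w0 = w.
    apply: w0P; split=> //; rewrite (Lam_cosetE (Ssub _ ws)); apply/(Lam_conjE psi phi_bij).
    by exists 0; rewrite subrr raddf0 mul0mx.
  apply: w0P; split=> //; rewrite (Lam_cosetE (Ssub _ ws)) (Lam_cosetE (Ssub _ w's)).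
  apply/(Lam_conjE psi phi_bij); exists (b - b').
  have -> : phi (b - b') = phi b - phi b' by exact: raddfB.
  rewrite mulmxBl -bE -b'E !(raddfD phi) opprB [RHS]addrC addrA subrK.
  by rewrite opprD addrACA subrr add0r.
have ps : perm_eq (map rep s) s.
  have um : uniq (map rep s) by rewrite map_inj_in_uniq.
  apply: uniq_perm => //; have sub : {subset map rep s <= s}.
    by move=> _ /mapP[w _ ->]; case: (repP w).
  by have [] := uniq_min_size um sub; rewrite ?size_map.
have e : \sum_(w <- s) chi (lam_part w) = chi a0 * \sum_(w <- s) chi (lam_part w).
  rewrite -{1}(perm_big _ ps) big_map mulr_sumr; apply: eq_bigr => w _; exact: repchi.
apply/eqP; move/eqP: e; rewrite -subr_eq0 -{1}[\sum_(w <- s) _]mul1r -mulrBl mulf_eq0.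
by rewrite subr_eq0 eq_sym (negbTE chi1).
Qed.

Lemma euler_formula_char_mod : euler_formula T char_mod.
Proof.
have RE s : \sum_(w <- s) gen_trace_at T w char_mod = c * \sum_(w <- s) chi (lam_part w).
  by rewrite mulr_sumr; apply: eq_bigr => w _; rewrite /gen_trace_at gen_trace_char_mod mulrC.
have [[a0 chi1]|trivial] := pselect (exists a0, chi a0 != 1).
  (* On homology [a0] acts both as the identity and as the scalar [chi a0]. *)
  have H0 i (h : group_homology char_mod i) : h = 0.
    have [y yh] := class_of_surj h.
    have h1 := @homology_Lam_trivial _ _ i _ char_mod a0 _ _ yh.
    have h2 := class_of_linear (chi a0) yh (class_of00 _ _); rewrite !addr0 in h2.
    have e : bar_map (act_Lam char_mod a0) i y = chi a0 *: y.
      by apply: finsupp_eq => t; rewrite bar_mapE.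
    rewrite e in h1; have := class_of_uniq h1 h2 => /eqP.
    rewrite -subr_eq0 -{1}[h]scale1r -scalerBl scaler_eq0 subr_eq0 eq_sym (negbTE chi1).
    by move/eqP.
  exists 0%N, (fun=> 0); split=> // [i|s us Ss]; first exact: (is_trace0 _ (H0 i)).
  by rewrite big_ord0 RE (sum_nontrivial_character us Ss chi1) mulr0.
have chi1 a : chi a = 1 by apply: contrapT => /eqP h; apply: trivial; exists a.
have actL a x : act_Lam char_mod a x = x by rewrite scal_mod_Lam chi1 scale1r.
have dimH i : has_dim (group_homology char_mod i) 'C(r, i).
  have := lat_mod_homology L phi_bij i (leqnn r); rewrite subnn => dimL.
  have [||F [bF _]] := @group_homology_iso _ _ _ _ (lat_mod L phi 0) char_mod (idfun : {linear line -> line}) _ _ i.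
  - move=> a x; rewrite actL /=.
    apply: (@eq_on_fsing _ _ _ _ (act_Lam (lat_mod L phi 0) a) idfun) => t m.
    by rewrite trans_mod_fsing; congr (fsing _ m); apply/rowP; case.
  - by exists idfun.
  exact: has_dim_bij bF dimL.
have uE x : act_u char_mod x = c *: x by rewrite scal_mod_u.
have [t [tr eul]] := trivial_euler charL actL uE line_coord_gen phi_bij dimH.
exists r.+1, t; split=> // [i ri|s us Ss].
  have [f bf] := dimH i; rewrite bin_small // in f bf.
  by move=> h; apply: (bij_inj bf); apply/rowP; case.
rewrite eul RE; congr (_ * _); rewrite (eq_bigr (fun=> 1)) => [|w _]; last exact: chi1.
rewrite big_const_seq count_predT iter_addr_0.
have [s' [us' S's sz]] := transversal_seq phi_bij psi_ell Ss.
have -> : size s = size s'.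
  apply/eqP; rewrite -(uniq_size_uniq us') // => w.
  have e : [set` s] w = [set` s'] w by rewrite S's.
  by apply/idP/idP => h; [change ([set` s] w); rewrite e | change ([set` s'] w); rewrite -e].
(* The classes are counted by the absolute value of the determinant; positivity identifies it with
   the determinant itself. *)
rewrite sz -[in LHS](gtz0_abs (det_elliptic_gt0 phi_bij psi_order psi_ell)) //.
Qed.

End Line.

Section Final.
Variables (L : closedFieldType) (charL : [pchar L] =i pred0).
Variables (Lam : zmodType) (psi : zmod_aut Lam) (n : nat).
Hypotheses (Lam_free : fg_free Lam) (psi_order : aut_order psi n) (psi_ell : elliptic psi).
Variable T : gmod L (Delta psi) -> L.
Hypothesis TP : is_gen_trace T.

Lemma euler_formula_fgulf M : fgulf M -> euler_formula T M.
Proof.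
move: M; apply: noetherian_induction => // Q gQ IH; apply: contrapT => Q_bad.
have [[x0 x0_neq0]|Q0] := pselect (exists x : Q, x != 0); last first.
  apply: Q_bad; apply: (euler_formula_zero TP psi_order psi_ell) => x.
  by apply: contrapT => /eqP x0; apply: Q0; exists x.
have Q_neq0 : exists x : Q, x != 0 by exists x0.
have psiL := psi_acts_trivially charL psi_order psi_ell TP gQ IH Q_neq0 Q_bad.
have /choice[chi chiE] := Lam_acts_scalar charL psi_order psi_ell TP gQ IH Q_neq0 Q_bad.
have [c [c0 cE]] := u_acts_scalar charL psi_order psi_ell TP gQ IH Q_neq0 Q_bad.
have inj0 b d : b *: x0 = d *: x0 -> b = d.
  move/eqP; rewrite -subr_eq0 -scalerBl scaler_eq0 (negbTE x0_neq0) orbF subr_eq0.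
  by move/eqP.
have chi0 : chi 0 = 1 by apply: inj0; rewrite -chiE act_Lam0 scale1r.
have chiD a b : chi (a + b) = chi a * chi b.
  by apply: inj0; rewrite -chiE act_LamD !chiE scalerA.
have chipsi a : chi (psi a) = chi a by apply: inj0; rewrite -!chiE psiL.
have flin : linear (fun v : line L => (line_coord L v : L) *: x0).
  by move=> d v v'; rewrite linearP scalerDl scalerA.
pose P := char_mod chi0 chiD chipsi c0.
pose f : {linear P -> Q} := HB.pack (fun v : line L => (line_coord L v : L) *: x0)
  (GRing.isLinear.Build L (line L) Q *:%R _ flin).
have fE v : f v = (line_coord L v : L) *: x0 by [].
have fL : Lam_equivariant f by move=> a v; rewrite chiE scal_mod_Lam linearZ_LR.
have fu v : f (act_u P v) = act_u Q (f v) by rewrite cE scal_mod_u linearZ_LR.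
have [|Q2 [q [qe qS q0]]] := @quotient_ex _ _ _ Q _ f.
  by move=> g v; exists (gact P g v); apply: (equivariantP fL fu).
have g2 := fgulf_surj qe qS gQ.
have tw : twisted_seq 1 f q.
  split=> // [v|]; first by rewrite scale1r fu.
  split=> //; apply: linear_inj => v; rewrite fE -(scale0r x0) => /inj0 v0.
  by rewrite [v]line_coordK v0 scale0r.
have [[r phi] phi_bij] : exists rp : {r & {additive Lam -> 'rV[int]_r}}, bijective (projT2 rp).
  by have [r [phi bij]] := Lam_free; exists (existT _ r phi).
apply: Q_bad; apply: (euler_formula_extension TP psi_order psi_ell (oner_neq0 _) tw _ gQ g2).
- exact: (fgulf_char_mod chi0 chiD chipsi c0).
- exact: (euler_formula_char_mod charL phi_bij psi_order psi_ell TP chi0 chiD chipsi c0).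
(* The quotient by the line through [x0] is proper, possibly zero. *)
- apply: (IH _ q qe qS g2); exists x0; split=> //; apply/q0; exists (line_gen L).
  by rewrite fE line_coord_gen scale1r.
Qed.

End Final.

Lemma bar_u_bij (L : fieldType) (Lam : zmodType) (psi : zmod_aut Lam)
    (M : gmod L (Delta psi)) i : bijective (bar_u M i).
Proof.
exists (push (fun t : {ffun 'I_i -> Lam} => [ffun j => aut_inv psi (t j)]) (fun=> act_ui M)).
  apply: (@eq_on_fsing _ _ _ _ (push _ _ \o bar_u M i) idfun) => t m.
  rewrite /= bar_u_fsing push_fsing act_uK; congr (fsing _ m).
  by apply/ffunP => j; rewrite !ffunE aut_funK.
apply: (@eq_on_fsing _ _ _ _ (bar_u M i \o push _ _) idfun) => t m.
rewrite /= push_fsing bar_u_fsing act_uiK; congr (fsing _ m).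
by apply/ffunP => j; rewrite !ffunE aut_invK.
Qed.

(** Makes the homology a representation of the group generated by [u], not merely of a monoid. *)
Lemma group_homology_u_bij (L : fieldType) (Lam : zmodType) (psi : zmod_aut Lam)
    (M : gmod L (Delta psi)) i : bijective (group_homology_u M i).
Proof. by apply: homology_map_bij; exact: bar_u_bij. Qed.

Theorem propositionA4p6 (L : closedFieldType) (charL : [pchar L] =i pred0)
    (Lam : zmodType) (Lam_free : fg_free Lam)
    (psi : zmod_aut Lam) (n : nat) (psi_order : aut_order psi n)
    (psi_ell : elliptic psi)
    (Tr_gen : gmod L (Delta psi) -> L) (Tr_genP : is_gen_trace Tr_gen)
    (M : gmod L (Delta psi))
    (M_fg : fin_gen M) (M_lf : locally_finite (du psi) M) :
  (forall a : Lam,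
     gen_trace_at Tr_gen (dLam psi a * du psi * (dLam psi a)^-1)%g M
     = Tr_gen M)
  /\
  ((forall i, findim (group_homology M i) /\ bijective (group_homology_u M i))
   /\
   exists N : nat,
     (forall i, (N <= i)%N -> forall h : group_homology M i, h = 0) /\
     forall S : set (Delta psi), conj_transversal S ->
       finite_set S /\
       \sum_(i < N) (-1) ^+ i * trace (group_homology_u M i)
       = \sum_(w \in S) gen_trace_at Tr_gen w M).
Proof.
have gM : fgulf M by [].
split=> [a|]; first exact: (gen_trace_conj Tr_genP a psi_order psi_ell gM).
have [N [t [van tr eul]]] := euler_formula_fgulf charL Lam_free psi_order psi_ell Tr_genP gM.
split=> [i|]; first by split; [exact: is_trace_findim (tr i) | exact: group_homology_u_bij].
exists N; split=> // S Strans; have [r [phi phi_bij]] := Lam_free.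
have [s [us SE _]] := transversal_seq phi_bij psi_ell Strans.
split; first by rewrite SE; exact: finite_seq.
rewrite SE in Strans *; rewrite -(fsbig_seq _ _ us) -(eul s us Strans).
by apply: eq_bigr => i _; rewrite (traceE (tr i)).
Qed.
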